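(* Let $p\ge1$ be an integer and $\gamma\in\mathbb{R}$. Consider the $p$-th order CIP-FEM with penalty parameter $\gamma$ for the two-dimensional homogeneous Helmholtz equation $-\Delta u-k^2u=0$ on the tensor product mesh of $\mathbb{R}^2$ of size $h$, and let $\mathcal{D}$ be the $p^2\times p^2$ coefficient matrix described in the context. There exists a constant $C_0>0$ such that if $\frac{kh}{p}\le C_0$, then for each direction $\theta$ there is a discrete wave number $k_h=k_h(\theta)>0$, i.e. a solution of $\det(\mathcal{D})=0$, such that the phase difference (the upper bound of $|k-k_h|$ with respect to $\theta$) satisfies $$\sup_{\theta}|k-k_h(\theta)|=\frac12\left|\frac{1}{2p+1}\left[\frac{p!}{(2p)!}\right]^2+\gamma\right|k^{2p+1}h^{2p}+\mathcal{O}(k^{2p+3}h^{2p+2}).$$ As a consequence, taking the penalty parameter as $$\gamma=\gamma_0=-\frac{1}{2p+1}\left[\frac{p!}{(2p)!}\right]^2$$ reduces the phase difference of the CIP-FEM to $\mathcal{O}(k^{2p+3}h^{2p+2})$.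
   Context: Let $k>0$ be the wave number and $h>0$ the mesh size. $\mathbb{R}^2$ is decomposed into the closed squares $K$ of side $h$ with vertices in $h\mathbb{Z}^2$; $\mathcal{E}_h$ is the set of all edges. $V_h$ is the space of continuous functions on $\mathbb{R}^2$ whose restriction to each square is a polynomial of degree $\le p$ in each variable. Its nodes are $\bm{x}_{i,j}=(ih/p,jh/p)$, $i,j\in\mathbb{Z}$, and $\phi_{i,j}\in V_h$ is the nodal basis function equal to $1$ at $\bm{x}_{i,j}$ and $0$ at all other nodes. For $u,v\in V_h$, at least one of compact support, $$\mathcal{A}_\gamma(u,v)=\int_{\mathbb{R}^2}(\nabla u\cdot\nabla v-k^2uv)\,d\bm{x}+\sum_{e\in\mathcal{E}_h}\gamma h^{2p-1}\int_e\left[\frac{\partial^pu}{\partial\mathbf{n}^p}\right]\left[\frac{\partial^pv}{\partial\mathbf{n}^p}\right],$$ where on each edge $e$, $\mathbf{n}$ is a fixed unit normal and $[\cdot]$ is the jump (difference of the two one-sided traces) across $e$. The CIP-FEM solution $u_h\in V_h$ (source-free problem) satisfies $\mathcal{A}_\gamma(u_h,v_h)=0$ for all compactly supported $v_h\in V_h$. One seeks solutions satisfying the Bloch wave condition $u_h(\bm{x}+\bm{m}h)=e^{\mathbf{i}\bm{m}\cdot\bm{k}_hh}u_h(\bm{x})$ for all $\bm{m}\in\mathbb{Z}^2$, where $\bm{k}_h=(k_h\cos\theta,k_h\sin\theta)$ and $\mathbf{i}=\sqrt{-1}$. Testing with $\phi_{i,j}$, $0\le i,j\le p-1$, gives a linear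 system $\mathcal{D}\mathbf{U}=0$ for the values of $u_h$ at $\bm{x}_{i,j}$, $0\le i,j\le p-1$, with entries $$\mathcal{D}_{(i,j),(i',j')}=\sum_{\bm{m}=(m_1,m_2)\in\mathbb{Z}^2}e^{\mathbf{i}\bm{m}\cdot\bm{k}_hh}\mathcal{A}_\gamma(\phi_{i'+m_1p,\,j'+m_2p},\phi_{i,j})$$ (a finite sum). For given $\theta$, a discrete wave number $k_h$ is a solution of $\det(\mathcal{D})=0$. The constant $C_0$ and the constants implied in $\mathcal{O}(\cdot)$ are independent of $k$ and $h$ (they may depend on $p$ and $\gamma$). *)

(* Defs.v *)
From mathcomp Require Import all_boot all_order all_algebra.
From mathcomp Require Import all_classical all_reals all_analysis.
From mathcomp Require Import complex mxtens.
Export numFieldNormedType.Exports.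

Set Implicit Arguments.
Unset Strict Implicit.
Unset Printing Implicit Defensive.

Import Order.TTheory GRing.Theory Num.Theory.

Local Open Scope classical_set_scope.
Local Open Scope ring_scope.

Section CIPFEM.
Variable R : realType.
Implicit Types (p : nat) (gamma k h : R) (u v : R * R -> R).

Definition mesh_interval h (m : int) : set R :=
  `[m%:~R * h, (m + 1)%:~R * h].

Definition mesh_square h (m n : int) : set (R * R) :=
  mesh_interval h m `*` mesh_interval h n.

Definition fe_space p h : set (R * R -> R) :=
  [set u | continuous u /\
    forall m n : int, exists c : 'M[R]_p.+1,
      forall z, mesh_square h m n z ->
        u z = \sum_(a < p.+1) \sum_(b < p.+1) c a b * z.1 ^+ a * z.2 ^+ b].

Definition node p h (i j : int) : R * R :=
  (i%:~R * h / p%:R, j%:~R * h / p%:R).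

Definition is_nodal_basis p h (i j : int) u : Prop :=
  fe_space p h u /\
  forall i' j' : int, u (node p h i' j') = ((i' == i) && (j' == j))%:R.

(* For p, h > 0 the function singled out here exists and is unique; the first
   argument of [xget] is the default value, and is not used in that case. *)
Definition phi p h (i j : int) : R * R -> R :=
  xget (fun=> 0) [set u | is_nodal_basis p h i j u].

Definition pderiv1 n u (z : R * R) : R := derive1n n (fun x => u (x, z.2)) z.1.
Definition pderiv2 n u (z : R * R) : R := derive1n n (fun y => u (z.1, y)) z.2.

Definition jump (f : R -> R) (a : R) : R :=
  lim (f x @[x --> a^'+]) - lim (f x @[x --> a^'-]).

(* Only products of two jumps across the same edge are used below, so the
   orientation of the normal is immaterial: it is taken in the direction of the
   positive coordinate axis. *)
Definition vertical_edge_term p h u v (m n : int) : R :=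
  \int[lebesgue_measure]_(y in mesh_interval h n)
    (jump (fun x => pderiv1 p u (x, y)) (m%:~R * h) *
     jump (fun x => pderiv1 p v (x, y)) (m%:~R * h)).

Definition horizontal_edge_term p h u v (m n : int) : R :=
  \int[lebesgue_measure]_(x in mesh_interval h m)
    (jump (fun y => pderiv2 p u (x, y)) (n%:~R * h) *
     jump (fun y => pderiv2 p v (x, y)) (n%:~R * h)).

(* Partial derivatives of elements of [fe_space] may fail to exist on the mesh
   lines, where [derive1] takes an unspecified value: these lines are a null
   set. The sum over the edges is finitely supported when [u] or [v] has compact
   support. *)
Definition cip_form p gamma k h u v : R :=
  \int[(lebesgue_measure \x lebesgue_measure)%E]_z
    (pderiv1 1 u z * pderiv1 1 v z + pderiv2 1 u z * pderiv2 1 v z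
     - k ^+ 2 * u z * v z)
  + (\sum_(e \in [set: int * int])
       gamma * h ^+ (2 * p).-1 * vertical_edge_term p h u v e.1 e.2
   + \sum_(e \in [set: int * int])
       gamma * h ^+ (2 * p).-1 * horizontal_edge_term p h u v e.1 e.2).

Definition expi (a : R) : R[i] := (cos a +i* sin a)%C.

(* The pairs (i, j) with 0 <= i, j < p are numbered by [mxtens_unindex]. *)
Definition bloch_matrix p gamma k h (kh theta : R) : 'M[R[i]]_(p * p) :=
  \matrix_(r, s)
    let i : int := (mxtens_unindex r).1 in
    let j : int := (mxtens_unindex r).2 in
    let i' : int := (mxtens_unindex s).1 in
    let j' : int := (mxtens_unindex s).2 in
    \sum_(m \in [set: int * int])
      expi ((m.1%:~R * (kh * cos theta) + m.2%:~R * (kh * sin theta)) * h) *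
      (cip_form p gamma k h
         (phi p h (i' + m.1 * p%:Z) (j' + m.2 * p%:Z)) (phi p h i j))%:C%C.

Definition discrete_wave_number p gamma k h (theta kh : R) : Prop :=
  \det (bloch_matrix p gamma k h kh theta) = 0.

Definition phase_difference k (kh : R -> R) : \bar R :=
  ereal_sup [set (`|k - kh theta|)%:E | theta in [set: R]].

Definition fem_phase_coef p : R :=
  (2 * p + 1)%:R^-1 * (p`!%:R / (2 * p)`!%:R) ^+ 2.

End CIPFEM.
Arguments fem_phase_coef R p : clear implicits.

(* Main.v *)
Require Import Defs.
From HB Require Import structures.
From mathcomp Require Import all_boot all_order all_algebra.
From mathcomp Require Import all_classical all_reals all_analysis.
From mathcomp Require Import measurable_realfun.
From mathcomp Require Import complex mxtens.
From mathcomp Require Import ring lra zify.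

Set Implicit Arguments.
Unset Strict Implicit.
Unset Printing Implicit Defensive.

Import Order.TTheory GRing.Theory Num.Theory.

Local Open Scope classical_set_scope.
Local Open Scope ring_scope.

(** The mesh and the finite element space are tensor products. Let S(t) be the
matrix of stiffness plus penalty and M(t) the mass matrix of the one-dimensional
method on cells of length 1, for Bloch functions with phase t per cell. The powers
of h cancel, and with t1 = k_h h cos theta, t2 = k_h h sin theta the matrix of the
theorem is
  S(t1) (x) M(t2) + M(t1) (x) S(t2) - (kh)^2 M(t1) (x) M(t2)
([cip_formE], [bloch_matrixE]). If S(ti) Ui = li M(ti) Ui and l1 + l2 = (kh)^2,
then U1 (x) U2 is a null vector ([bloch_matrix_det]). It remains to find a branch
l = Lam(t) of eigenvalues in dimension one, and to expand it.

Eigenvectors in dimension one. On a cell, a polynomial q solves the discrete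
equation up to boundary terms if it comes with a flux s such that s' = - l q and
s - q' is orthogonal to the derivatives of the test functions, up to the penalty
([flux_pair]). Two such pairs, of opposite parity, are explicit in terms of
Legendre polynomials ([sol_low], [sol_full]). A combination of them extends to a
Bloch solution on the line once q and s are both multiplied by e^(it) across the
cell ([bloch_kernel]); the penalty then sees the phase through the number
w = 4 sin^2(t/2) only. This is possible under one scalar condition
([bloch_vector]) of the form - l g1(w, l) + w g2(w, l) = 0 with g1 = g2 = 1 at the
origin, which has a Lipschitz branch of roots ([implicit_root]).

Expansion. Green's formula against cos(t x) and sin(t x) rewrites the scalar
condition as (t^2 - l) (1 + O(t^2)) + defect = 0 ([green]). The defect consists of
moments of the residuals s - q', which are combinations of Legendre polynomials; by
Rodrigues' formula the moment of the one of degree n is of order t^n, with a Beta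
integral as coefficient. Altogether Lam(t) = t^2 + (c + gamma) t^(2p+2)
+ O(t^(2p+4)), where c is the integral of (1/4 - x^2)^p over the cell divided by
(2p)!, which is the constant of the theorem ([dispersion_relation],
[fem_phase_coefE]).

Back to dimension two, Lam(tau cos theta) + Lam(tau sin theta) equals
tau^2 + (c + gamma) g(theta) tau^(2p+2) + O(tau^(2p+4)), with
g = cos^(2p+2) + sin^(2p+2). By the intermediate value theorem it takes the value
(kh)^2 at some tau, which is k_h h ([solve_tau]); solving for tau gives
k - k_h = (c + gamma)/2 g(theta) k^(2p+1) h^(2p) + O(k^(2p+3) h^(2p+2))
([tau_expansion]). As 0 <= g <= 1 and g(0) = 1, the supremum over theta is the one
claimed ([phase_difference_bound]). *)

(** * Polynomials on the reference cell *)

Section CellPolynomials.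
Variable F : numFieldType.
Implicit Types (P Q v : {poly F}).

Definition cell_moment i : F :=
  (2^-1 ^+ i.+1 - (- 2^-1) ^+ i.+1) / i.+1%:R.

(** The integral over the reference cell [-1/2, 1/2]. It is defined on the
coefficients because the Bloch condition forces complex polynomials, while the
moment estimates are made over the reals. *)
Definition cellint P : F := \sum_(i < size P) P`_i * cell_moment i.

Lemma cellint_wide n P : (size P <= n)%N ->
  cellint P = \sum_(i < n) P`_i * cell_moment i.
Proof.
move=> sP; rewrite /cellint (big_ord_widen n (fun i => P`_i * cell_moment i)) //.
rewrite big_mkcond /=; apply: eq_bigr => i _; case: ltnP => // h.
by rewrite nth_default ?mul0r.
Qed.

Lemma cellint_is_scalar : scalar cellint.
Proof.
move=> a P Q; set n := maxn (size P) (size Q).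
have sP : (size P <= n)%N by rewrite leq_maxl.
have sQ : (size Q <= n)%N by rewrite leq_maxr.
have sR : (size (a *: P + Q)%R <= n)%N.
  by rewrite (leq_trans (size_polyD _ _)) // geq_max (leq_trans (size_scale_leq _ _)).
rewrite !(@cellint_wide n) // mulr_sumr -big_split /=; apply: eq_bigr => i _.
by rewrite coefD coefZ mulrDl mulrA.
Qed.

HB.instance Definition _ :=
  GRing.isLinear.Build F {poly F} F *%R cellint cellint_is_scalar.

Lemma cellint_deriv P : cellint P^`() = P.[2^-1] - P.[- 2^-1].
Proof.
have s1 : (size P <= (size P).+1)%N by [].
have s2 : (size P^`() <= size P)%N.
  by apply: leq_trans (size_poly _ _) _; rewrite leq_pred.
rewrite !(horner_coef_wide _ s1) (cellint_wide s2) !big_ord_recl /= !expr0.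
rewrite !mulr1 opprD addrACA subrr add0r -sumrB; apply: eq_bigr => i _.
rewrite coef_deriv /bump /= add1n /cell_moment -mulrBr mulrnAl -mulrnAr.
by congr (_ * _); rewrite -mulr_natr divfK // pnatr_eq0.
Qed.

Lemma cellint_by_parts P Q : cellint (P^`() * Q) =
  P.[2^-1] * Q.[2^-1] - P.[- 2^-1] * Q.[- 2^-1] - cellint (P * Q^`()).
Proof.
by rewrite -!hornerM -cellint_deriv derivM linearD /= addrK.
Qed.

Lemma poly_antiderivative P : exists Q, Q^`() = P.
Proof.
exists (\poly_(i < (size P).+1) (P`_i.-1 / i%:R)); apply/polyP => i.
rewrite coef_deriv coef_poly ltnS /=; case: ltnP => h.
  by rewrite -[LHS]mulr_natr divfK // pnatr_eq0.
by rewrite mul0rn nth_default.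
Qed.

Lemma derivn_top d P : (size P <= d.+1)%N -> P^`(d) = (P`_d *+ d`!)%:P.
Proof.
move=> sP; apply/polyP => i; rewrite coef_derivn coefC.
case: i => [|i] /=; [by rewrite addn0 ffactnn|].
by rewrite nth_default ?mul0rn // (leq_trans sP) // addnS ltnS leq_addr.
Qed.

Lemma derivn_small d P : (size P <= d)%N -> P^`(d) = 0.
Proof.
move=> sP; rewrite derivn_top ?(leqW sP) //.
by rewrite nth_default // mul0rn.
Qed.

Lemma derivn_derivn a b P : P^`(a)^`(b) = P^`(a + b).
Proof. by rewrite /derivn -iterD addnC. Qed.

Lemma size_derivn d P : (size P^`(d) <= size P - d)%N.
Proof.
elim: d => [|d IH]; first by rewrite subn0.
rewrite derivnS subnS; apply: leq_trans (size_poly _ _) _.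
by move: IH; case: (size _) => //= a; case: (size P - d)%N.
Qed.

Definition parity b P := P \Po (- 'X) = (-1) ^+ b *: P.

Lemma parity_horner b P x : parity b P -> P.[- x] = (-1) ^+ b * P.[x].
Proof.
by move=> /(congr1 (fun Q => Q.[x])); rewrite horner_comp !hornerE.
Qed.

Lemma parity_deriv b P : parity b P -> parity b.+1 P^`().
Proof.
rewrite /parity => /(congr1 (@deriv F)); rewrite deriv_comp derivZ derivN derivX.
by rewrite exprS mulN1r scaleNr => <-; rewrite mulrN1 opprK.
Qed.

Lemma parity_derivn b k P : parity b P -> parity (b + k) P^`(k).
Proof.
move=> h; elim: k => [|k IH]; first by rewrite addn0.
by rewrite addnS derivnS; apply: parity_deriv.
Qed.

Lemma parity_congr b c P : odd b = odd c -> parity b P -> parity c P.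
Proof. by rewrite /parity -signr_odd => ->; rewrite signr_odd. Qed.

Lemma parityD b P Q : parity b P -> parity b Q -> parity b (P + Q).
Proof. by rewrite /parity linearD scalerDr /= => -> ->. Qed.

Lemma parityZ b a P : parity b P -> parity b (a *: P).
Proof. by rewrite /parity linearZ /= => ->; rewrite !scalerA mulrC. Qed.

Lemma parity0 b : parity b 0.
Proof. by rewrite /parity linear0 scaler0. Qed.

Definition bubble n : {poly F} := ('X^2 - (4^-1)%:P) ^+ n.
(** The Legendre polynomial of the cell, without the normalising factor of
Rodrigues' formula. *)
Definition legendre n : {poly F} := (bubble n)^`(n).

Lemma size_bubble n : size (bubble n) = n.*2.+1.
Proof.
have := @size_exp F ('X^2 - (4^-1)%:P) n; rewrite size_XnsubC //= mul2n => e.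
rewrite [LHS]polySpred; first by rewrite [X in X.+1]e.
by apply/monic_neq0/monic_exp/monicXnsubC.
Qed.

Lemma bubble_monic n : bubble n \is monic.
Proof. by apply: monic_exp; apply: monicXnsubC. Qed.

Lemma parity_bubble n : parity 0 (bubble n).
Proof.
rewrite /parity scale1r /bubble rmorphXn /= linearB /= comp_polyC.
by rewrite comp_Xn_poly sqrrN.
Qed.

Lemma parity_legendre n : parity n (legendre n).
Proof. by have := parity_derivn n (parity_bubble n). Qed.

Lemma bubble_derivn k n : (k <= n)%N ->
  exists Q, (bubble n)^`(k) = bubble (n - k) * Q.
Proof.
elim: k => [|k IH] kn; first by exists 1; rewrite subn0 mulr1.
have [Q eQ] := IH (ltnW kn); rewrite derivnS eQ derivM.
have -> : (n - k = (n - k.+1).+1)%N by rewrite subnS prednK // subn_gt0.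
set j := (n - k.+1)%N.
exists (('X^2 - (4^-1)%:P)^`() *+ j.+1 * Q + ('X^2 - (4^-1)%:P) * Q^`()).
rewrite /bubble deriv_exp (exprS _ j) /= mulrDr !mulrA.
rewrite (mulrC (_ ^+ j) (_ - _)) -(mulrC (_ *+ j.+1) (_ ^+ j)).
by rewrite !mulrnAl.
Qed.

Lemma bubble_derivn_half k n : (k < n)%N ->
  (bubble n)^`(k).[2^-1] = 0 /\ (bubble n)^`(k).[- 2^-1] = 0.
Proof.
move=> kn; have [Q ->] := bubble_derivn (ltnW kn).
have h x : x ^+ 2 = 4^-1 -> (bubble (n - k) * Q).[x] = 0.
  move=> hx; rewrite /bubble !hornerE ?hx ?subrr.
  by rewrite expr0n subn_eq0 leqNgt kn mul0r.
by split; apply: h; field.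
Qed.

(** The end points are zeros of order n of the bubble, so no integration by
parts leaves a boundary term. *)
Lemma rodrigues_aux n k v : (k <= n)%N ->
  cellint ((bubble n)^`(k) * v) = (-1) ^+ k * cellint (bubble n * v^`(k)).
Proof.
elim: k v => [|k IH] v kn; first by rewrite expr0 mul1r.
have [h1 h2] := bubble_derivn_half kn.
rewrite derivnS cellint_by_parts h1 h2 !mul0r subrr sub0r IH; last exact: ltnW.
by rewrite exprS mulN1r mulNr derivSn.
Qed.

Lemma rodrigues n v :
  cellint (legendre n * v) = (-1) ^+ n * cellint (bubble n * v^`(n)).
Proof. exact: rodrigues_aux. Qed.

Lemma legendre_orth n v : (size v <= n)%N -> cellint (legendre n * v) = 0.
Proof.
by move=> sv; rewrite rodrigues derivn_small // mulr0 linear0 mulr0.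
Qed.

(** The Beta integral of (1/4 - x^2)^n over the cell. *)
Definition bubble_mass n : F := (-1) ^+ n * cellint (bubble n).

(** Integrate the derivative of x (x^2 - 1/4)^(n+1), which vanishes at both end
points. *)
Lemma bubble_mass_rec n :
  (n.*2.+3)%:R * bubble_mass n.+1 = n.+1%:R / 2 * bubble_mass n.
Proof.
have e1 : ('X * bubble n.+1)^`() = (n.*2.+3)%:R *: bubble n.+1 +
    (n.+1%:R / 2) *: bubble n.
  have eX : 'X * 'X = bubble 1 + (4^-1)%:P by rewrite /bubble expr1 subrK -expr2.
  have dB : (bubble n.+1)^`() = n.+1%:R * (2 * 'X) * bubble n.
    rewrite /bubble deriv_exp derivB derivXn derivC subr0 /= -mulr_natl mulrA.
    by congr (_ * _ * _); rewrite -mulr_natl.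
  have eS : bubble n.+1 = bubble 1 * bubble n by rewrite /bubble expr1 exprS.
  rewrite derivM derivX mul1r dB eS.
  have -> : 'X * (n.+1%:R * (2 * 'X) * bubble n) =
      n.+1%:R * 2 * (('X * 'X) * bubble n) :> {poly F} by ring.
  rewrite eX [(_ + _%:P) * _]mulrDl [_ * (_ + _%:P * _)]mulrDr addrA -!mul_polyC.
  rewrite [X in _ + X = _]mulrA.
  have -> : n.+1%:R * 2 * (4^-1)%:P = (n.+1%:R / 2)%:P :> {poly F}.
    by rewrite -[n.+1%:R]polyC_natr -(polyC_natr _ 2) -!polyCM; congr (_%:P); field.
  have -> : (n.*2.+3)%:R%:P = 1 + n.+1%:R * 2 :> {poly F}.
    by rewrite polyC_natr -natrM -natr1 addrC; congr (_ + _%:R); lia.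
  by rewrite [(1 + _) * _]mulrDl mul1r.
have := cellint_deriv ('X * bubble n.+1); rewrite e1 linearD !linearZ /=.
have [h1 h2] := @bubble_derivn_half 0 n.+1 isT.
rewrite !hornerM h1 h2 !mulr0 subrr => /eqP; rewrite addr_eq0 => /eqP h.
by rewrite /bubble_mass mulrCA h mulrN exprS mulN1r mulNr opprK mulrCA.
Qed.

Lemma bubble_massE n : bubble_mass n = n`!%:R ^+ 2 / (n.*2.+1)`!%:R.
Proof.
elim: n => [|n IH].
  rewrite [RHS](_ : _ = 1) ?fact0 ?expr1n ?divr1 //.
  rewrite /bubble_mass /bubble !expr0 mul1r.
  have := cellint_deriv 'X; rewrite derivX !hornerX opprK => ->.
  by rewrite -mulr2n -[LHS]mulr_natr mulVf // pnatr_eq0.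
have h3 : (n.*2.+3)%:R != 0 :> F by rewrite pnatr_eq0.
apply: (mulfI h3); rewrite bubble_mass_rec IH doubleS.
have h1 : (n.*2.+1)`!%:R != 0 :> F by rewrite pnatr_eq0 -lt0n fact_gt0.
rewrite (factS n) (factS n.*2.+2) (factS n.*2.+1).
move: h1; move: ((n.*2.+1)`!) (n`!) => a d h1; rewrite !natrM.
have -> : (n.*2.+2)%:R = 2 * n.+1%:R :> F by rewrite -doubleS -mul2n natrM.
have h2 : n.+1%:R != 0 :> F by rewrite pnatr_eq0.
move: (a%:R : F) (n.+1%:R : F) ((n.*2.+3)%:R : F) (d%:R : F) h1 h2 h3.
by move=> {}a b c {}d h1 h2 h3; field; rewrite h1 h2 h3.
Qed.

Lemma bubble_mass_neq0 n : bubble_mass n != 0.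
Proof.
by rewrite bubble_massE mulf_neq0 ?expf_neq0 ?invr_neq0 // pnatr_eq0 -lt0n fact_gt0.
Qed.

Lemma size_legendre n : (size (legendre n) <= n.+1)%N.
Proof.
by apply: leq_trans (size_derivn _ _) _; rewrite size_bubble -addnn -addSn addnK.
Qed.

Lemma legendre_top n : (legendre n)^`(n) = (n.*2)`!%:R%:P.
Proof.
rewrite derivn_derivn addnn derivn_top ?size_bubble //.
by have /monicP := bubble_monic n; rewrite lead_coefE size_bubble /= => ->.
Qed.

Lemma legendre_subtop n : (legendre n.+1)^`(n) = (n.+1.*2)`!%:R *: 'X.
Proof.
set P := _^`(n); have dP : P^`() = (n.+1.*2)`!%:R%:P.
  by rewrite -derivnS legendre_top.
have pP : parity 1 P.
  apply: parity_congr (parity_derivn n (parity_legendre n.+1)).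
  by rewrite addSn addnn /= odd_double.
have P0 : P.[0] = 0.
  have := parity_horner 0 pP; rewrite oppr0 expr1 mulN1r => /eqP.
  by rewrite -subr_eq0 opprK -mulr2n mulrn_eq0 => /eqP.
have sP : (size P <= 2)%N.
  apply: leq_trans (size_derivn _ _) _; rewrite leq_subLR.
  by apply: leq_trans (size_legendre _) _; rewrite addn2.
apply/polyP => -[|[|i]]; rewrite coefZ coefX /=.
- by rewrite -horner_coef0 P0 mulr0.
- by have := congr1 (fun Q : {poly F} => Q`_0) dP; rewrite coef_deriv coefC mulr1.
- by rewrite nth_default ?mulr0 // (leq_trans sP).
Qed.

(** The quotient of D^(2n) - (- lam)^n by D^2 + lam, where D is differentiation,
applied to Q. If D^(2n) Q = 0, it is a polynomial solution u of
u'' + lam u = - (- lam)^n Q: the Helmholtz equation up to a multiple of Q that is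
small with lam. *)
Fixpoint helm lam n Q : {poly F} :=
  if n is n'.+1 then (- lam) *: helm lam n' Q + Q^`(n'.*2) else 0.

Lemma helm_eq lam n Q :
  (helm lam n Q)^`(2) + lam *: helm lam n Q =
  Q^`(n.*2) - (- lam) ^+ n *: Q.
Proof.
elim: n => [|n IH].
  by rewrite [helm _ _ _]/= derivn_small ?size_poly0 // scaler0 addr0 expr0 scale1r subrr.
rewrite [helm lam n.+1 Q]/=.
rewrite derivnD derivnZ derivn_derivn addn2 -doubleS scalerDr.
have -> : (helm lam n Q)^`(2) = Q^`(n.*2) - (- lam) ^+ n *: Q - lam *: helm lam n Q.
  by rewrite -IH addrK.
rewrite exprS -!mul_polyC polyCM !polyCN; ring.
Qed.

Lemma parity_helm lam n b Q : parity b Q -> parity b (helm lam n Q).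
Proof.
move=> hQ; elim: n => [|n IH] /=; first exact: parity0.
apply: parityD; first exact: parityZ.
by apply: parity_congr (parity_derivn _ hQ); rewrite oddD odd_double addbF.
Qed.

Lemma size_helm lam n Q : (size (helm lam n Q) <= size Q)%N.
Proof.
elim: n => [|n IH] /=; first by rewrite size_poly0.
apply: leq_trans (size_polyD _ _) _; rewrite geq_max.
rewrite (leq_trans (size_scale_leq _ _)) //=.
by apply: leq_trans (size_derivn _ _) _; rewrite leq_subr.
Qed.

(** All the summands of [helm] but one differentiate Q at least twice. *)
Lemma helm_top lam n d Q : (size Q <= d.+1)%N ->
  (helm lam n.+1 Q)^`(d) = (- lam) ^+ n *: Q^`(d).
Proof.
move=> sQ; elim: n => [|n IH].
  by rewrite /= scaler0 add0r scale1r.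
rewrite -[helm lam n.+2 Q]/(- lam *: helm lam n.+1 Q + Q^`(n.+1.*2)).
rewrite derivnD derivnZ IH scalerA -exprS.
rewrite derivn_derivn [X in _ + X]derivn_small ?addr0 //.
by apply: leq_trans sQ _; rewrite doubleS /= !addSn ltnS leqW // leq_addl.
Qed.

End CellPolynomials.

(** * Galerkin solutions on one cell *)

Section ElementSolutions.
Variable F : numFieldType.
Implicit Types (P Q q s v : {poly F}) (lam eta gw : F).

(** The form of - u'' - lam u on one cell. A p-th derivative is constant on the
cell, hence its evaluation at 0. For a Bloch function the jumps at the two ends
of the cell reduce to this constant times a factor depending on the phase;
[gw] is the penalty parameter times that factor. *)
Definition cell_form p gw lam q v : F :=
  cellint (q^`() * v^`()) - lam * cellint (q * v)
  + gw * (q^`(p).[0] * v^`(p).[0]).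

Definition boundary_form s v : F := s.[2^-1] * v.[2^-1] - s.[- 2^-1] * v.[- 2^-1].

(** With s in the role of the derivative of q, the equation tested with all
polynomials of degree at most p leaves boundary terms only. Cells can then be
glued to a solution on the line by matching q and s at the common end point,
although q itself is not smooth there. *)
Definition flux_pair p gw lam q s :=
  forall v, (size v <= p.+1)%N -> cell_form p gw lam q v = boundary_form s v.

(** The solution of degree less than p. Writing P for the Legendre polynomial of
degree p, q'' + lam q is a multiple of P'; so s := q' + const P satisfies
s' = - lam q, and s - q' is orthogonal to the derivatives of the test functions.
The factor in front makes the solution 1 or x in the limit lam = 0. *)
Definition sol_low p lam : {poly F} :=
  ((p.*2)`!%:R)^-1 *: helm lam (uphalf p) (legendre F p)^`().
Definition flux_low p lam : {poly F} := (sol_low p lam)^`() +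
  ((- lam) ^+ uphalf p / (p.*2)`!%:R) *: legendre F p.

(** The solution of degree p, built in the same way from the Legendre polynomial
of degree p + 1. As its p-th derivative does not vanish, a second term is
needed: the moment of the Legendre polynomial of degree p - 1 against v' is a
multiple of the p-th derivative of v, and for the right [eta] it balances the
penalty. *)
Definition sol_full p lam eta : {poly F} :=
  ((p.+1.*2)`!%:R)^-1 *: helm lam (p./2).+1 (legendre F p.+1)^`()
  + eta *: helm lam p./2 (legendre F p.-1)^`().
Definition flux_full p lam eta : {poly F} := (sol_full p lam eta)^`() +
  (((- lam) ^+ (p./2).+1 / (p.+1.*2)`!%:R) *: legendre F p.+1
   + (eta * (- lam) ^+ p./2) *: legendre F p.-1).

Lemma size_deriv_le n P : (size P <= n.+1)%N -> (size P^`() <= n)%N.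
Proof.
by move=> h; rewrite (leq_trans (size_derivn 1 _)) // leq_subLR add1n.
Qed.

Lemma size_scale_helm a lam m n P :
  (size P <= n.+1)%N -> (size (a *: helm lam m P^`()) <= n)%N.
Proof.
move=> /size_deriv_le h; rewrite (leq_trans (size_scale_leq _ _)) //.
by rewrite (leq_trans (size_helm _ _ _)).
Qed.

Lemma size_sol_low p lam : (size (sol_low p lam) <= p)%N.
Proof. exact/size_scale_helm/size_legendre. Qed.

Lemma size_sol_full p lam eta : (0 < p)%N -> (size (sol_full p lam eta) <= p.+1)%N.
Proof.
move=> p0; rewrite (leq_trans (size_polyD _ _)) // geq_max.
rewrite size_scale_helm ?size_legendre //= size_scale_helm //.
by rewrite (leq_trans (size_legendre _ _)) // prednK // leqW.
Qed.

Lemma parity_sol_low p lam : parity p.+1 (sol_low p lam).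
Proof. by apply/parityZ/parity_helm/parity_deriv/parity_legendre. Qed.

Lemma parity_sol_full p lam eta : (0 < p)%N -> parity p (sol_full p lam eta).
Proof.
case: p => // p _; apply: parityD.
  apply/parityZ/parity_helm/(@parity_congr _ p.+3); first by rewrite /= negbK.
  exact/parity_deriv/parity_legendre.
by apply/parityZ/parity_helm/parity_deriv/parity_legendre.
Qed.

Lemma parity_flux_low p lam : parity p (flux_low p lam).
Proof.
apply: parityD; last exact/parityZ/parity_legendre.
by apply: parity_congr (parity_deriv (parity_sol_low _ _)); rewrite /= negbK.
Qed.

Lemma parity_flux_full p lam eta : (0 < p)%N -> parity p.+1 (flux_full p lam eta).
Proof.
case: p => // p _; apply: parityD; first exact/parity_deriv/parity_sol_full.
apply: parityD; first exact/parityZ/parity_legendre.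
apply: parityZ; apply: parity_congr (parity_legendre _ _) => /=.
by rewrite negbK.
Qed.

(** Since s' = - lam q, the derivative of s v integrates to the volume terms plus
the moment of the residual r = s - q' against v'. *)
Lemma flux_pairI p gw lam q s r :
  s = q^`() + r -> s^`() = - lam *: q ->
  (forall v, (size v <= p.+1)%N ->
     gw * (q^`(p).[0] * v^`(p).[0]) = cellint (r * v^`())) ->
  flux_pair p gw lam q s.
Proof.
move=> es ds hr v sv; rewrite /cell_form hr // /boundary_form -!hornerM -cellint_deriv.
rewrite derivM ds es mulrDl !linearD /= -scalerAl [cellint (_ *: _)]linearZ /=; ring.
Qed.

Lemma flux_pair_lin p gw lam (a b : F) q1 s1 q2 s2 :
  flux_pair p gw lam q1 s1 -> flux_pair p gw lam q2 s2 ->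
  flux_pair p gw lam (a *: q1 + b *: q2) (a *: s1 + b *: s2).
Proof.
move=> h1 h2 v sv; have k1 := h1 v sv; have k2 := h2 v sv.
have I2 x y P Q : cellint (x *: P + y *: Q) = x * cellint P + y * cellint Q :> F.
  by rewrite linearD !linearZ.
have -> : cell_form p gw lam (a *: q1 + b *: q2) v =
    a * cell_form p gw lam q1 v + b * cell_form p gw lam q2 v.
  rewrite /cell_form derivD !derivZ !mulrDl -!scalerAl !I2.
  by rewrite derivnD !derivnZ hornerD !hornerZ; ring.
by rewrite k1 k2 /boundary_form !hornerD !hornerZ; ring.
Qed.

Lemma helm_deriv2 n P lam : (size P <= n.*2.+1)%N ->
  (helm lam n P^`())^`()^`() =
  - lam *: helm lam n P^`() - (- lam) ^+ n *: P^`().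
Proof.
move=> sP; have := helm_eq lam n P^`().
rewrite [X in X - _]derivn_small ?size_deriv_le // sub0r.
by move=> /(canRL (addrK _)); rewrite derivSn derivn1 => ->; rewrite addrC scaleNr.
Qed.

Lemma deriv_flux_low p lam : (flux_low p lam)^`() = - lam *: sol_low p lam.
Proof.
rewrite /flux_low /sol_low !linearD !linearZ /= helm_deriv2.
  by apply/polyP => i; rewrite !(coefD, coefB, coefZ, coefN); ring.
rewrite (leq_trans (size_legendre _ _)) // ltnS.
by case: p => // p; rewrite uphalf_half; move: (odd_double_half p.+1); lia.
Qed.

Lemma deriv_flux_full p lam eta : (0 < p)%N ->
  (flux_full p lam eta)^`() = - lam *: sol_full p lam eta.
Proof.
move=> p0; rewrite /flux_full /sol_full.
have h : (p <= p./2.*2.+1)%N by move: (odd_double_half p); lia.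
move: p./2 h => m h; rewrite !derivD !derivZ !helm_deriv2.
- by apply/polyP => i; rewrite !(coefD, coefB, coefZ, coefN); ring.
- by rewrite (leq_trans (size_legendre _ _)) // prednK // (leq_trans h).
- by rewrite (leq_trans (size_legendre _ _)) // doubleS.
Qed.

Lemma flux_pair_sol_low p gw lam : flux_pair p gw lam (sol_low p lam) (flux_low p lam).
Proof.
apply: flux_pairI (erefl _) (deriv_flux_low p lam) _ => v sv.
rewrite derivn_small ?size_sol_low // horner0 mul0r mulr0 -scalerAl linearZ /=.
by rewrite legendre_orth ?mulr0 // size_deriv_le.
Qed.

Lemma sol_full_top p lam eta : (0 < p)%N ->
  (sol_full p lam eta)^`(p) = ((- lam) ^+ p./2)%:P.
Proof.
move=> p0; rewrite /sol_full derivnD !derivnZ helm_top; last exact/size_deriv_le/size_legendre.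
rewrite [X in eta *: X]derivn_small; last first.
  rewrite (leq_trans (size_helm _ _ _)) // size_deriv_le //.
  by rewrite (leq_trans (size_legendre _ _)) // prednK // leqW.
rewrite scaler0 addr0 -derivSn legendre_top scalerA -mul_polyC -polyCM.
by rewrite mulrAC mulVf ?mul1r // pnatr_eq0 -lt0n fact_gt0.
Qed.

(** By Rodrigues' formula the residual eta * legendre p.-1 contributes
eta * bubble_mass p.-1 times the p-th derivative of v; this fixes eta. *)
Lemma flux_pair_sol_full p gw lam : (0 < p)%N ->
  flux_pair p gw lam (sol_full p lam (gw / bubble_mass F p.-1))
    (flux_full p lam (gw / bubble_mass F p.-1)).
Proof.
move=> p0; apply: flux_pairI (erefl _) (deriv_flux_full _ _ p0) _ => v sv.
rewrite sol_full_top // mulrDl -!scalerAl linearD /= ![cellint (_ *: _)]linearZ /=.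
rewrite legendre_orth; last by rewrite size_deriv_le // leqW.
rewrite mulr0 add0r rodrigues.
rewrite -derivSn prednK // derivn_top //.
set c := _ *+ _; have -> : bubble F p.-1 * c%:P = c *: bubble F p.-1.
  by rewrite mulrC mul_polyC.
rewrite [cellint (_ *: _)]linearZ /= !hornerC mulrCA -/(bubble_mass F p.-1) [in RHS]mulrAC.
have := bubble_mass_neq0 F p.-1; rewrite /bubble_mass.
move: (cellint _) ((-1) ^+ _) ((- lam) ^+ _) c => B e l c h.
have [he hB] : e != 0 /\ B != 0 by move: h; rewrite mulf_eq0 negb_or => /andP[].
by field; rewrite he hB.
Qed.

Lemma helm0 n Q : helm 0 n.+1 Q = Q^`(n.*2).
Proof. by rewrite /= oppr0 scale0r add0r. Qed.

Lemma sol_limit p : (0 < p)%N ->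
  (if odd p then sol_low p 0 else sol_full p 0 0) = 1 /\
  (if odd p then sol_full p 0 0 else sol_low p 0) = 'X.
Proof.
case: p => // p _; rewrite /sol_full /sol_low -[uphalf p.+1]/(p./2).+1 scale0r addr0 !helm0.
have fN0 n : n`!%:R != 0 :> F by rewrite pnatr_eq0 -lt0n fact_gt0.
have E : (p.+1)./2 = uphalf p by [].
have hX : forall n k (a := (n.+1.*2)`!%:R : F), k.+1 = n ->
   a^-1 *: (legendre F n.+1)^`()^`(k) = 'X.
  by move=> n k a e; rewrite -derivSn e legendre_subtop scalerA mulVf ?scale1r //; apply: fN0.
have h1 : forall n k (a := (n.*2)`!%:R : F), k.+1 = n ->
   a^-1 *: (legendre F n)^`()^`(k) = 1.
  by move=> n k a e; rewrite -derivSn e legendre_top -mul_polyC -polyCM mulVf ?polyC1 //; apply: fN0.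
case: ifP => op; split.
all: try (apply: h1); try (apply: hX).
all: by move: op (odd_double_half p); rewrite ?E ?uphalf_half /=; case: (odd p); lia.
Qed.

End ElementSolutions.

(** * Lipschitz functions of two variables and implicit roots *)

Section BoxLipschitz.
Variable R : realType.
Implicit Types (g : R -> R -> R) (w l : R).

(** Lipschitz continuity on the unit box takes the place of differentiability in
the implicit function argument: it is stable under ring operations, and the
shape of the equation supplies the slope. *)
Definition lip2 g := exists2 K : R, 0 <= K & forall w l w' l',
  `|w| <= 1 -> `|l| <= 1 -> `|w'| <= 1 -> `|l'| <= 1 ->
  `|g w l - g w' l'| <= K * (`|w - w'| + `|l - l'|).

Lemma lip2_bounded g : lip2 g -> exists2 M : R, 0 <= M & forall w l,
  `|w| <= 1 -> `|l| <= 1 -> `|g w l| <= M.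
Proof.
move=> [K K0 hK]; exists (`|g 0 0| + K * 2); first by rewrite addr_ge0 ?mulr_ge0.
move=> w l hw hl; have := hK w l 0 0 hw hl; rewrite normr0 ler01 !subr0.
move=> /(_ isT isT) h; have := ler_normD (g 0 0) (g w l - g 0 0); rewrite addrC subrK.
move=> /le_trans; apply; rewrite lerD2l (le_trans h) // ler_wpM2l //; lra.
Qed.

Lemma lip2_cst c : lip2 (fun _ _ => c).
Proof. by exists 0 => // *; rewrite subrr normr0 mul0r. Qed.

Lemma lip2_fst : lip2 (fun w _ => w).
Proof. by exists 1 => // *; rewrite mul1r lerDl. Qed.

Lemma lip2_snd : lip2 (fun _ l => l).
Proof. by exists 1 => // *; rewrite mul1r lerDr. Qed.

Lemma lip2D f g : lip2 f -> lip2 g -> lip2 (fun w l => f w l + g w l).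
Proof.
move=> [K K0 hK] [L L0 hL]; exists (K + L); first exact: addr_ge0.
move=> w l w' l' a b c d; rewrite opprD addrACA (le_trans (ler_normD _ _)) //.
by rewrite mulrDl lerD ?hK ?hL.
Qed.

Lemma lip2M f g : lip2 f -> lip2 g -> lip2 (fun w l => f w l * g w l).
Proof.
move=> hf hg; have [M M0 hM] := lip2_bounded hf; have [N N0 hN] := lip2_bounded hg.
case: hf hg => [K K0 hK] [L L0 hL]; exists (K * N + M * L).
  by rewrite addr_ge0 // mulr_ge0.
move=> w l w' l' a b c d.
have -> : f w l * g w l - f w' l' * g w' l' =
  (f w l - f w' l') * g w l + f w' l' * (g w l - g w' l') by ring.
rewrite (le_trans (ler_normD _ _)) // !normrM mulrDl lerD //.
  by rewrite mulrAC ler_pM // ?hK // hN.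
by rewrite -mulrA ler_pM // ?hL // hM.
Qed.

Lemma lip2X f n : lip2 f -> lip2 (fun w l => f w l ^+ n).
Proof.
move=> hf; elim: n => [|n IH]; first exact: lip2_cst.
suff -> : (fun w l => f w l ^+ n.+1) = (fun w l => f w l * f w l ^+ n).
  exact: lip2M.
by apply/funext => w; apply/funext => l; rewrite exprS.
Qed.

Lemma lip2N f : lip2 f -> lip2 (fun w l => - f w l).
Proof.
move=> hf; suff -> : (fun w l => - f w l) = (fun w l => (-1) * f w l).
  by apply: lip2M => //; apply: lip2_cst.
by apply/funext => w; apply/funext => l; rewrite mulN1r.
Qed.

Lemma lipschitz_within_continuous (f : R -> R) (K a b : R) :
  (forall x y, a <= x <= b -> a <= y <= b -> `|f x - f y| <= K * `|x - y|) ->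
  {within `[a, b], continuous f}.
Proof.
move=> h; apply/subspace_continuousP => x /=; rewrite in_itv /= => xab.
apply/cvgrPdist_le => e e0; rewrite near_withinE.
have K1 : 0 < `|K| + 1 by rewrite ltr_wpDl.
near=> y; rewrite /= in_itv /= => yab; rewrite (le_trans (h _ _ xab yab)) //.
rewrite (@le_trans _ _ ((`|K| + 1) * `|x - y|)) //.
  rewrite ler_wpM2r // (le_trans (ler_norm _)) // lerDl //.
rewrite mulrC -ler_pdivlMr //; near: y.
apply: cvgr_dist_le; first by [].
exact: divr_gt0.
Unshelve. all: by end_near. Qed.

Section ImplicitRoot.
Variables g1 g2 : R -> R -> R.
Hypotheses (h1 : lip2 g1) (h2 : lip2 g2) (g10 : g1 0 0 = 1).
Let F w l := - l * g1 w l + w * g2 w l.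

(** As g1 0 0 = 1, the increments of F w near the origin are close to those of
l |-> - l. So F w changes sign on a small interval, and |F w l| controls the
distance from l to a root, which bounds the variation of the root with w. *)
Lemma implicit_root : exists (d K : R) (Lam : R -> R),
  [/\ 0 < d <= 1, 0 <= K,
     forall w, `|w| <= d -> F w (Lam w) = 0 /\ `|Lam w| <= 1,
     forall w, `|w| <= d -> `|Lam w| <= K * `|w| &
     forall w w', `|w| <= d -> `|w'| <= d ->
       `|Lam w - Lam w'| <= K * `|w - w'|].
Proof.
have [M M0 hM] := lip2_bounded h2.
case: h1 h2 => [K1 K10 hK1] [K2 K20 hK2].
set S := K1 + K2 + 1; have S0 : 0 < S by rewrite /S; lra.
(* Within radius r the increments of F w differ from those of - l by at most
   one half. *)
set r : R := (8 * S)^-1.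
have r0 : 0 < r by rewrite invr_gt0; lra.
have rS : r * S = 8^-1 by rewrite /r invfM -mulrA mulVf ?mulr1 // gt_eqF.
have rS' : r * K1 + r * K2 + r = 8^-1 by rewrite -rS /S; ring.
have rK1 : 0 <= r * K1 by rewrite mulr_ge0 // ltW.
have rK2 : 0 <= r * K2 by rewrite mulr_ge0 // ltW.
have r1 : r <= 1 by lra.
have mono w l l' : `|w| <= r -> `|l| <= r -> `|l'| <= r ->
    `|F w l - F w l' + (l - l')| <= 2^-1 * `|l - l'|.
  move=> hw hl hl'.
  have w1 := le_trans hw r1; have l1 := le_trans hl r1; have l1' := le_trans hl' r1.
  have -> : F w l - F w l' + (l - l') = - (l - l') * (g1 w l - 1)
      - l' * (g1 w l - g1 w l') + w * (g2 w l - g2 w l').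
    by rewrite /F; ring.
  have a1 : `|g1 w l - 1| <= 2 * (r * K1).
    have := hK1 w l 0 0 w1 l1; rewrite normr0 ler01 g10 !subr0 => /(_ isT isT).
    move=> /le_trans; apply; rewrite mulrC mulrA ler_wpM2r //; lra.
  have a2 := hK1 w l w l' w1 l1 w1 l1'; have a3 := hK2 w l w l' w1 l1 w1 l1'.
  move: a2 a3; rewrite subrr normr0 add0r => a2 a3.
  have n0 := normr_ge0 (l - l').
  have b1 : `|- (l - l') * (g1 w l - 1)| <= `|l - l'| * (2 * (r * K1)).
    by rewrite normrM normrN ler_wpM2l.
  have b2 : `|l' * (g1 w l - g1 w l')| <= (r * K1) * `|l - l'|.
    by rewrite normrM -mulrA ler_pM.
  have b3 : `|w * (g2 w l - g2 w l')| <= (r * K2) * `|l - l'|.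
    by rewrite normrM -mulrA ler_pM.
  rewrite (le_trans (ler_normD _ _)) // -lerBrDr (le_trans (ler_normB _ _)) //.
  rewrite lerBrDr; nra.
(* For |w| <= d the term w * g2 is at most r / 4: too small to change the sign
   of F w at the end points of [-r, r]. *)
set d := r / (4 * (M + 1)).
have M1 : 0 < 4 * (M + 1) by lra.
have d0 : 0 < d by rewrite divr_gt0.
have dM : d * M + d = r / 4.
  by rewrite /d; field; rewrite gt_eqF //; lra.
have dM0 : 0 <= d * M by rewrite mulr_ge0 // ltW.
have dr : d <= r by lra.
have root w : `|w| <= d -> exists l, `|l| <= r /\ F w l = 0.
  move=> hw; have hwr := le_trans hw dr; have w1 := le_trans hwr r1.
  have nr : `|r| <= 1 by rewrite ger0_norm // ltW.
  have nNr : `|- r| <= 1 by rewrite normrN.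
  have cF : {within `[- r, r], continuous (F w)}.
    apply: (@lipschitz_within_continuous _ 2) => x y hx hy.
    have m : `|F w x - F w y + (x - y)| <= 2^-1 * `|x - y|.
      by apply: mono; rewrite // ler_norml.
    have -> : F w x - F w y = F w x - F w y + (x - y) - (x - y) by ring.
    rewrite (le_trans (ler_normB _ _)) //; move: (normr_ge0 (x - y)) m; lra.
  have a1 l : `|l| <= r -> `|g1 w l - 1| <= 2 * (r * K1).
    move=> hl; have := hK1 w l 0 0 w1 (le_trans hl r1).
    rewrite normr0 ler01 g10 !subr0 => /(_ isT isT).
    move=> /le_trans; apply; rewrite mulrC mulrA ler_wpM2r //; lra.
  have a2 l : `|l| <= r -> `|w * g2 w l| <= d * M.
    by move=> hl; rewrite normrM ler_pM // hM // (le_trans hl).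
  have rr : `|r| <= r by rewrite ger0_norm // ltW.
  have rrN : `|- r| <= r by rewrite normrN.
  have f1 : F w r <= 0.
    have := a1 r rr; have := a2 r rr; rewrite !ler_norml /F; nra.
  have f2 : 0 <= F w (- r).
    have := a1 _ rrN; have := a2 _ rrN; rewrite !ler_norml /F; nra.
  have [||l] := @IVT R (F w) (- r) r 0 _ cF.
  - lra.
  - by rewrite ge_min le_max f1 f2 orbT.
  by rewrite in_itv /= => hl Fl; exists l; rewrite ler_norml.
have [Lam hLam] : exists Lam : R -> R, forall w, `|w| <= d -> `|Lam w| <= r /\ F w (Lam w) = 0.
  exists (fun w => xget 0 [set l | `|l| <= r /\ F w l = 0]) => w hw.
  by have := root w hw => -[l hl]; case: xgetP => [y _ //|/(_ l)].
have lipL w w' : `|w| <= d -> `|w'| <= d ->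
    `|Lam w - Lam w'| <= (2 * (K1 + K2 + M)) * `|w - w'|.
  move=> hw hw'; have [b1 e1] := hLam w hw; have [b2 e2] := hLam w' hw'.
  have hwr := le_trans hw dr; have w1 := le_trans hwr r1.
  have w1' := le_trans (le_trans hw' dr) r1.
  have m := mono w _ _ hwr b1 b2; rewrite e1 sub0r in m.
  have b21 := le_trans b2 r1.
  have a1 := hK1 w (Lam w') w' (Lam w') w1 b21 w1' b21.
  have a2 := hK2 w (Lam w') w' (Lam w') w1 b21 w1' b21.
  rewrite subrr normr0 addr0 in a1 a2.
  have a3 : `|F w (Lam w')| <= (K1 + K2 + M) * `|w - w'|.
    have -> : F w (Lam w') = - Lam w' * (g1 w (Lam w') - g1 w' (Lam w')) +
        (w' * (g2 w (Lam w') - g2 w' (Lam w')) + (w - w') * g2 w (Lam w')).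
      rewrite -[LHS]subr0 -e2 /F; ring.
    rewrite [leRHS]mulrDl [X in _ <= X + _]mulrDl -addrA.
    rewrite (le_trans (ler_normD _ _)) // lerD //.
      by rewrite normrM normrN -[leRHS]mul1r ler_pM.
    rewrite (le_trans (ler_normD _ _)) // lerD //.
      by rewrite normrM -[leRHS]mul1r ler_pM.
    by rewrite normrM mulrC ler_wpM2r // hM.
  have m2 : `|Lam w - Lam w'| <= 2^-1 * `|Lam w - Lam w'| + `|F w (Lam w')|.
    have {1}-> : Lam w - Lam w' = (- F w (Lam w') + (Lam w - Lam w')) + F w (Lam w') by ring.
    by rewrite (le_trans (ler_normD _ _)) // lerD2r.
  move: m2 a3; lra.
exists d, (2 * (K1 + K2 + M)), Lam; split => //.
- by rewrite d0 (le_trans dr).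
- by rewrite mulr_ge0 // !addr_ge0.
- by move=> w hw; have [a b] := hLam w hw; rewrite (le_trans a).
have L0 : Lam 0 = 0.
  have z : `|0 : R| <= d by rewrite normr0 ltW.
  have [b1 e1] := hLam 0 z; have z' : `|0 : R| <= r by rewrite normr0 ltW.
  have := mono 0 (Lam 0) 0 z' b1 z'; rewrite e1 /F !oppr0 !mul0r !addr0 subr0 add0r.
  by move=> h; apply/eqP; rewrite -normr_le0; lra.
move=> w hw; have := lipL w 0 hw; rewrite normr0 ltW // L0 !subr0; exact.
Qed.

End ImplicitRoot.
End BoxLipschitz.

(** * Integrals over the cell and elementary bounds *)

Section IntervalIntegral.
Variable R : realType.
Implicit Types (f g F : R -> R) (a b t : R) (P Q : {poly R}).
Notation mu := (@lebesgue_measure R).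

Lemma continuous_itv_integrable f a b :
  continuous f -> mu.-integrable `[a, b] (EFin \o f).
Proof.
move=> cf; apply: continuous_compact_integrable; first exact: segment_compact.
exact: continuous_subspaceT.
Qed.

Lemma Rintegral_derive F f a b : a < b -> continuous f ->
  (forall x, is_derive x (1:R) F (f x)) ->
  \int[mu]_(x in `[a, b]) f x = F b - F a.
Proof.
move=> ab cf dF; rewrite /Rintegral (@continuous_FTC2 _ f F) //.
- exact: continuous_subspaceT.
- have dd x : derivable F x 1 by have := dF x.
  have cF : continuous F by move=> x; apply/differentiable_continuous/derivable1_diffP.
  by split => //; [apply: cvg_at_right_filter; exact: cF | apply: cvg_at_left_filter; exact: cF].
- by move=> x _; rewrite derive1E; have := dF x => -[_ ->].
Qed.

Lemma is_derive_cosM t x : is_derive x (1:R) (fun y => cos (t * y)) (- (t * sin (t * x))).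
Proof.
have d : is_derive x (1:R) (fun y => t * y) t.
  by have := @is_deriveZ R R R id t x 1 1 (is_derive_id _ _); rewrite /GRing.scale /= mulr1.
have := is_derive1_comp (is_derive_cos (t * x)) d.
by rewrite mulNr mulrC.
Qed.

Lemma is_derive_sinM t x : is_derive x (1:R) (fun y => sin (t * y)) (t * cos (t * x)).
Proof.
have d : is_derive x (1:R) (fun y => t * y) t.
  by have := @is_deriveZ R R R id t x 1 1 (is_derive_id _ _); rewrite /GRing.scale /= mulr1.
have := is_derive1_comp (is_derive_sin (t * x)) d.
by rewrite mulrC.
Qed.

Lemma is_derive_mul F (G : R -> R) (x u v : R) :
  is_derive x (1:R) F u -> is_derive x (1:R) G v ->
  is_derive x (1:R) (fun y => F y * G y) (u * G x + F x * v).
Proof.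
move=> dF dG; have := @is_deriveM R R F G x 1 u v dF dG.
by rewrite /GRing.scale /= addrC (mulrC (G x)).
Qed.

Lemma is_derive_continuous F f :
  (forall x, is_derive x (1:R) F (f x)) -> continuous F.
Proof.
move=> h x; apply/differentiable_continuous/derivable1_diffP.
by have := h x; case.
Qed.

Lemma continuous_cosM t : continuous (fun y : R => cos (t * y)).
Proof. exact: is_derive_continuous (is_derive_cosM t). Qed.

Lemma continuous_sinM t : continuous (fun y : R => sin (t * y)).
Proof. exact: is_derive_continuous (is_derive_sinM t). Qed.

Lemma continuous_polyM P (g : R -> R) :
  continuous g -> continuous (fun y : R => P.[y] * g y).
Proof.
move=> cg x; apply: cvgM; [exact: continuous_horner|exact: cg].
Qed.

Definition weighted_int (g : R -> R) P := \int[mu]_(x in `[- 2^-1, 2^-1]) (P.[x] * g x).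

Lemma weighted_int_linear g a P Q : continuous g ->
  weighted_int g (a *: P + Q) = a * weighted_int g P + weighted_int g Q.
Proof.
move=> cg; rewrite /weighted_int -RintegralZl //; last first.
  exact/continuous_itv_integrable/continuous_polyM.
rewrite -RintegralD //.
- by apply: eq_Rintegral => x _; rewrite hornerD hornerZ mulrDl mulrA.
- apply: continuous_itv_integrable => x; apply: cvgM; first exact: cvg_cst.
  exact: continuous_polyM.
- exact/continuous_itv_integrable/continuous_polyM.
Qed.

Lemma weighted_int_deriv g g' P : (forall x, is_derive x (1:R) g (g' x)) -> continuous g' ->
  weighted_int g P^`() = P.[2^-1] * g 2^-1 - P.[- 2^-1] * g (- 2^-1) - weighted_int g' P.
Proof.
move=> dg cg'; have cg := is_derive_continuous dg.
apply/eqP; rewrite -subr_eq0 opprB addrA subr_eq0 addrC; apply/eqP.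
have h : - 2^-1 < 2^-1 :> R by lra.
have c : continuous (fun x => P^`().[x] * g x + P.[x] * g' x).
  by move=> x; apply: cvgD; apply: continuous_polyM.
have d x : is_derive x (1:R) (fun x => P.[x] * g x) (P^`().[x] * g x + P.[x] * g' x).
  exact: (@is_derive_mul (horner P) g x _ _ (is_derive_poly P x) (dg x)).
have := @Rintegral_derive (fun x => P.[x] * g x)
  (fun x => P^`().[x] * g x + P.[x] * g' x) _ _ h c d => /= <-.
rewrite RintegralD //; first by rewrite addrC.
- exact/continuous_itv_integrable/continuous_polyM.
- exact/continuous_itv_integrable/continuous_polyM.
Qed.

Lemma Rintegral_cell_bound f M : continuous f ->
  (forall x, - 2^-1 <= x <= 2^-1 -> `|f x| <= M) ->
  `|\int[mu]_(x in `[- 2^-1, 2^-1]) f x| <= M.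
Proof.
move=> cf hM; have i1 := @continuous_itv_integrable f (- 2^-1) 2^-1 cf.
rewrite (le_trans (le_normr_Rintegral _ i1)) //.
have cc : continuous (fun _ : R => M) by move=> x; exact: cvg_cst.
have -> : M = \int[mu]_(x in `[- 2^-1, 2^-1]) M.
  have d x : is_derive x (1:R) (fun x => M * x) M.
    have := @is_deriveZ R R R id M x 1 1 (is_derive_id _ _).
    by rewrite /GRing.scale /= mulr1.
  have h : - 2^-1 < 2^-1 :> R by lra.
  by rewrite (@Rintegral_derive (fun x => M * x) (fun _ => M) _ _ h cc d); field.
apply: le_Rintegral => //.
- apply: continuous_itv_integrable => x.
  by apply: (@cvg_norm _ R^o); exact: cf.
- exact: continuous_itv_integrable.
Qed.

(** Truncating at a fixed n, and not at the size of P, makes this bounded along a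
family of polynomials whose coefficients are bounded. *)
Definition coef_norm n P : R := \sum_(i < n) `|P`_i|.

Lemma horner_coef_norm n P x : (size P <= n)%N -> `|x| <= 1 -> `|P.[x]| <= coef_norm n P.
Proof.
move=> sP hx; rewrite (horner_coef_wide _ sP) (le_trans (ler_norm_sum _ _ _)) //.
apply: ler_sum => i _; rewrite normrM normrX -[leRHS]mulr1 ler_wpM2l //.
exact: exprn_ile1.
Qed.

Lemma weighted_int_bound g P n c : (size P <= n)%N -> continuous g -> 0 <= c ->
  (forall x, `|x| <= 1 -> `|g x| <= c) -> `|weighted_int g P| <= coef_norm n P * c.
Proof.
move=> sP cg c0 hg; apply: Rintegral_cell_bound; first exact: continuous_polyM.
move=> x hx; have x1 : `|x| <= 1 by rewrite ler_norml; lra.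
by rewrite normrM ler_pM // ?hg // horner_coef_norm.
Qed.

Lemma mvt_bound (F f : R -> R) c x : (forall x, is_derive x (1:R) F (f x)) ->
  F 0 = 0 -> (forall y, `|y| <= `|x| -> `|f y| <= c) -> `|F x| <= c * `|x|.
Proof.
move=> dF F0 hf; have cF := is_derive_continuous dF.
have [x0|x0|<-] := ltgtP 0 x; last by rewrite F0 normr0 mulr0.
- have [|z] := @MVT R F f 0 x x0 (fun z _ => dF z).
    exact: continuous_subspaceT.
  rewrite in_itv /= F0 !subr0 => hz ->; rewrite normrM ler_wpM2r //.
  apply: hf; rewrite !ger0_norm; lra.
- have [|z] := @MVT R F f x 0 x0 (fun z _ => dF z).
    exact: continuous_subspaceT.
  rewrite in_itv /= F0 !sub0r => hz e; rewrite -normrN e normrM normrN.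
  rewrite ler_wpM2r // hf // !ler0_norm; lra.
Qed.

Lemma sin_bound x : `|sin x| <= `|x| :> R.
Proof.
rewrite -[leRHS]mul1r; apply: (@mvt_bound sin cos).
- by rewrite sin0.
- by move=> y _; rewrite cos_max.
Qed.

Lemma cos_bound x : `|cos x - 1| <= x ^+ 2 :> R.
Proof.
have -> : x ^+ 2 = `|x| * `|x| by rewrite -normrM -expr2 ger0_norm // sqr_ge0.
apply: (@mvt_bound (fun x => cos x - 1) (fun x => - sin x)).
- move=> y; have := @is_deriveB R R R cos (cst 1) y 1 (- sin y) 0 (is_derive_cos y) (is_derive_cst _ _ _).
  by rewrite subr0.
- by rewrite cos0 subrr.
- by move=> y hy; rewrite normrN (le_trans (sin_bound y)).
Qed.

Lemma sin_taylor x : `|sin x - x| <= x ^+ 2 * `|x| :> R.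
Proof.
apply: (@mvt_bound (fun x => sin x - x) (fun x => cos x - 1)).
- by rewrite sin0 subrr.
- move=> y hy; rewrite (le_trans (cos_bound y)) // -(ger0_norm (sqr_ge0 y)).
  by rewrite -(ger0_norm (sqr_ge0 x)) !normrX lerXn2r ?nnegrE.
Qed.

End IntervalIntegral.

(** * Expansions at zero *)

Section Orders.
Variable R : realType.
Implicit Types (f g : R -> R) (c d t : R) (n m : nat).

Definition ordo n f := exists2 K : R, 0 <= K &
  \forall t \near (0 : R), `|f t| <= K * `|t| ^+ n.

(** The remainder skips one order. The functions to be expanded are even or odd
in t up to the remainder, and this form of expansion is kept by sums of equal
order and by products. *)
Definition asym n c f := ordo n.+2 (fun t => f t - c * t ^+ n).

Lemma ordoD n f g : ordo n f -> ordo n g -> ordo n (fun t => f t + g t).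
Proof.
move=> [K K0 hK] [L L0 hL]; exists (K + L); first exact: addr_ge0.
near=> t; rewrite (le_trans (ler_normD _ _)) // mulrDl lerD //.
  by near: t.
by near: t.
Unshelve. all: by end_near. Qed.

Lemma ordoM n m f g : ordo n f -> ordo m g -> ordo (n + m) (fun t => f t * g t).
Proof.
move=> [K K0 hK] [L L0 hL]; exists (K * L); first exact: mulr_ge0.
near=> t; rewrite normrM exprD mulrACA ler_pM //.
  by near: t.
by near: t.
Unshelve. all: by end_near. Qed.

Lemma near_le r : 0 < r -> \forall t \near (0 : R), `|t| <= r.
Proof.
move=> r0; near=> t; rewrite -normrN -sub0r; near: t.
by apply: cvgr_dist_le.
Unshelve. all: by end_near. Qed.

Lemma ordoW n m f : (n <= m)%N -> ordo m f -> ordo n f.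
Proof.
move=> nm [K K0 hK]; exists K => //; have h1 := near_le (@ltr01 R).
near=> t; have -> : `|f t| <= K * `|t| ^+ n; last by [].
have h : `|t| <= 1 by near: t.
rewrite (@le_trans _ _ (K * `|t| ^+ m)) //; first by near: t.
by rewrite ler_wpM2l // ler_wiXn2l.
Unshelve. all: by end_near. Qed.

Lemma ordo_small n f e : ordo n.+1 f -> 0 < e -> \forall t \near (0 : R), `|f t| <= e.
Proof.
move=> [K K0 hK] e0; have r0 : 0 < e / (K + 1) by rewrite divr_gt0 //; lra.
have h1 := near_le r0; have h2 := near_le (@ltr01 R).
near=> t.
have a1 : `|f t| <= K * `|t| ^+ n.+1 by near: t.
have a2 : `|t| <= e / (K + 1) by near: t.
have a3 : `|t| <= 1 by near: t.
rewrite (le_trans a1) // (@le_trans _ _ ((K + 1) * `|t|)) //.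
  by rewrite ler_pM ?exprn_ge0 ?lerDl // exprS -[leRHS]mulr1 ler_wpM2l // exprn_ile1.
by rewrite mulrC -ler_pdivlMr //; lra.
Unshelve. all: by end_near. Qed.

Lemma ordo_cst c : ordo 0 (fun=> c).
Proof. by exists `|c| => //; near=> t; rewrite mulr1. Unshelve. all: by end_near. Qed.

Lemma ordo_exp n : ordo n (fun t => t ^+ n).
Proof.
by exists 1 => //; near=> t; rewrite mul1r normrX. Unshelve. all: by end_near. Qed.

Lemma ordo0 n : ordo n (fun=> 0).
Proof.
by exists 0 => //; near=> t; rewrite normr0 mul0r. Unshelve. all: by end_near. Qed.

Lemma ordo_near n f g : (\forall t \near (0 : R), f t = g t) -> ordo n f -> ordo n g.
Proof.
move=> e [K K0 hK]; exists K => //; near=> t.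
have <- : f t = g t by near: t.
by near: t.
Unshelve. all: by end_near. Qed.

Lemma ordo_eq n f g : f =1 g -> ordo n f -> ordo n g.
Proof. by move=> e; apply: ordo_near; near=> t. Unshelve. all: by end_near. Qed.

Lemma asym_near n c f g : (\forall t \near (0 : R), f t = g t) -> asym n c f -> asym n c g.
Proof.
move=> e; apply: ordo_near; near=> t; congr (_ - _); by near: t.
Unshelve. all: by end_near. Qed.

Lemma asym_ordo n c f : asym n c f -> ordo n f.
Proof.
move=> h; have h1 : ordo n (fun t => c * t ^+ n).
  exact: (ordoM (ordo_cst c) (ordo_exp n)).
apply: (ordo_eq _ (ordoD (ordoW _ h) h1)); last by rewrite leqW.
by move=> t /=; rewrite subrK.
Qed.

Lemma asymD n c d f g : asym n c f -> asym n d g -> asym n (c + d) (fun t => f t + g t).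
Proof.
by move=> hf hg; apply: (ordo_eq _ (ordoD hf hg)) => t /=; ring.
Qed.

Lemma asymM n m c d f g : asym n c f -> asym m d g ->
  asym (n + m) (c * d) (fun t => f t * g t).
Proof.
move=> hf hg; have h1 := ordoM hf (asym_ordo hg).
have h2 := ordoM (ordoM (ordo_cst c) (ordo_exp n)) hg.
rewrite add0n !addnS !addSn in h1 h2.
by apply: (ordo_eq _ (ordoD h1 h2)) => t /=; rewrite exprD; ring.
Qed.

Lemma asym_cst c : asym 0 c (fun=> c).
Proof. by apply: (ordo_eq _ (ordo0 _)) => t; rewrite mulr1 subrr. Qed.

Lemma asym_id : asym 1 1 id.
Proof. by apply: (ordo_eq _ (ordo0 _)) => t; rewrite mul1r subrr. Qed.

Lemma asymX n c f k : asym n c f -> asym (k * n) (c ^+ k) (fun t => f t ^+ k).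
Proof.
move=> h; elim: k => [|k IH]; first exact: asym_cst.
rewrite mulSn exprS.
have := asymM h IH; apply: ordo_eq => t /=; by rewrite -exprS.
Qed.

Lemma ordo_asym0 n f : ordo n.+2 f -> asym n 0 f.
Proof. by apply: ordo_eq => t; rewrite mul0r subr0. Qed.

Lemma asym_weaken n c f : asym n.+2 c f -> asym n 0 f.
Proof. by move/asym_ordo/ordo_asym0. Qed.

(** Near 0, g stays above 1/2, so that dividing by it costs a factor 2 in the
remainder. *)
Lemma asym_div n c f g : asym n c (fun t => f t * g t) -> asym 0 1 g -> asym n c f.
Proof.
move=> hfg hg.
have h3 := ordoM (ordoM (ordo_cst c) (ordo_exp n)) hg.
rewrite add0n addnS addn1 in h3.
have [K K0 hK] : ordo n.+2 (fun t => (f t - c * t ^+ n) * g t).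
  apply: (ordo_eq _ (ordoD hfg (ordoM (ordo_cst (-1)) h3))) => t /=.
  by rewrite expr0; ring.
have hg2 : \forall t \near (0 : R), 2^-1 <= `|g t|.
  have h2 : 0 < 2^-1 :> R by lra.
  have h1 := ordo_small hg h2; near=> t.
  have : `|g t - 1 * t ^+ 0| <= 2^-1 by near: t.
  rewrite expr0 mulr1; have := ler_normD (g t) (1 - g t).
  have -> : g t + (1 - g t) = 1 by ring.
  rewrite normr1 (distrC 1); lra.
exists (2 * K); first by rewrite mulr_ge0.
near=> t.
have b1 : `|(f t - c * t ^+ n) * g t| <= K * `|t| ^+ n.+2 by near: t.
have b2 : 2^-1 <= `|g t| by near: t.
rewrite normrM in b1; have b3 := ler_wpM2l (normr_ge0 (f t - c * t ^+ n)) b2.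
move: b1 b3; lra.
Unshelve. all: by end_near. Qed.

Lemma lip2_ordo h (w l : R -> R) : lip2 h -> ordo 2 w -> ordo 2 l ->
  ordo 2 (fun t => h (w t) (l t) - h 0 0).
Proof.
move=> [K K0 hK] hw hl; have sw := ordo_small hw ltr01.
have sl := ordo_small hl ltr01.
case: hw hl => [A A0 hA] [B B0 hB]; exists (K * (A + B)).
  by rewrite mulr_ge0 // addr_ge0.
near=> t.
have a1 : `|w t| <= 1 by near: t.
have a2 : `|l t| <= 1 by near: t.
rewrite (le_trans (hK _ _ _ _ a1 a2 _ _)) ?normr0 // !subr0 -mulrA ler_wpM2l //.
by rewrite mulrDl lerD //; near: t.
Unshelve. all: by end_near. Qed.

End Orders.

(** * Moments against plane waves *)

Section LinearFunctionals.
Variable R : realType.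
Implicit Types (P Q : {poly R}) (Lin : {poly R} -> R).

Definition linear_fun Lin := forall a P Q, Lin (a *: P + Q) = a * Lin P + Lin Q.

Lemma linear_fun0 Lin : linear_fun Lin -> Lin 0 = 0.
Proof.
move=> h; have := h 1 0 0; rewrite scaler0 addr0 mul1r => /eqP.
by rewrite -subr_eq0 opprD addNKr oppr_eq0 => /eqP.
Qed.

Lemma linear_funZ Lin a P : linear_fun Lin -> Lin (a *: P) = a * Lin P.
Proof. by move=> h; rewrite -[a *: P]addr0 h linear_fun0 // addr0. Qed.

Lemma linear_funD Lin P Q : linear_fun Lin -> Lin (P + Q) = Lin P + Lin Q.
Proof. by move=> h; rewrite -[P]scale1r h mul1r scale1r. Qed.

Lemma linear_horner x : linear_fun (fun P => P.[x]).
Proof. by move=> a P Q; rewrite hornerD hornerZ. Qed.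

Lemma linear_coef i : linear_fun (fun P => P`_i).
Proof. by move=> a P Q; rewrite coefD coefZ. Qed.

Lemma linear_cellint : linear_fun (@cellint R).
Proof. by move=> a P Q; rewrite linearP. Qed.

Lemma linear_deriv Lin : linear_fun Lin -> linear_fun (fun P => Lin P^`()).
Proof. by move=> h a P Q; rewrite derivD derivZ h. Qed.

End LinearFunctionals.

Section TrigMoments.
Variable R : realType.
Implicit Types (P Q : {poly R}) (t l : R).

Definition cos_moment t P := weighted_int (fun x => cos (t * x)) P.
Definition sin_moment t P := weighted_int (fun x => sin (t * x)) P.

Lemma cos_moment_linear t : linear_fun (cos_moment t).
Proof. by move=> a P Q; exact/weighted_int_linear/continuous_cosM. Qed.

Lemma sin_moment_linear t : linear_fun (sin_moment t).
Proof. by move=> a P Q; exact/weighted_int_linear/continuous_sinM. Qed.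

Lemma cos_momentD t P Q : cos_moment t (P + Q) = cos_moment t P + cos_moment t Q.
Proof. exact/linear_funD/cos_moment_linear. Qed.

Lemma sin_momentD t P Q : sin_moment t (P + Q) = sin_moment t P + sin_moment t Q.
Proof. exact/linear_funD/sin_moment_linear. Qed.

Lemma cos_momentZ t a P : cos_moment t (a *: P) = a * cos_moment t P.
Proof. exact/linear_funZ/cos_moment_linear. Qed.

Lemma sin_momentZ t a P : sin_moment t (a *: P) = a * sin_moment t P.
Proof. exact/linear_funZ/sin_moment_linear. Qed.

Lemma weighted_int_scale c (g : R -> R) P : continuous g ->
  weighted_int (fun x => c * g x) P = c * weighted_int g P.
Proof.
move=> cg; rewrite /weighted_int -RintegralZl //; last first.
  exact/continuous_itv_integrable/continuous_polyM.
by apply: eq_Rintegral => x _; rewrite mulrCA.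
Qed.

Lemma cos_moment_deriv t P : cos_moment t P^`() =
  (P.[2^-1] - P.[- 2^-1]) * cos (t / 2) + t * sin_moment t P.
Proof.
rewrite /cos_moment (weighted_int_deriv _ (is_derive_cosM t)); last first.
  move=> x; apply: cvgN; apply: cvgM; first exact: cvg_cst.
  exact: continuous_sinM.
rewrite mulrN cosN mulrBl /sin_moment -weighted_int_scale; last exact: continuous_sinM.
congr (_ + _).
have -> : (fun x => - (t * sin (t * x))) = (fun x => (-1) * (t * sin (t * x))).
  by apply/funext => x; rewrite mulN1r.
rewrite [in LHS]weighted_int_scale ?mulN1r ?opprK // => x.
apply: cvgM; first exact: cvg_cst.
exact: continuous_sinM.
Qed.

Lemma sin_moment_deriv t P : sin_moment t P^`() =
  (P.[2^-1] + P.[- 2^-1]) * sin (t / 2) - t * cos_moment t P.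
Proof.
rewrite /sin_moment (weighted_int_deriv _ (is_derive_sinM t)); last first.
  move=> x; apply: cvgM; first exact: cvg_cst.
  exact: continuous_cosM.
rewrite mulrN sinN mulrN opprK mulrDl; congr (_ - _).
by rewrite weighted_int_scale //; apply: continuous_cosM.
Qed.

Lemma cos_moment0 P : cos_moment 0 P = cellint P.
Proof.
have [Q <-] := poly_antiderivative P.
by rewrite cos_moment_deriv cellint_deriv !mul0r cos0 mulr1 addr0.
Qed.

Lemma cos_moment_bound n t P : (size P <= n)%N ->
  `|cos_moment t P - cellint P| <= coef_norm n P * t ^+ 2.
Proof.
move=> sP; rewrite -cos_moment0.
have -> : cos_moment t P - cos_moment 0 P =
    weighted_int (fun x => cos (t * x) - 1) P.
  rewrite /cos_moment /weighted_int -RintegralB //.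
  - apply: eq_Rintegral => x _; rewrite mul0r cos0; ring.
  - exact/continuous_itv_integrable/continuous_polyM/continuous_cosM.
  - exact/continuous_itv_integrable/continuous_polyM/continuous_cosM.
apply: weighted_int_bound => //; last 2 first.
- exact: sqr_ge0.
- move=> x hx; rewrite (le_trans (cos_bound _)) // exprMn.
  rewrite -[leRHS]mulr1 ler_wpM2l ?sqr_ge0 // -[x ^+ 2]ger0_norm ?sqr_ge0 //.
  by rewrite normrX exprn_ile1.
move=> x; apply: cvgB; last exact: cvg_cst.
exact: continuous_cosM.
Qed.

Lemma sin_moment_bound n t P : (size P <= n)%N ->
  `|sin_moment t P| <= coef_norm n P * `|t|.
Proof.
move=> sP; apply: weighted_int_bound => //; first exact: continuous_sinM.
move=> x hx; rewrite (le_trans (sin_bound _)) // normrM.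
by rewrite -[leRHS]mulr1 ler_wpM2l.
Qed.

(** Two integrations by parts turn two derivatives into a factor - t^2, without
boundary terms as long as at most n derivatives are taken. *)
Lemma bubble_moments t n j : (j.*2 <= n)%N ->
  cos_moment t (bubble R n)^`(j.*2) = (-1) ^+ j * t ^+ j.*2 * cos_moment t (bubble R n).
Proof.
elim: j => [|j IH] jn; first by rewrite !expr0 !mul1r.
have [a1 a2] := @bubble_derivn_half R j.*2.+1 n jn.
have [b1 b2] := @bubble_derivn_half R j.*2 n (ltnW jn).
rewrite doubleS derivnS cos_moment_deriv a1 a2 derivnS sin_moment_deriv b1 b2.
rewrite subrr addr0 !mul0r !add0r IH; last by rewrite ltnW // ltnW.
rewrite !exprS; ring.
Qed.

Lemma cos_moment_legendre t j : cos_moment t (legendre R j.*2) =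
  (-1) ^+ j * t ^+ j.*2 * cos_moment t (bubble R j.*2).
Proof. exact: bubble_moments. Qed.

Lemma sin_moment_legendre t j : sin_moment t (legendre R j.*2.+1) =
  - ((-1) ^+ j * t ^+ j.*2.+1 * cos_moment t (bubble R j.*2.+1)).
Proof.
have [b1 b2] := @bubble_derivn_half R j.*2 j.*2.+1 (ltnSn _).
rewrite /legendre derivnS sin_moment_deriv b1 b2 addr0 mul0r sub0r.
by rewrite bubble_moments // exprS; ring.
Qed.

Definition bubble_moment n t := (-1) ^+ n * cos_moment t (bubble R n).

Lemma asym_bubble_moment n : asym 0 (bubble_mass R n) (bubble_moment n).
Proof.
exists (coef_norm n.*2.+1 (bubble R n)); first by rewrite sumr_ge0.
near=> t; rewrite mulr1 -mulrBr normrM normrX normrN1 expr1n mul1r.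
have -> : `|t| ^+ 2 = t ^+ 2 by rewrite -normrX ger0_norm // sqr_ge0.
by apply: cos_moment_bound; rewrite size_bubble.
Unshelve. all: by end_near. Qed.

(** Up to sign, the moments of the residuals s - q' of the two flux pairs against
the wave of the same parity, cos (t x) or sin (t x). The factor t^n in the moment
of the Legendre polynomial of degree n is the source of the high order of the
dispersion error. *)
Definition residual_low p l t := l ^+ uphalf p * t ^+ p * bubble_moment p t / (p.*2)`!%:R.
Definition residual_full p eta l t :=
  l ^+ (p./2).+1 * t ^+ p.+1 * bubble_moment p.+1 t / (p.+1.*2)`!%:R
  + eta * l ^+ p./2 * t ^+ p.-1 * bubble_moment p.-1 t.

Lemma res_low_even p l t : ~~ odd p ->
  cos_moment t (flux_low p l - (sol_low p l)^`()) = residual_low p l t.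
Proof.
move=> ep; rewrite /flux_low addrC addKr cos_momentZ /residual_low /bubble_moment.
have -> : p = (p./2).*2 by rewrite -[LHS]odd_double_half (negbTE ep).
move: p./2 => m; rewrite uphalf_double cos_moment_legendre.
rewrite -[in RHS]signr_odd odd_double expr0 mul1r (exprNn l).
have : (-1) ^+ m * (-1) ^+ m = 1 :> R by rewrite -expr2 sqrr_sign.
move: ((-1) ^+ m) => s ss.
rewrite [LHS](_ : _ = (s * s) * (l ^+ m * t ^+ m.*2 * cos_moment t (bubble R m.*2) / (m.*2.*2)`!%:R)); last by ring.
by rewrite ss mul1r.
Qed.

Lemma res_low_odd p l t : odd p ->
  sin_moment t (flux_low p l - (sol_low p l)^`()) = - residual_low p l t.
Proof.
move=> ep; rewrite /flux_low addrC addKr sin_momentZ /residual_low /bubble_moment.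
have -> : p = (p./2).*2.+1 by rewrite -[LHS]odd_double_half ep.
move: p./2 => m; have -> : uphalf m.*2.+1 = m.+1 by rewrite /= doubleK.
rewrite sin_moment_legendre.
rewrite -[in RHS]signr_odd /= odd_double expr1 (exprNn l) !(exprS (-1)).
have : (-1) ^+ m * (-1) ^+ m = 1 :> R by rewrite -expr2 sqrr_sign.
move: ((-1) ^+ m) (l ^+ m.+1) (t ^+ m.*2.+1) (_%:R) => s L T f ss.
rewrite [LHS](_ : _ = (s * s) * (L * T * cos_moment t (bubble R m.*2.+1) / f)); last by ring.
rewrite ss; ring.
Qed.

Lemma res_full_odd p eta l t : odd p ->
  cos_moment t (flux_full p l eta - (sol_full p l eta)^`()) = residual_full p eta l t.
Proof.
move=> ep; rewrite /flux_full addrC addKr cos_moment_linear cos_momentZ /residual_full /bubble_moment.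
have -> : p = (p./2).*2.+1 by rewrite -[LHS]odd_double_half ep.
move: p./2 => m; rewrite /= uphalf_double -[m.*2.+2]doubleS !cos_moment_legendre.
rewrite -[in RHS]signr_odd odd_double expr0 mul1r.
rewrite -[(-1) ^+ m.*2]signr_odd odd_double expr0 mul1r !(exprNn l) !(exprS (-1)).
have : (-1) ^+ m * (-1) ^+ m = 1 :> R by rewrite -expr2 sqrr_sign.
move: ((-1) ^+ m) (l ^+ m.+1) (l ^+ m) (t ^+ m.+1.*2) (t ^+ m.*2) (_%:R) => s L L' T T' f ss.
move: (cos_moment _ _) (cos_moment _ _) => y x.
rewrite [LHS](_ : _ = (s * s) * (L * T * x / f + eta * L' * T' * y)); last by ring.
by rewrite ss mul1r.
Qed.

Lemma res_full_even p eta l t : (0 < p)%N -> ~~ odd p ->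
  sin_moment t (flux_full p l eta - (sol_full p l eta)^`()) = - residual_full p eta l t.
Proof.
move=> p0 ep; rewrite /flux_full addrC addKr sin_moment_linear sin_momentZ /residual_full /bubble_moment.
have e : p = (p./2).*2 by rewrite -[LHS]odd_double_half (negbTE ep).
have m0 : (0 < p./2)%N by move: p0; rewrite [in X in X -> _]e; case: p./2.
rewrite e; move: p./2 m0 => [//|m _]; rewrite doubleK doubleS [_.-1]/= -doubleS !sin_moment_legendre.
rewrite -[in RHS]signr_odd /= odd_double expr1.
rewrite -[(-1) ^+ m.*2.+1]signr_odd /= odd_double expr1 !(exprNn l) !(exprS (-1)).
have : (-1) ^+ m * (-1) ^+ m = 1 :> R by rewrite -expr2 sqrr_sign.
move: ((-1) ^+ m) (l ^+ m.+2) (l ^+ m.+1) (t ^+ m.*2.+3) (t ^+ m.*2.+1) (_%:R) => s L L' T T' f ss.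
move: (cos_moment _ _) (cos_moment _ _) => y x.
rewrite [LHS](_ : _ = (s * s) * (L * T * x / f + eta * L' * T' * y)); last by ring.
rewrite ss; ring.
Qed.

End TrigMoments.

(** * The scalar Bloch equation *)

Section PolynomialFamilies.
Variable R : realType.
Implicit Types (P Q : {poly R}) (w l : R) (Lin : {poly R} -> R).

(** Lipschitz dependence on two parameters, tested by linear functionals: values,
coefficients and integrals are all instances, and no norm on polynomials is
involved. *)
Definition poly_lip (E : R -> R -> {poly R}) :=
  forall Lin, linear_fun Lin -> lip2 (fun w l => Lin (E w l)).

Lemma poly_lip_cst P : poly_lip (fun _ _ => P).
Proof. by move=> Lin _; apply: lip2_cst. Qed.

Lemma poly_lipD E1 E2 : poly_lip E1 -> poly_lip E2 ->
  poly_lip (fun w l => E1 w l + E2 w l).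
Proof.
move=> h1 h2 Lin lin; have -> : (fun w l => Lin (E1 w l + E2 w l)) =
    (fun w l => Lin (E1 w l) + Lin (E2 w l)).
  by apply/funext => w; apply/funext => l; rewrite linear_funD.
by apply: lip2D; [apply: h1|apply: h2].
Qed.

Lemma poly_lipZ c E : lip2 c -> poly_lip E -> poly_lip (fun w l => c w l *: E w l).
Proof.
move=> h1 h2 Lin lin; have -> : (fun w l => Lin (c w l *: E w l)) =
    (fun w l => c w l * Lin (E w l)).
  by apply/funext => w; apply/funext => l; rewrite linear_funZ.
by apply: lip2M => //; apply: h2.
Qed.

Lemma poly_lip_deriv E : poly_lip E -> poly_lip (fun w l => (E w l)^`()).
Proof. by move=> h Lin lin; exact: (h _ (linear_deriv lin)). Qed.

Lemma lip2Nsnd : lip2 (fun _ l : R => - l).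
Proof. exact: (@lip2N _ (fun _ l : R => l) (@lip2_snd R)). Qed.

Lemma poly_lip_helm n Q : poly_lip (fun _ l => helm l n Q).
Proof.
elim: n => [|n IH]; first exact: poly_lip_cst.
apply: (@poly_lipD (fun _ l => - l *: helm l n Q) (fun _ _ => Q^`(n.*2))).
  by apply: poly_lipZ => //; exact: lip2Nsnd.
exact: poly_lip_cst.
Qed.

Lemma poly_lip_sol_low p : poly_lip (fun _ l => sol_low p l).
Proof. by apply: poly_lipZ; [exact: lip2_cst|exact: poly_lip_helm]. Qed.

Lemma poly_lip_flux_low p : poly_lip (fun _ l => flux_low p l).
Proof.
apply: poly_lipD; first exact/poly_lip_deriv/poly_lip_sol_low.
apply: (@poly_lipZ (fun _ l => (- l) ^+ uphalf p / (p.*2)`!%:R) (fun _ _ => legendre R p));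
  last exact: poly_lip_cst.
apply: (@lip2M _ (fun _ l => (- l) ^+ uphalf p)); last exact: lip2_cst.
by apply: lip2X; exact: lip2Nsnd.
Qed.

Lemma poly_lip_sol_full p c : poly_lip (fun w l => sol_full p l (c * w)).
Proof.
have hc : lip2 (fun w _ : R => c * w).
  by apply: (@lip2M _ (fun _ _ => c)); [exact: lip2_cst|exact: lip2_fst].
by apply: poly_lipD; apply: poly_lipZ => //; [exact: lip2_cst|exact: poly_lip_helm..].
Qed.

Lemma poly_lip_flux_full p c : poly_lip (fun w l => flux_full p l (c * w)).
Proof.
have hc : lip2 (fun w _ : R => c * w).
  by apply: (@lip2M _ (fun _ _ => c)); [exact: lip2_cst|exact: lip2_fst].
apply: poly_lipD; first exact/poly_lip_deriv/poly_lip_sol_full.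
apply: poly_lipD.
  apply: (@poly_lipZ (fun _ l => (- l) ^+ (p./2).+1 / (p.+1.*2)`!%:R) (fun _ _ => legendre R p.+1));
    last exact: poly_lip_cst.
  apply: (@lip2M _ (fun _ l => (- l) ^+ (p./2).+1)); last exact: lip2_cst.
  by apply: lip2X; exact: lip2Nsnd.
apply: (@poly_lipZ (fun w l => c * w * (- l) ^+ p./2) (fun _ _ => legendre R p.-1));
    last exact: poly_lip_cst.
by apply: lip2M => //; apply: lip2X; exact: lip2Nsnd.
Qed.

Lemma poly_lip_coef_norm E n : poly_lip E -> exists M, forall w l,
  `|w| <= 1 -> `|l| <= 1 -> coef_norm n (E w l) <= M.
Proof.
move=> hE; elim: n => [|n [M IH]].
  by exists 0 => *; rewrite /coef_norm big_ord0.
have [N N0 hN] := lip2_bounded (hE _ (linear_coef n)).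
by exists (M + N) => w l hw hl; rewrite /coef_norm big_ord_recr lerD ?IH ?hN.
Qed.

End PolynomialFamilies.

Section Dispersion.
Variable R : realType.
Variables (p : nat) (p0 : (0 < p)%N) (gamma : R).
Implicit Types (w l t : R).

Let c := gamma / bubble_mass R p.-1.
(** The two flux pairs sorted by the parity of q; which of them has degree p
depends on the parity of p. With [eta = c * w] they are the pairs for the penalty
[gw = gamma * w]. *)
Definition sol_even w l : {poly R} := if odd p then sol_low p l else sol_full p l (c * w).
Definition sol_odd w l : {poly R} := if odd p then sol_full p l (c * w) else sol_low p l.
Definition flux_even w l : {poly R} := if odd p then flux_low p l else flux_full p l (c * w).
Definition flux_odd w l : {poly R} := if odd p then flux_full p l (c * w) else flux_low p l.

Lemma parity_sol_even w l : parity 0 (sol_even w l).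
Proof.
rewrite /sol_even; case: ifP => op.
  by apply: parity_congr (parity_sol_low _ _); rewrite /= op.
by apply: parity_congr (parity_sol_full _ _ p0); rewrite /= op.
Qed.
Lemma parity_sol_odd w l : parity 1 (sol_odd w l).
Proof.
rewrite /sol_odd; case: ifP => op.
  by apply: parity_congr (parity_sol_full _ _ p0); rewrite /= op.
by apply: parity_congr (parity_sol_low _ _); rewrite /= op.
Qed.
Lemma parity_flux_even w l : parity 1 (flux_even w l).
Proof.
rewrite /flux_even; case: ifP => op.
  by apply: parity_congr (parity_flux_low _ _); rewrite /= op.
by apply: parity_congr (parity_flux_full _ _ p0); rewrite /= op.
Qed.
Lemma parity_flux_odd w l : parity 0 (flux_odd w l).
Proof.
rewrite /flux_odd; case: ifP => op.
  by apply: parity_congr (parity_flux_full _ _ p0); rewrite /= op.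
by apply: parity_congr (parity_flux_low _ _); rewrite /= op.
Qed.

Lemma size_sol_even w l : (size (sol_even w l) <= p.+1)%N.
Proof. by rewrite /sol_even; case: ifP => op; [rewrite leqW ?size_sol_low|rewrite size_sol_full]. Qed.
Lemma size_sol_odd w l : (size (sol_odd w l) <= p.+1)%N.
Proof. by rewrite /sol_odd; case: ifP => op; [rewrite size_sol_full|rewrite leqW ?size_sol_low]. Qed.

Lemma deriv_flux_even w l : (flux_even w l)^`() = - l *: sol_even w l.
Proof. by rewrite /flux_even /sol_even; case: ifP => _; rewrite ?deriv_flux_low ?deriv_flux_full. Qed.
Lemma deriv_flux_odd w l : (flux_odd w l)^`() = - l *: sol_odd w l.
Proof. by rewrite /flux_odd /sol_odd; case: ifP => _; rewrite ?deriv_flux_low ?deriv_flux_full. Qed.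

Lemma sol_even0 : sol_even 0 0 = 1.
Proof. by rewrite /sol_even mulr0; have [] := sol_limit R p0. Qed.
Lemma sol_odd0 : sol_odd 0 0 = 'X.
Proof. by rewrite /sol_odd mulr0; have [] := sol_limit R p0. Qed.
Lemma flux_odd0 : flux_odd 0 0 = 1.
Proof.
have -> : flux_odd 0 0 = (sol_odd 0 0)^`(); last by rewrite sol_odd0 derivX.
rewrite /flux_odd /sol_odd /flux_full /flux_low mulr0 oppr0; case: ifP => op.
  by rewrite exprS !mul0r !scale0r !addr0.
have -> : 0 ^+ uphalf p = 0 :> R by rewrite expr0n; case: (p) p0.
by rewrite mul0r scale0r addr0.
Qed.

Lemma lip_sol_even : poly_lip sol_even.
Proof. by rewrite /sol_even; case: (odd p); [exact: poly_lip_sol_low|exact: poly_lip_sol_full]. Qed.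
Lemma lip_sol_odd : poly_lip sol_odd.
Proof. by rewrite /sol_odd; case: (odd p); [exact: poly_lip_sol_full|exact: poly_lip_sol_low]. Qed.
Lemma lip_flux_odd : poly_lip flux_odd.
Proof. by rewrite /flux_odd; case: (odd p); [exact: poly_lip_flux_full|exact: poly_lip_flux_low]. Qed.

(** With w = 4 sin^2 (t/2), and so 4 - w = 4 cos^2 (t/2), this is the condition
for some combination of the even and the odd pair to be multiplied by e^(it)
across the cell, both in value and in flux. Written in w it is free of
trigonometric functions. *)
Definition bloch_eq w l :=
  (4 - w) * (sol_odd w l).[2^-1] * (flux_even w l).[2^-1]
  + w * (sol_even w l).[2^-1] * (flux_odd w l).[2^-1].

Let g1 w l := (2 - w / 2) * (sol_odd w l).[2^-1] * cellint (sol_even w l).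
Let g2 w l := (sol_even w l).[2^-1] * (flux_odd w l).[2^-1].

(** The even solution has an odd flux with derivative - l * sol_even, so the end
value of the flux carries a factor l. *)
Lemma bloch_eqE w l : bloch_eq w l = - l * g1 w l + w * g2 w l.
Proof.
have e1 : (flux_even w l).[2^-1] = - l * cellint (sol_even w l) / 2.
  have := cellint_deriv (flux_even w l); rewrite deriv_flux_even linearZ /= => ->.
  by rewrite (parity_horner _ (parity_flux_even w l)) expr1; field.
by rewrite /bloch_eq e1 /g1 /g2; field.
Qed.

Lemma cellint1 : cellint 1 = 1 :> R.
Proof. by have := cellint_deriv ('X : {poly R}); rewrite derivX !hornerX => ->; field. Qed.

(** This is |1 - e^(it)|^2, the factor that the Bloch phase t contributes to a
product of two jumps. *)
Definition jump_weight t := 4 * sin (t / 2) ^+ 2.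

Lemma asym_sin_half : asym 1 2^-1 (fun t : R => sin (t / 2)).
Proof.
exists 1 => //; near=> t; rewrite mul1r expr1 (mulrC _ t).
rewrite (le_trans (sin_taylor _)) //.
have -> : (t / 2) ^+ 2 = `|t| ^+ 2 / 4.
  by rewrite -normrX ger0_norm ?sqr_ge0 //; field.
rewrite normrM (ger0_norm (_ : 0 <= 2^-1)) ?invr_ge0 //.
have : 0 <= `|t| ^+ 3 by rewrite exprn_ge0.
have -> : `|t| ^+ 2 / 4 * (`|t| / 2) = `|t| ^+ 3 / 8 by field.
by move: (_ ^+ 3) => X; lra.
Unshelve. all: by end_near. Qed.

Lemma asym_cos_half : asym 0 1 (fun t : R => cos (t / 2)).
Proof.
exists 1 => //; near=> t; rewrite mul1r expr0.
rewrite (le_trans (cos_bound _)) //.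
have -> : (t / 2) ^+ 2 = `|t| ^+ 2 / 4.
  by rewrite -normrX ger0_norm ?sqr_ge0 //; field.
have : 0 <= `|t| ^+ 2 by rewrite exprn_ge0.
by move: (_ ^+ 2) => X; lra.
Unshelve. all: by end_near. Qed.

Lemma asym_jump_weight : asym 2 1 jump_weight.
Proof.
have := asymM (asym_cst 4) (asymX 2 asym_sin_half); rewrite add0n mul2n.
have -> : 4 * 2^-1 ^+ 2 = 1 :> R by field.
exact.
Qed.

Lemma jump_weight_le t : 0 <= jump_weight t <= t ^+ 2.
Proof.
rewrite /jump_weight mulr_ge0 ?sqr_ge0 //=.
have h := sin_bound (t / 2).
have : sin (t / 2) ^+ 2 <= (t / 2) ^+ 2.
  by rewrite -[leLHS]ger0_norm ?sqr_ge0 // -[leRHS]ger0_norm ?sqr_ge0 // !normrX lerXn2r ?nnegrE.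
rewrite exprMn; lra.
Qed.

Definition green_mass w l t :=
  2 * cos (t / 2) * (sol_odd w l).[2^-1] * cos_moment t (sol_even w l)
  + 2 * sin (t / 2) * (sol_even w l).[2^-1] * sin_moment t (sol_odd w l).
Definition green_defect w l t :=
  t * (2 * sin (t / 2) * (sol_even w l).[2^-1]
         * cos_moment t (flux_odd w l - (sol_odd w l)^`())
     - 2 * cos (t / 2) * (sol_odd w l).[2^-1]
         * sin_moment t (flux_even w l - (sol_even w l)^`())).

(** Green's formula for the flux pairs against the exact waves cos (t x) and
sin (t x). Were the residuals s - q' zero, the equation would be solved by
l = t^2; the moments of the residuals make up [green_defect]. *)
Lemma green t l : bloch_eq (jump_weight t) l =
  (t ^+ 2 - l) * green_mass (jump_weight t) l t + green_defect (jump_weight t) l t.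
Proof.
rewrite /bloch_eq /green_mass /green_defect; set w := jump_weight t.
have c2 : 4 - w = 4 * cos (t / 2) ^+ 2 by rewrite /w /jump_weight cos2sin2; ring.
have w2 : w = 4 * sin (t / 2) ^+ 2 by [].
set e := sol_even w l; set o := sol_odd w l; set se := flux_even w l; set so := flux_odd w l.
rewrite c2 [X in _ + X * _ * _ = _]w2.
have pe := parity_horner 2^-1 (parity_sol_even w l).
have po := parity_horner 2^-1 (parity_sol_odd w l).
have pse := parity_horner 2^-1 (parity_flux_even w l).
have pso := parity_horner 2^-1 (parity_flux_odd w l).
rewrite ?expr0 ?expr1 ?mul1r ?mulN1r -?/e -?/o -?/se -?/so in pe po pse pso.
have h1 := cos_moment_deriv t se; rewrite deriv_flux_even cos_momentZ -/e pse opprK in h1.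
have h2 := sin_moment_deriv t e; rewrite pe in h2.
have h3 := sin_moment_deriv t so; rewrite deriv_flux_odd sin_momentZ -/o pso in h3.
have h4 := cos_moment_deriv t o; rewrite po opprK in h4.
have h5 : sin_moment t se = sin_moment t (se - e^`()) + sin_moment t e^`().
  by rewrite -sin_momentD subrK.
have h6 : cos_moment t so = cos_moment t (so - o^`()) + cos_moment t o^`().
  by rewrite -cos_momentD subrK.
rewrite h5 h2 in h1; rewrite h6 h4 in h3.
have k1 : 2 * se.[2^-1] * cos (t / 2) = (t ^+ 2 - l) * cos_moment t e
    - 2 * t * e.[2^-1] * sin (t / 2) - t * sin_moment t (se - e^`()).
  move: h1; move: (cos_moment t e) (sin_moment t _) => X Y h1; nra.
have k2 : 2 * so.[2^-1] * sin (t / 2) = (t ^+ 2 - l) * sin_moment t o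
    + 2 * t * o.[2^-1] * cos (t / 2) + t * cos_moment t (so - o^`()).
  move: h3; move: (sin_moment t o) (cos_moment t _) => X Y h3; nra.
transitivity (2 * cos (t / 2) * o.[2^-1] * (2 * se.[2^-1] * cos (t / 2))
   + 2 * sin (t / 2) * e.[2^-1] * (2 * so.[2^-1] * sin (t / 2))); first by ring.
by rewrite k1 k2; ring.
Qed.

End Dispersion.

(** * The one-dimensional dispersion relation *)

Section DispersionRelation.
Variable R : realType.
Variables (p : nat) (p0 : (0 < p)%N) (gamma : R).
Implicit Types (w l t : R).

Local Notation sole := (sol_even p gamma).
Local Notation solo := (sol_odd p gamma).

Lemma near_ball0 (P : R -> Prop) : (\forall t \near (0 : R), P t) ->
  exists2 e : R, 0 < e & forall t, `|t| <= e -> P t.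
Proof.
move=> /nbhs_ballP[e /= e0 h]; exists (e / 2); first by lra.
by move=> t ht; apply: h; rewrite /ball /= sub0r normrN; lra.
Qed.

Lemma asym_near_neq0 (f : R -> R) c : c != 0 -> asym 0 c f ->
  \forall t \near (0 : R), f t != 0.
Proof.
move=> c0 /(asymM (asym_cst c^-1)); rewrite mulVf // => hf.
have h2 : 0 < 2^-1 :> R by lra.
have h1 := ordo_small hf h2; near=> t; apply/negP => /eqP ft.
have : `|c^-1 * f t - 1 * t ^+ 0| <= 2^-1 by near: t.
by rewrite ft mulr0 expr0 mul1r sub0r normrN normr1; lra.
Unshelve. all: by end_near. Qed.

(** The coefficient of the phase difference is the Beta integral of
(1/4 - x^2)^p over the cell divided by (2p)!. *)
Lemma fem_phase_coefE : fem_phase_coef R p = bubble_mass R p / (p.*2)`!%:R.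
Proof.
rewrite /fem_phase_coef bubble_massE mul2n addn1.
rewrite (factS p.*2); have : (p.*2)`!%:R != 0 :> R by rewrite pnatr_eq0 -lt0n fact_gt0.
have : (p.*2.+1)%:R != 0 :> R by rewrite pnatr_eq0.
move: (p.*2.+1) (p.*2)`! p`! => a b d a0 b0; rewrite natrM.
by field; rewrite a0 b0.
Qed.

Lemma jump_weight_lipschitz t t' : `|t| <= 1 -> `|t'| <= 1 ->
  `|jump_weight t - jump_weight t'| <= 8 * `|t - t'|.
Proof.
move=> ht ht'; rewrite /jump_weight; set a := t / 2; set b := t' / 2.
have e : `|a - b| = `|t - t'| / 2.
  by rewrite /a /b -mulrBl normrM (ger0_norm (_ : 0 <= 2^-1)) ?invr_ge0.
have h : `|sin a - sin b| <= 2 * `|a - b|.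
  have -> : sin a - sin b = sin b * (cos (a - b) - 1) + cos b * sin (a - b).
    by rewrite -{1}(subrK b a) addrC sinD; ring.
  have d1 : `|a - b| <= 1.
    by rewrite e; have := ler_normB t t'; lra.
  rewrite (le_trans (ler_normD _ _)) // !normrM.
  have a1 : `|sin b| * `|cos (a - b) - 1| <= 1 * `|a - b|.
    rewrite ler_pM ?sin_max // (le_trans (cos_bound _)) //.
    rewrite -[leLHS]ger0_norm ?sqr_ge0 // normrX expr2 -[leRHS]mul1r.
    by rewrite ler_wpM2r.
  have a2 : `|cos b| * `|sin (a - b)| <= 1 * `|a - b|.
    by rewrite ler_pM ?cos_max ?sin_bound.
  by lra.
have -> : 4 * sin a ^+ 2 - 4 * sin b ^+ 2 = 4 * (sin a - sin b) * (sin a + sin b) by ring.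
have h2 : `|sin a + sin b| <= 2.
  by rewrite (le_trans (ler_normD _ _)) //; have := sin_max a; have := sin_max b; lra.
rewrite !normrM ger0_norm //.
have : `|sin a - sin b| * `|sin a + sin b| <= (2 * `|a - b|) * 2 by rewrite ler_pM.
by rewrite e -mulrA; lra.
Qed.

(** By [green], (Lam t - t^2) * green_mass = green_defect along the branch of
solutions through the origin. There green_mass is 1 + O(t^2), and the leading
term t^(2p+2) of the defect has two sources: the residual of the solution of
degree less than p contributes the coefficient without penalty, the one of degree
p contributes gamma. *)
Theorem dispersion_relation :
  exists (Lam : R -> R) (t0 K : R), [/\ 0 < t0, 0 <= K,
    forall t, `|t| <= t0 ->
      [/\ bloch_eq p gamma (jump_weight t) (Lam t) = 0,
          (sole (jump_weight t) (Lam t)).[2^-1] != 0 &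
          (solo (jump_weight t) (Lam t)).[2^-1] != 0],
    forall t t', `|t| <= t0 -> `|t'| <= t0 -> `|Lam t - Lam t'| <= K * `|t - t'| &
    forall t, `|t| <= t0 ->
      `|Lam t - (t ^+ 2 + (fem_phase_coef R p + gamma) * t ^+ (p.*2.+2))|
       <= K * `|t| ^+ p.*2.+4].
Proof.
pose c := gamma / bubble_mass R p.-1.
pose g1 w l := (2 - w / 2) * (solo w l).[2^-1] * cellint (sole w l).
pose g2 w l := (sole w l).[2^-1] * (flux_odd p gamma w l).[2^-1].
have lh x := @linear_horner R x.
have le12 : lip2 (fun w l => (sole w l).[2^-1]) by apply: (lip_sol_even _ _ (lh _)).
have lo12 : lip2 (fun w l => (solo w l).[2^-1]) by apply: (lip_sol_odd _ _ (lh _)).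
have ls12 : lip2 (fun w l => (flux_odd p gamma w l).[2^-1]) by apply: (lip_flux_odd _ _ (lh _)).
have lci : lip2 (fun w l => cellint (sole w l)) by apply: (lip_sol_even _ _ (@linear_cellint R)).
have lg1 : lip2 g1.
  apply: lip2M => //; apply: lip2M => //.
  apply: (@lip2D _ (fun _ _ => 2) (fun w _ => - (w / 2))); first exact: lip2_cst.
  apply: (@lip2N _ (fun w _ => w / 2)).
  by apply: (@lip2M _ (fun w _ => w) (fun _ _ => 2^-1)); [exact: lip2_fst|exact: lip2_cst].
have lg2 : lip2 g2 by apply: lip2M.
have g10 : g1 0 0 = 1.
  by rewrite /g1 sol_odd0 // sol_even0 // hornerX cellint1; field.
have g20 : g2 0 0 = 1 by rewrite /g2 sol_even0 // flux_odd0 // hornerC mulr1.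
have [d [K0 [L0 [/andP[d0 d1] K00 hroot hsmall hlip]]]] := implicit_root lg1 lg2 g10.
pose Lam t := L0 (jump_weight t).
have wd : \forall t \near (0 : R), `|jump_weight t| <= d.
  have h1 := near_le d0; near=> t; have ht : `|t| <= d by near: t.
  have /andP[w0 w2] := jump_weight_le t; rewrite ger0_norm // (le_trans w2) //.
  rewrite -[leLHS]ger0_norm ?sqr_ge0 // normrX expr2 -[leRHS]mul1r ler_pM //.
have ow : ordo 2 (@jump_weight R) := asym_ordo (@asym_jump_weight R).
have oL : ordo 2 Lam.
  case: ow => [W W0 hW]; exists (K0 * W); first exact: mulr_ge0.
  near=> t; rewrite (le_trans (hsmall _ _)) //; first by near: t.
  by rewrite -mulrA ler_wpM2l //; near: t.
(* A Lipschitz function of w and l is constant up to O(t^2) along the branch. *)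
have path h : lip2 h -> asym 0 (h 0 0) (fun t => h (jump_weight t) (Lam t)).
  by move=> lh'; apply: (ordo_eq _ (lip2_ordo lh' ow oL)) => t; rewrite mulr1.
(* Divide the equation - Lam * g1 + w * g2 = 0 by g1. *)
have aL : asym 2 1 Lam.
  have ag1 := path _ lg1; have ag2 := path _ lg2; rewrite g10 in ag1; rewrite g20 in ag2.
  apply: (asym_div _ ag1); have := asymM (@asym_jump_weight R) ag2; rewrite addn0 mulr1.
  apply: asym_near; near=> t.
  have wt_d : `|jump_weight t| <= d by near: t.
  by have [h _] := hroot _ wt_d; move: h; rewrite /Lam; lra.
pose eh t := (sole (jump_weight t) (Lam t)).[2^-1].
pose oh t := (solo (jump_weight t) (Lam t)).[2^-1].
have aeh : asym 0 1 eh by have := path _ le12; rewrite sol_even0 // hornerC.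
have aoh : asym 0 2^-1 oh by have := path _ lo12; rewrite sol_odd0 // hornerX.
have small : \forall t \near (0 : R), `|jump_weight t| <= 1 /\ `|Lam t| <= 1.
  near=> t; have h : `|jump_weight t| <= d by near: t.
  by split; [rewrite (le_trans h)|have [] := hroot _ h].
have aIc : asym 0 1 (fun t => cos_moment t (sole (jump_weight t) (Lam t))).
  have [M hM] := poly_lip_coef_norm p.+1 (lip_sol_even p gamma).
  have h1 := path _ lci; rewrite sol_even0 // cellint1 in h1.
  have h2 : ordo 2 (fun t => cos_moment t (sole (jump_weight t) (Lam t)) - cellint (sole (jump_weight t) (Lam t))).
    exists `|M| => //; near=> t; have [w1 l1] : `|jump_weight t| <= 1 /\ `|Lam t| <= 1 by near: t.
    rewrite (le_trans (cos_moment_bound _ (size_sol_even _ _ _ _))) //.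
    rewrite -normrX (ger0_norm (sqr_ge0 _)) ler_wpM2r ?sqr_ge0 //.
    by rewrite (le_trans (hM _ _ w1 l1)) // ler_norm.
  have := asymD h1 (ordo_asym0 h2); rewrite addr0; apply: asym_near; near=> t.
  by rewrite addrC subrK.
have oIs : ordo 1 (fun t => sin_moment t (solo (jump_weight t) (Lam t))).
  have [M hM] := poly_lip_coef_norm p.+1 (lip_sol_odd p gamma).
  exists `|M| => //; near=> t; have [w1 l1] : `|jump_weight t| <= 1 /\ `|Lam t| <= 1 by near: t.
  rewrite (le_trans (sin_moment_bound _ (size_sol_odd _ _ _ _))) // expr1 ler_wpM2r //.
  by rewrite (le_trans (hM _ _ w1 l1)) // ler_norm.
have asin2 : asym 1 1 (fun t : R => 2 * sin (t / 2)).
  by have := asymM (asym_cst 2) (@asym_sin_half R); rewrite add0n mulfV.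
have acos2 : asym 0 2 (fun t : R => 2 * cos (t / 2)).
  by have := asymM (asym_cst 2) (@asym_cos_half R); rewrite mulr1.
have aN : asym 0 1 (fun t => green_mass p gamma (jump_weight t) (Lam t) t).
  have h1 := asymM (asymM acos2 aoh) aIc; rewrite mulfV // mul1r in h1.
  have h2 := ordoM (ordoM (asym_ordo asin2) (asym_ordo aeh)) oIs.
  by have := asymD h1 (ordo_asym0 h2); rewrite addr0.
have ar1 : asym (uphalf p * 2 + p) (fem_phase_coef R p) (fun t => residual_low p (Lam t) t).
  have := asymM (asymM (asymM (asymX (uphalf p) aL) (asymX p (@asym_id R)))
     (@asym_bubble_moment R p)) (asym_cst ((p.*2)`!%:R^-1)).
  by rewrite muln1 !addn0 !expr1n !mul1r -fem_phase_coefE.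
have hp2 := odd_double_half p.
have ar2 : asym (2 + p./2 * 2 + p.-1) gamma (fun t => residual_full p (c * jump_weight t) (Lam t) t).
  have h1 := asymM (asymM (asymM (asymX (p./2).+1 aL) (asymX p.+1 (@asym_id R)))
     (@asym_bubble_moment R p.+1)) (asym_cst ((p.+1.*2)`!%:R^-1)).
  have h2 := asymM (asymM (asymM (asymM (asym_cst c) (@asym_jump_weight R)) (asymX p./2 aL))
     (asymX p.-1 (@asym_id R))) (@asym_bubble_moment R p.-1).
  rewrite muln1 !addn0 in h1; rewrite muln1 add0n !addn0 !expr1n !mulr1 in h2.
  have ec : c * bubble_mass R p.-1 = gamma by rewrite /c divfK // bubble_mass_neq0.
  rewrite ec in h2.
  (* The Legendre polynomial of degree p + 1 contributes two orders later. *)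
  have e1 : ((p./2).+1 * 2 + p.+1 = (2 + p./2 * 2 + p.-1).+2)%N by lia.
  by rewrite e1 in h1; have := asymD (asym_weaken h1) h2; rewrite add0r.
have aD : asym (p.*2.+2) (fem_phase_coef R p + gamma)
    (fun t => green_defect p gamma (jump_weight t) (Lam t) t).
  have [op|ep] := boolP (odd p).
    have h1 := asymM (@asym_id R) (asymM (asymM asin2 aeh) ar2).
    have h2 := asymM (@asym_id R) (asymM (asymM acos2 aoh) ar1).
    rewrite mulfV // !mul1r in h1 h2.
    have e1 : (1 + (1 + 0 + (2 + p./2 * 2 + p.-1)) = p.*2.+2)%N by rewrite op in hp2; lia.
    have e2 : (1 + (0 + 0 + (uphalf p * 2 + p)) = p.*2.+2)%N.
      by rewrite uphalf_half op; rewrite op in hp2; lia.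
    rewrite e1 in h1; rewrite e2 in h2.
    have := asymD h2 h1; apply: asym_near; near=> t.
    rewrite /green_defect /eh /oh /sol_odd /sol_even /flux_odd /flux_even op.
    by rewrite res_full_odd // res_low_odd // -/c; ring.
  have h1 := asymM (@asym_id R) (asymM (asymM asin2 aeh) ar1).
  have h2 := asymM (@asym_id R) (asymM (asymM acos2 aoh) ar2).
  rewrite mulfV // !mul1r in h1 h2.
  rewrite (negbTE ep) in hp2.
  have e1 : (1 + (1 + 0 + (uphalf p * 2 + p)) = p.*2.+2)%N.
    by rewrite uphalf_half (negbTE ep); lia.
  have e2 : (1 + (0 + 0 + (2 + p./2 * 2 + p.-1)) = p.*2.+2)%N by lia.
  rewrite e1 in h1; rewrite e2 in h2.
  have := asymD h1 h2; apply: asym_near; near=> t.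
  rewrite /green_defect /eh /oh /sol_odd /sol_even /flux_odd /flux_even (negbTE ep).
  by rewrite res_full_even // res_low_even // -/c; ring.
have beq0 t : `|jump_weight t| <= d -> bloch_eq p gamma (jump_weight t) (Lam t) = 0.
  by move=> h; rewrite bloch_eqE //; have [] := hroot _ h.
have aErr : asym (p.*2.+2) (fem_phase_coef R p + gamma) (fun t => Lam t - t ^+ 2).
  apply: (asym_div _ aN); apply: asym_near aD; near=> t.
  have wtd : `|jump_weight t| <= d by near: t.
  by have := green p0 gamma t (Lam t); rewrite (beq0 _ wtd); lra.
have neh := asym_near_neq0 (oner_neq0 _) aeh.
have noh := asym_near_neq0 (_ : 2^-1 != 0) aoh.
case: aErr => K1 K10 hK1.
have [t1 t10 ht1] : exists2 t1 : R, 0 < t1 & forall t, `|t| <= t1 ->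
   [/\ `|jump_weight t| <= d, eh t != 0, oh t != 0 &
    `|Lam t - t ^+ 2 - (fem_phase_coef R p + gamma) * t ^+ p.*2.+2| <= K1 * `|t| ^+ p.*2.+4].
  apply: near_ball0; near=> t; split; near: t => //.
  by apply: noh; rewrite invr_eq0.
exists Lam, (Num.min t1 1), (Num.max K1 (K0 * 8)); split.
- by rewrite lt_min t10 ltr01.
- by rewrite le_max K10.
- by move=> t; rewrite le_min => /andP[/ht1[a b e _] _]; split => //; exact: beq0.
- move=> t t'; rewrite !le_min => /andP[/ht1[a _ _ _] h1] /andP[/ht1[a' _ _ _] h1'].
  rewrite (le_trans (hlip _ _ a a')) // (@le_trans _ _ (K0 * 8 * `|t - t'|)) //.
    by rewrite -mulrA ler_wpM2l // jump_weight_lipschitz.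
  by rewrite ler_wpM2r // le_max lexx orbT.
- move=> t; rewrite le_min => /andP[/ht1[_ _ _ h] _].
  rewrite opprD addrA (le_trans h) // ler_wpM2r ?exprn_ge0 // le_max lexx //.
Unshelve. all: by end_near. Qed.

End DispersionRelation.

(** * The Lagrange basis and Bloch vectors on the line *)

Section LagrangeBasis.
Variables (F : numFieldType) (p : nat).
Hypothesis p0 : (0 < p)%N.
Implicit Types (P Q : {poly F}) (j a b m n : int) (r : nat).

Definition cell_node r : F := r%:R / p%:R - 2^-1.

Definition lagrange_poly r : {poly F} :=
  \prod_(i < p.+1 | val i != r)
    ((cell_node r - cell_node i)^-1 *: ('X - (cell_node i)%:P)).

(** Extended by 0 to all integers, so that the restriction of the a-th basis
function of the line to the n-th cell is [lag (a - n * p)] without distinction of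
cases. *)
Definition lag j : {poly F} :=
  if j is Posz r then if (r <= p)%N then lagrange_poly r else 0 else 0.

Lemma pF0 : p%:R != 0 :> F.
Proof. by rewrite pnatr_eq0 -lt0n. Qed.

Lemma cell_node0 : cell_node 0 = - 2^-1.
Proof. by rewrite /cell_node mul0r sub0r. Qed.

Lemma cell_nodep : cell_node p = 2^-1.
Proof. by rewrite /cell_node divff ?pF0 //; field. Qed.

Lemma cell_node_inj : injective cell_node.
Proof.
move=> r s /addIr /(mulIf (invr_neq0 pF0)) /eqP.
by rewrite eqr_nat => /eqP.
Qed.

Lemma size_lag j : (size (lag j) <= p.+1)%N.
Proof.
case: j => [r|r]; rewrite /lag; last by rewrite size_poly0.
case: ifP => hr; last by rewrite size_poly0.
rewrite /lagrange_poly (eq_bigr (fun i : 'I_p.+1 => (cell_node r - cell_node i)^-1%:P *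
   ('X - (cell_node i)%:P))) => [|i _]; last by rewrite mul_polyC.
rewrite big_split /= -rmorph_prod /= mul_polyC (leq_trans (size_scale_leq _ _)) //.
rewrite -big_filter size_prod_XsubC ltnS size_filter.
have e : #|predC1 (Ordinal (n := p.+1) hr)| = p by rewrite cardC1 card_ord.
rewrite -[X in (_ <= X)%N]e cardE /enum_mem size_filter.
rewrite (eq_count (a2 := mem (predC1 (Ordinal (n := p.+1) hr)))) ?leqnn //.
Qed.

Lemma lag_node j r : (r <= p)%N -> (lag j).[cell_node r] = (j == r%:Z)%:R.
Proof.
move=> rp; case: j => [s|s] /=; last by rewrite horner0.
case: leqP => hs; last first.
  by rewrite horner0 eqz_nat gtn_eqF // (leq_ltn_trans rp).
rewrite eqz_nat /lagrange_poly horner_prod; case: eqP => [->|/eqP ne].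
  apply: big1 => i ne; rewrite hornerZ hornerXsubC mulVf // subr_eq0.
  by apply: contra ne => /eqP /cell_node_inj ->.
have hr : (r < p.+1)%N by [].
by rewrite (bigD1 (Ordinal hr)) /= 1?eq_sym // hornerZ hornerXsubC subrr mulr0 mul0r.
Qed.

Lemma cell_interp P Q : (size P <= p.+1)%N -> (size Q <= p.+1)%N ->
  (forall r, (r <= p)%N -> P.[cell_node r] = Q.[cell_node r]) -> P = Q.
Proof.
move=> sP sQ h; apply/eqP; rewrite -subr_eq0; apply/negPn/negP => ne0.
have sPQ : (size (P - Q)%R <= p.+1)%N.
  by rewrite (leq_trans (size_polyD _ _)) // geq_max sP size_polyN.
have := @max_poly_roots _ (P - Q) [seq cell_node r | r <- iota 0 p.+1] ne0.
rewrite size_map size_iota => /(_ _ _) H.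
suff : (p.+1 < size (P - Q)%R)%N by rewrite ltnNge sPQ.
apply: H; last by rewrite map_inj_uniq ?iota_uniq //; exact: cell_node_inj.
apply/allP => x /mapP[r]; rewrite mem_iota add0n ltnS => /andP[_ rp] ->.
by rewrite /root hornerD hornerN h // subrr.
Qed.

Definition lag_top j : F := (lag j)^`(p).[0].
(** The second index is meant to be in [0, p): that basis function lives on the
cells -1 and 0, and the jumps of its p-th derivative are at -1, 0 and 1. *)
Definition mass1 a b : F :=
  \sum_(n <- [:: -1; 0]) cellint (lag (a - n * p%:Z) * lag (b - n * p%:Z)).
Definition stiff1 a b : F :=
  \sum_(n <- [:: -1; 0])
     cellint ((lag (a - n * p%:Z))^`() * (lag (b - n * p%:Z))^`()).
Definition lag_jump a n : F :=
  lag_top (a - n * p%:Z) - lag_top (a - (n - 1) * p%:Z).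
Definition jump1 a b : F := \sum_(n <- [:: -1; 0; 1]) lag_jump a n * lag_jump b n.
Definition energy1 gamma a b : F := stiff1 a b + gamma * jump1 a b.

Lemma lag_out j : (j < 0) || (p%:Z < j) -> lag j = 0.
Proof. by case: j => [r|r] //=; rewrite ltz_nat ltnNge => /negbTE ->. Qed.

(** A translate by more than two cells shares neither a cell nor a jump with a
basis function based in the cell 0. *)
Definition shifts : seq int := [:: -2; -1; 0; 1; 2].

Lemma far_shift (i : 'I_p) m n : m \notin shifts -> n \in [:: -2; -1; 0; 1] ->
  lag (i%:Z + m * p%:Z - n * p%:Z) = 0.
Proof.
move=> hm hn; apply: lag_out; have := ltn_ord i; move: hn hm.
rewrite !inE => /or4P[] /eqP -> hm ip; apply/orP;
  (have [h|h] : m <= -3 \/ 3 <= m by lia); [left|right|left|right|left|right|left|right]; nia.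
Qed.

Lemma mass1_far (i : 'I_p) m b : m \notin shifts -> mass1 (i%:Z + m * p%:Z) b = 0.
Proof.
move=> hm; rewrite /mass1 !big_cons big_nil !(far_shift _ hm) //.
by rewrite !mul0r !linear0 !addr0.
Qed.

Lemma energy1_far gamma (i : 'I_p) m b : m \notin shifts ->
  energy1 gamma (i%:Z + m * p%:Z) b = 0.
Proof.
move=> hm; rewrite /energy1 /stiff1 /jump1 /lag_jump /lag_top !big_cons !big_nil.
rewrite !(far_shift _ hm) // !linear0 !mul0r !linear0 !addr0.
by rewrite !subrr !mul0r !addr0 mulr0 ?addr0 ?add0r.
Qed.

Lemma shift_eq (i r m n : int) : 0 <= i < p%:Z -> 0 <= r < p%:Z ->
  i + m * p%:Z - n * p%:Z = r -> m = n /\ i = r.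
Proof.
move=> hi hr; rewrite -addrA -mulrBl => e.
suff d0 : m - n = 0.
  by move: e; rewrite d0 mul0r addr0 => ->; split => //; apply/eqP; rewrite -subr_eq0 d0.
have pp : 0 <= p%:Z by [].
have [d1|d1] : (0 <= m - n - 1 \/ 0 <= n - m - 1) \/ m - n = 0 by lia.
  by move: e; case: d1 => d1; have := mulr_ge0 d1 pp; lia.
by [].
Qed.

Section BlochKernel.
Variables (E gamma lam : F) (q s : {poly F}).
Hypotheses (E0 : E != 0) (sq : (size q <= p.+1)%N).
Hypothesis hfl : flux_pair p (gamma * ((1 - E) * (1 - E^-1))) lam q s.
Hypotheses (bq : q.[2^-1] = E * q.[- 2^-1]) (bs : s.[2^-1] = E * s.[- 2^-1]).

Let U (i : 'I_p) : F := q.[cell_node i].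

(** Extending q by the factor E from cell to cell gives a continuous function, by
[bq], so its nodal interpolant returns E ^ n times q on the n-th cell. *)
Lemma bloch_interp n : n \in [:: -2; -1; 0; 1] ->
  \sum_(i < p) \sum_(m <- shifts)
     (U i * E ^ m) *: lag (i%:Z + m * p%:Z - n * p%:Z) = E ^ n *: q.
Proof.
move=> hn; apply: cell_interp.
- rewrite (leq_trans (size_sum _ _ _)) //; apply/bigmax_leqP => i _.
  rewrite (leq_trans (size_sum _ _ _)) //; apply/bigmax_leqP_seq => m _ _.
  by rewrite (leq_trans (size_scale_leq _ _)) // size_lag.
- by rewrite (leq_trans (size_scale_leq _ _)).
move=> r rp; rewrite horner_sum.
under eq_bigr => i _ do rewrite horner_sum.
under eq_bigr => i _ do under eq_bigr => m _ do rewrite hornerZ lag_node //.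
have us : uniq shifts by [].
rewrite hornerZ; case: (ltngtP r p) rp => // [rp _|-> _].
  rewrite (bigD1 (Ordinal rp)) //= (bigD1_seq n) //=; last first.
    by move: hn; rewrite !inE => /or4P[] /eqP ->.
  rewrite addrK eqxx mulr1 [U (Ordinal _) * E ^ n]mulrC !big1 ?addr0 // => [i ir|m mn].
    rewrite big_seq big1 // => m _; case: eqP; rewrite ?mulr0 // => e.
    have ip := ltn_ord i; have {}ir : (i : nat) != r by [].
    have [||_] := shift_eq _ _ e; first by rewrite ltz_nat ip.
      by rewrite ltz_nat rp.
    by move=> [] e2; rewrite e2 eqxx in ir.
  case: eqP; rewrite ?mulr0 // => e.
  have [||h _] := shift_eq _ _ e; first by rewrite ltz_nat rp.
    by rewrite ltz_nat rp.
  by rewrite h eqxx in mn.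
have us' : n + 1 \in shifts by move: hn; rewrite !inE => /or4P[] /eqP ->.
rewrite (bigD1 (Ordinal p0)) //= (bigD1_seq (n + 1)) //=.
rewrite (_ : _ == _); last by apply/eqP; ring.
rewrite mulr1 !big1 ?addr0 // => [||].
- rewrite {1}/U /= cell_node0 cell_nodep bq exprzDr ?unitfE // expr1z; ring.
- move=> i ir; rewrite big_seq big1 // => m _; case: eqP; rewrite ?mulr0 // => e.
  have ip := ltn_ord i; have {}ir : (i : nat) != 0%N by [].
  have e' : i%:Z + m * p%:Z - (n + 1) * p%:Z = 0 by lia.
  have [||_] := shift_eq _ _ e'; first by rewrite ltz_nat ip.
    by rewrite ltz_nat p0.
  by move=> [] e2; rewrite e2 eqxx in ir.
- move=> m mn; case: eqP; rewrite ?mulr0 // => e.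
  have e' : 0 + m * p%:Z - (n + 1) * p%:Z = 0 by move: e => /=; lia.
  have [||h _] := shift_eq _ _ e'; rewrite ?ltz_nat ?p0 //.
  by rewrite h eqxx in mn.
Qed.

Lemma bloch_lin (Lin : {poly F} -> F) n : scalar Lin -> n \in [:: -2; -1; 0; 1] ->
  \sum_(i < p) \sum_(m <- shifts)
     U i * E ^ m * Lin (lag (i%:Z + m * p%:Z - n * p%:Z)) = E ^ n * Lin q.
Proof.
move=> linL hn; pose T := GRing.isLinear.Build F {poly F} F *%R Lin linL.
pose L : {scalar {poly F}} := HB.pack Lin T.
have -> : E ^ n * Lin q = L (E ^ n *: q) by rewrite linearZ.
rewrite -bloch_interp // linear_sum; apply: eq_bigr => i _.
by rewrite linear_sum; apply: eq_bigr => m _; rewrite linearZ.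
Qed.

Lemma bloch_lin_sum (Lin : int -> {poly F} -> F) (ns : seq int) :
  (forall n, scalar (Lin n)) -> {subset ns <= [:: -2; -1; 0; 1]} ->
  \sum_(i < p) \sum_(m <- shifts) U i * E ^ m *
     (\sum_(n <- ns) Lin n (lag (i%:Z + m * p%:Z - n * p%:Z)))
  = \sum_(n <- ns) E ^ n * Lin n q.
Proof.
move=> linL sub.
under eq_bigr => i _ do under eq_bigr => m _ do rewrite mulr_sumr.
under eq_bigr => i _ do rewrite exchange_big.
rewrite exchange_big /= big_seq [RHS]big_seq; apply: eq_bigr => n hn.
exact: bloch_lin (sub _ hn).
Qed.

Lemma bloch_mass b :
  \sum_(i < p) \sum_(m <- shifts) U i * E ^ m * mass1 (i%:Z + m * p%:Z) b
  = E^-1 * cellint (q * lag (b + p%:Z)) + cellint (q * lag b).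
Proof.
rewrite (bloch_lin_sum (Lin := fun n P => cellint (P * lag (b - n * p%:Z)))).
- rewrite !big_cons big_nil addr0 expr0z mul1r mul0r subr0 -exprN1.
  by rewrite mulN1r opprK.
- by move=> n x P Q; rewrite mulrDl -scalerAl linearP.
- by move=> n; rewrite !inE => /orP[] ->; rewrite ?orbT.
Qed.

Lemma bloch_stiff b :
  \sum_(i < p) \sum_(m <- shifts) U i * E ^ m * stiff1 (i%:Z + m * p%:Z) b
  = E^-1 * cellint (q^`() * (lag (b + p%:Z))^`()) + cellint (q^`() * (lag b)^`()).
Proof.
rewrite (bloch_lin_sum (Lin := fun n P => cellint (P^`() * (lag (b - n * p%:Z))^`()))).
- rewrite !big_cons big_nil addr0 expr0z mul1r mul0r subr0 -exprN1.
  by rewrite mulN1r opprK.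
- by move=> n x P Q; rewrite derivD derivZ mulrDl -scalerAl linearP.
- by move=> n; rewrite !inE => /orP[] ->; rewrite ?orbT.
Qed.

Lemma bloch_lag_jump n : n \in [:: -1; 0; 1] ->
  \sum_(i < p) \sum_(m <- shifts) U i * E ^ m * lag_jump (i%:Z + m * p%:Z) n
  = (E ^ n - E ^ (n - 1)) * q^`(p).[0].
Proof.
move=> hn; have lT : scalar (fun P : {poly F} => P^`(p).[0]).
  by move=> x P Q; rewrite linearP hornerD hornerZ.
have h1 : n \in [:: -2; -1; 0; 1] by move: hn; rewrite !inE => /or3P[] ->; rewrite ?orbT.
have h2 : n - 1 \in [:: -2; -1; 0; 1] by move: hn; rewrite !inE => /or3P[] /eqP ->.
rewrite mulrBl -!(bloch_lin lT) // -sumrB; apply: eq_bigr => i _.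
by rewrite -sumrB; apply: eq_bigr => m _; rewrite -mulrBr.
Qed.

Lemma bloch_jump b :
  \sum_(i < p) \sum_(m <- shifts) U i * E ^ m * jump1 (i%:Z + m * p%:Z) b
  = \sum_(n <- [:: -1; 0; 1]) (E ^ n - E ^ (n - 1)) * q^`(p).[0] * lag_jump b n.
Proof.
rewrite /jump1.
under eq_bigr => i _ do under eq_bigr => m _ do rewrite mulr_sumr.
under eq_bigr => i _ do rewrite exchange_big.
rewrite exchange_big /= big_seq [RHS]big_seq; apply: eq_bigr => n hn.
rewrite -bloch_lag_jump // mulr_suml; apply: eq_bigr => i _.
by rewrite mulr_suml; apply: eq_bigr => m _; rewrite mulrA.
Qed.

(** Add the identities of the flux pair on the cell 0 and on the cell -1. The
boundary terms cancel by the Bloch condition [bs] on the flux, and the jumps at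
-1, 0 and 1 are those of the constant p-th derivative of q times differences of
powers of E, whence the factor (1 - E) (1 - 1/E) in the penalty. *)
Lemma bloch_kernel (b : 'I_p) :
  \sum_(i < p) \sum_(m <- shifts) U i * E ^ m * energy1 gamma (i%:Z + m * p%:Z) b
  = lam * \sum_(i < p) \sum_(m <- shifts) U i * E ^ m * mass1 (i%:Z + m * p%:Z) b.
Proof.
have bp := ltn_ord b.
have lag2 : lag (b%:Z - (-1 - 1) * p%:Z) = 0 by apply: lag_out; apply/orP; right; lia.
have lagN : lag (b%:Z - 1 * p%:Z) = 0 by apply: lag_out; apply/orP; left; lia.
have -> : \sum_(i < p) \sum_(m <- shifts)
     U i * E ^ m * energy1 gamma (i%:Z + m * p%:Z) b =
   \sum_(i < p) \sum_(m <- shifts) U i * E ^ m * stiff1 (i%:Z + m * p%:Z) b +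
   gamma * \sum_(i < p) \sum_(m <- shifts) U i * E ^ m * jump1 (i%:Z + m * p%:Z) b.
  rewrite mulr_sumr -big_split /=; apply: eq_bigr => i _.
  rewrite mulr_sumr -big_split /=; apply: eq_bigr => m _; rewrite /energy1; ring.
rewrite bloch_mass bloch_stiff bloch_jump !big_cons big_nil /lag_jump /lag_top.
have Z : (0 : {poly F})^`(p) = 0 by rewrite derivn_small ?size_poly0.
rewrite lag2 lagN Z horner0 subr0 sub0r addr0.
have e2 : b%:Z - -1 * p%:Z = b%:Z + p%:Z by ring.
have e0 : b%:Z - 0 * p%:Z = b%:Z by ring.
have e1 : b%:Z - (0 - 1) * p%:Z = b%:Z + p%:Z by ring.
have e3 : b%:Z - (1 - 1) * p%:Z = b%:Z by ring.
have x1 : E ^ (-1 - 1) = E^-1 * E^-1 by rewrite exprzDr ?unitfE // exprN1.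
have x2 : E ^ (0 - 1) = E^-1 by rewrite sub0r exprN1.
have x3 : E ^ (1 - 1) = 1 by rewrite subrr expr0z.
rewrite ?e2 ?e0 ?e1 ?e3 ?x1 ?x2 ?x3 ?expr0z ?expr1z ?exprN1.
have k1 := hfl (size_lag b); have k2 := hfl (size_lag (b%:Z + p%:Z)).
have bd : boundary_form s (lag b) + E^-1 * boundary_form s (lag (b%:Z + p%:Z)) = 0.
  rewrite /boundary_form -cell_node0 -cell_nodep !lag_node // eqz_nat ltn_eqF // mulr0 sub0r.
  case: (posnP b) => [b0|b0].
    rewrite b0 add0r eqxx !eqz_nat eqn0Ngt p0 /= mulr0 subr0 !mulr1.
    by rewrite eqxx mulr1 cell_node0 cell_nodep bs mulKf // addNr.
  have f1 : (b%:Z == 0%:Z) = false by apply/eqP; lia.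
  have f2 : (b%:Z + p%:Z == p%:Z) = false by apply/eqP; lia.
  have f3 : (b%:Z + p%:Z == 0%:Z) = false by apply/eqP; lia.
  by rewrite f1 f2 f3 !mulr0 subr0 mulr0 oppr0 addr0.
rewrite -[RHS]addr0 -[X in _ = _ + X]bd -k1 -k2 /cell_form.
move: (cellint _) (cellint _) (cellint _) (cellint _) => A B C D.
move: (q^`(p).[0]) ((lag b)^`(p).[0]) ((lag (b%:Z + p%:Z))^`(p).[0]) => T T1 T2.
by field.
Qed.

End BlochKernel.
End LagrangeBasis.

(** The flux pairs have real coefficients whereas the Bloch phase is complex: they
are transported along the embedding of the reals. *)
Section Transfer.
Variables (F G : numFieldType) (f : {rmorphism F -> G}).
Local Notation mapf := (map_poly f).
Implicit Types (P Q : {poly F}).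

Lemma cellint_map P : cellint (mapf P) = f (cellint P).
Proof.
rewrite (cellint_wide (n := size P)) ?size_map_poly // rmorph_sum.
apply: eq_bigr => i _; rewrite coef_map rmorphM; congr (_ * _).
rewrite /cell_moment rmorphM fmorphV rmorph_nat rmorphB !rmorphXn rmorphN.
by rewrite /= fmorphV rmorph_nat.
Qed.

Lemma derivn_map_poly n P : mapf P^`(n) = (mapf P)^`(n).
Proof. by elim: n P => [//|n IH] P; rewrite !derivSn IH deriv_map. Qed.

Lemma bubble_map n : mapf (bubble F n) = bubble G n.
Proof.
rewrite /bubble rmorphXn rmorphB /= map_polyXn map_polyC /=.
by rewrite fmorphV rmorph_nat.
Qed.

Lemma legendre_map n : mapf (legendre F n) = legendre G n.
Proof. by rewrite /legendre derivn_map_poly bubble_map. Qed.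

Lemma legendre_deriv_map n : mapf (legendre F n)^`() = (legendre G n)^`().
Proof. by rewrite -deriv_map legendre_map. Qed.

Lemma bubble_mass_map n : f (bubble_mass F n) = bubble_mass G n.
Proof.
by rewrite /bubble_mass -bubble_map cellint_map rmorphM rmorphXn rmorphN rmorph1.
Qed.

Lemma helm_map lam n Q : mapf (helm lam n Q) = helm (f lam) n (mapf Q).
Proof.
elim: n => [|n IH] /=; first by rewrite rmorph0.
by rewrite rmorphD /= map_polyZ /= IH rmorphN derivn_map_poly.
Qed.

Local Arguments helm : simpl never.

Lemma sol_low_map p lam : mapf (sol_low p lam) = sol_low p (f lam).
Proof.
by rewrite /sol_low map_polyZ /= helm_map fmorphV rmorph_nat -deriv_map legendre_map.
Qed.

Lemma flux_low_map p lam : mapf (flux_low p lam) = flux_low p (f lam).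
Proof.
rewrite /flux_low rmorphD /= map_polyZ /= -deriv_map sol_low_map legendre_map.
by rewrite rmorphM fmorphV rmorph_nat rmorphXn rmorphN.
Qed.

Lemma sol_full_map p lam eta : mapf (sol_full p lam eta) = sol_full p (f lam) (f eta).
Proof.
rewrite /sol_full rmorphD /= !map_polyZ /= !helm_map !legendre_deriv_map.
by rewrite fmorphV rmorph_nat.
Qed.

Lemma flux_full_map p lam eta : mapf (flux_full p lam eta) = flux_full p (f lam) (f eta).
Proof.
rewrite /flux_full rmorphD [X in _ + X]rmorphD /= !map_polyZ /= -deriv_map sol_full_map !legendre_map.
by rewrite fmorph_div rmorph_nat rmorphM !rmorphXn rmorphN.
Qed.

Lemma cell_node_map p r : f (cell_node F p r) = cell_node G p r.
Proof. by rewrite /cell_node rmorphB rmorphM !fmorphV !rmorph_nat. Qed.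

Lemma lag_map p j : mapf (lag F p j) = lag G p j.
Proof.
case: j => [r|r]; rewrite /lag; last by rewrite rmorph0.
case: ifP => _; last by rewrite rmorph0.
rewrite /lagrange_poly rmorph_prod; apply: eq_bigr => i _ /=.
by rewrite map_polyZ /= fmorphV rmorphB !cell_node_map map_polyXsubC cell_node_map.
Qed.

Lemma mass1_map p a b : f (mass1 F p a b) = mass1 G p a b.
Proof.
rewrite /mass1 rmorph_sum; apply: eq_bigr => n _ /=.
by rewrite -cellint_map rmorphM /= !lag_map.
Qed.

Lemma lag_top_map p j : f (lag_top F p j) = lag_top G p j.
Proof. by rewrite /lag_top -lag_map -derivn_map_poly -horner_map rmorph0. Qed.

Lemma energy1_map p gamma a b : f (energy1 p gamma a b) = energy1 p (f gamma) a b.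
Proof.
rewrite /energy1 rmorphD rmorphM; congr (_ + _ * _).
  rewrite /stiff1 rmorph_sum; apply: eq_bigr => n _ /=.
  by rewrite -cellint_map rmorphM /= -!deriv_map !lag_map.
rewrite /jump1 rmorph_sum; apply: eq_bigr => n _ /=.
by rewrite /lag_jump rmorphM !rmorphB !lag_top_map.
Qed.

End Transfer.

(** * Complex Bloch vectors *)

Section Expi.
Variable R : realType.
Implicit Types (a b t : R) (m : int).
Local Notation toC := (real_complex R).

Lemma expiD a b : expi (a + b) = expi a * expi b.
Proof. by rewrite /expi cosD sinD; simpc; congr (_ +i* _)%C; ring. Qed.

Lemma expi0 : expi (0 : R) = 1.
Proof. by rewrite /expi cos0 sin0. Qed.

Lemma expiN a : expi (- a) = (expi a)^-1.
Proof.
have h : expi a * expi (- a) = 1 by rewrite -expiD subrr expi0.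
have n0 : expi a != 0.
  by apply/eqP => e; move: h; rewrite e mul0r => /esym/eqP; rewrite oner_eq0.
by apply: (mulfI n0); rewrite h divff.
Qed.

Lemma expi_neq0 a : expi a != 0.
Proof.
apply/eqP => e; have : expi a * expi (- a) = 1 by rewrite -expiD subrr expi0.
by rewrite e mul0r => /esym/eqP; rewrite oner_eq0.
Qed.

Lemma expi_int m t : expi (m%:~R * t) = expi t ^ m.
Proof.
have hn (n : nat) : expi (n%:R * t) = expi t ^+ n.
  elim: n => [|n IH]; first by rewrite mul0r expi0.
  by rewrite -natr1 mulrDl mul1r expiD IH exprSr.
case: m => n; first by rewrite -exprnP -pmulrn hn.
by rewrite NegzE -exprnN mulrNz mulNr expiN -pmulrn hn.
Qed.

Lemma toC_cos t : toC (2 * cos t) = expi t + (expi t)^-1.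
Proof.
rewrite -expiN /expi cosN sinN; apply/eqP; rewrite eq_complex /=.
by apply/andP; split; apply/eqP; ring.
Qed.

Lemma toC_sin t : 'i%C * toC (2 * sin t) = expi t - (expi t)^-1.
Proof.
rewrite -expiN /expi cosN sinN; apply/eqP; rewrite eq_complex /=.
by apply/andP; split; apply/eqP; ring.
Qed.

End Expi.

Section BlochVector.
Variables (R : realType) (p : nat) (gamma : R).
Hypothesis p0 : (0 < p)%N.
Variables (t l : R).
Local Notation toC := (real_complex R).
Local Notation C := (R[i]).

(** The combination q = c2 o(1/2) e + s2 e(1/2) o of the even solution e and the
odd solution o, with c2 = 2 cos (t/2) and s2 = 2 i sin (t/2),
satisfies the Bloch condition on the value whatever l is. The same condition on
its flux is [bloch_eq]. *)
Lemma bloch_vector :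
  bloch_eq p gamma (jump_weight t) l = 0 ->
  (sol_even p gamma (jump_weight t) l).[2^-1] != 0 ->
  (sol_odd p gamma (jump_weight t) l).[2^-1] != 0 ->
  exists U : 'I_p -> C, (exists i, U i != 0) /\
   forall b : 'I_p,
    \sum_(i < p) \sum_(m <- shifts)
       U i * expi (m%:~R * t) * toC (energy1 p gamma (i%:Z + m * p%:Z) b)
    = toC l * \sum_(i < p) \sum_(m <- shifts)
       U i * expi (m%:~R * t) * toC (mass1 R p (i%:Z + m * p%:Z) b).
Proof.
set w := jump_weight t => beq e0 o0.
pose c := gamma / bubble_mass R p.-1.
pose e := map_poly toC (sol_even p gamma w l).
pose o := map_poly toC (sol_odd p gamma w l).
pose se := map_poly toC (flux_even p gamma w l).
pose so := map_poly toC (flux_odd p gamma w l).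
pose H := expi (t / 2).
have H0 : H != 0 := expi_neq0 _.
pose E := expi t.
have EH : E = H * H by rewrite /E /H -expiD -mulrDl -mulr2n -[t *+ 2]mulr_natr mulfK ?pnatr_eq0.
pose c2 := H + H^-1; pose s2 := H - H^-1.
have c2E : toC (2 * cos (t / 2)) = c2 := toC_cos _.
have s2E : 'i%C * toC (2 * sin (t / 2)) = s2 := toC_sin _.
have wE : toC w = - (s2 * s2).
  rewrite -s2E mulrACA -expr2 sqr_i mulN1r opprK -rmorphM /w /jump_weight /=.
  by congr (toC _); ring.
clearbody w.
have wE' : toC w = (1 - E) * (1 - E^-1) by rewrite wE EH /s2; field.
have hh : 2^-1 = toC 2^-1 by rewrite fmorphV rmorph_nat.
have ev : e.[2^-1] = toC (sol_even p gamma w l).[2^-1] by rewrite hh horner_map.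
have ov : o.[2^-1] = toC (sol_odd p gamma w l).[2^-1] by rewrite hh horner_map.
have sev : se.[2^-1] = toC (flux_even p gamma w l).[2^-1] by rewrite hh horner_map.
have sov : so.[2^-1] = toC (flux_odd p gamma w l).[2^-1] by rewrite hh horner_map.
have hN : - 2^-1 = toC (- 2^-1) by rewrite rmorphN hh.
have evN : e.[- 2^-1] = e.[2^-1].
  by rewrite hN horner_map ev (parity_horner _ (parity_sol_even p0 gamma w l)) mul1r.
have ovN : o.[- 2^-1] = - o.[2^-1].
  by rewrite hN horner_map ov (parity_horner _ (parity_sol_odd p0 gamma w l)) mulN1r rmorphN.
have sevN : se.[- 2^-1] = - se.[2^-1].
  by rewrite hN horner_map sev (parity_horner _ (parity_flux_even p0 gamma w l)) mulN1r rmorphN.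
have sovN : so.[- 2^-1] = so.[2^-1].
  by rewrite hN horner_map sov (parity_horner _ (parity_flux_odd p0 gamma w l)) mul1r.
have be : (c2 * c2) * o.[2^-1] * se.[2^-1] = (s2 * s2) * e.[2^-1] * so.[2^-1].
  have := congr1 toC beq; rewrite /bloch_eq rmorph0 rmorphD !rmorphM rmorphB /=.
  rewrite -ev -ov -sev -sov wE rmorph_nat => h.
  have c4 : 4 - - (s2 * s2) = c2 * c2 by rewrite /s2 /c2; field.
  by rewrite c4 in h; apply/subr0_eq; rewrite -[RHS]h; ring.
pose q := (o.[2^-1] * c2) *: e + (s2 * e.[2^-1]) *: o.
pose s := (o.[2^-1] * c2) *: se + (s2 * e.[2^-1]) *: so.
have sz_e : (size e <= p.+1)%N by rewrite size_map_poly size_sol_even.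
have sz_o : (size o <= p.+1)%N by rewrite size_map_poly size_sol_odd.
have sq : (size q <= p.+1)%N.
  rewrite (leq_trans (size_polyD _ _)) // geq_max.
  by rewrite !(leq_trans (size_scale_leq _ _)).
have eta : toC (c * w) = toC gamma * ((1 - E) * (1 - E^-1)) / bubble_mass C p.-1.
  by rewrite -wE' /c -(bubble_mass_map toC) rmorphM fmorph_div mulrAC.
have fC := @flux_pair_sol_low C p (toC gamma * ((1 - E) * (1 - E^-1))) (toC l).
have fA := @flux_pair_sol_full C p (toC gamma * ((1 - E) * (1 - E^-1))) (toC l) p0.
have fe : flux_pair p (toC gamma * ((1 - E) * (1 - E^-1))) (toC l) e se.
  rewrite /e /se /sol_even /flux_even -/c; case: (odd p).
    by rewrite sol_low_map flux_low_map.
  by rewrite sol_full_map flux_full_map /= eta.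
have fo : flux_pair p (toC gamma * ((1 - E) * (1 - E^-1))) (toC l) o so.
  rewrite /o /so /sol_odd /flux_odd -/c; case: (odd p).
    by rewrite sol_full_map flux_full_map /= eta.
  by rewrite sol_low_map flux_low_map.
have fq := flux_pair_lin (o.[2^-1] * c2) (s2 * e.[2^-1]) fe fo.
have qN : q.[- 2^-1] = 2 * (e.[2^-1] * o.[2^-1]) / H.
  by rewrite /q hornerD !hornerZ evN ovN /c2 /s2; field.
have bq : q.[2^-1] = E * q.[- 2^-1].
  by rewrite qN /q hornerD !hornerZ EH /c2 /s2; field.
have bs : s.[2^-1] = E * s.[- 2^-1].
  rewrite /s !hornerD !hornerZ sevN sovN EH.
  apply/eqP; rewrite -subr_eq0; apply/eqP.
  transitivity (H * ((c2 * c2) * o.[2^-1] * se.[2^-1] - (s2 * s2) * e.[2^-1] * so.[2^-1])).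
    by rewrite /c2 /s2; field.
  by rewrite be subrr mulr0.
have := bloch_kernel p0 (expi_neq0 t) sq fq bq bs.
move=> ker; exists (fun i : 'I_p => q.[cell_node C p i]); split.
  exists (Ordinal p0) => /=; rewrite cell_node0 qN ev ov.
  by rewrite !mulf_neq0 ?invr_neq0 ?pnatr_eq0 ?fmorph_eq0.
move=> b; have := ker b.
have tr (X : int -> R) (Y : int -> C) : (forall a, toC (X a) = Y a) ->
  \sum_(i < p) \sum_(m <- shifts) q.[cell_node C p i] * expi (m%:~R * t) * toC (X (i%:Z + m * p%:Z))
  = \sum_(i < p) \sum_(m <- shifts) q.[cell_node C p i] * E ^ m * Y (i%:Z + m * p%:Z).
  move=> h; apply: eq_bigr => i _; apply: eq_bigr => m _.
  by rewrite expi_int h.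
rewrite (tr (fun a => energy1 p gamma a b) (fun a => energy1 p (toC gamma) a b)); last first.
  by move=> a; rewrite energy1_map.
rewrite (tr (fun a => mass1 R p a b) (fun a => mass1 C p a b)); last first.
  by move=> a; rewrite mass1_map.
exact.
Qed.

End BlochVector.

(** * Integrals of piecewise polynomials *)

Section PiecewiseIntegrals.
Variable R : realType.
Notation mu := (@lebesgue_measure R).
Implicit Types (F G : R -> R) (P Q : {poly R}) (a b h : R).

Lemma measurable_horner_itv P (A : set R) : measurable A ->
  measurable_fun A (fun x => P.[x]).
Proof.
move=> mA; apply: (@measurable_funS _ _ _ _ setT) => //.
by apply: continuous_measurable_fun; exact: continuous_horner.
Qed.

(** At the mesh points the derivative of a piecewise polynomial function has no
useful value; hence these lemmas ask nothing about the end points. *)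
Lemma open_cell_measurable F P a b :
  (forall x, a < x < b -> F x = P.[x]) -> measurable_fun `]a, b[ F.
Proof.
move=> h; apply: (eq_measurable_fun (fun x => P.[x])).
  by move=> x; rewrite inE /= in_itv /= => /h.
exact: measurable_horner_itv.
Qed.

Lemma open_cell_integrable F P a b : a < b ->
  (forall x, a < x < b -> F x = P.[x]) -> mu.-integrable `[a, b] (EFin \o F).
Proof.
move=> ab h; have mF := open_cell_measurable h.
apply/integrableP; split.
  by apply/measurable_EFinP; apply: measurable_fun_itv_cc mF.
have -> : (\int[mu]_(x in `[a, b]) `|(EFin \o F) x|)%E =
   (\int[mu]_(x in `[a, b]) `|(EFin \o horner P) x|)%E.
  rewrite (@eq_integral_itv_bounded R a b (fun x => `|P.[x]|) (fun x => `|F x|)) //.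
  - exact: measurableT_comp mF.
  - by apply: measurableT_comp => //; exact: measurable_horner_itv.
  - by move=> x; rewrite in_itv /= => /h ->.
have := @continuous_itv_integrable R (horner P) a b (@continuous_horner _ P).
by case/integrableP.
Qed.

Lemma open_cell_Rintegral F P a b (b0 b1 : bool) :
  (forall x, a < x < b -> F x = P.[x]) ->
  \int[mu]_(x in [set` Interval (BSide b0 a) (BSide b1 b)]) F x =
  \int[mu]_(x in `[a, b]) P.[x].
Proof.
move=> h; have mF := open_cell_measurable h.
have mP : measurable_fun `]a, b[ (horner P) by exact: measurable_horner_itv.
rewrite /Rintegral; congr fine.
rewrite integral_itv_bndoo; last exact/measurable_EFinP.
rewrite (@integral_itv_bndoo _ a b (EFin \o horner P) true false); last exact/measurable_EFinP.
by apply: eq_integral => x; rewrite inE /= in_itv /= => /h ->.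
Qed.

Lemma two_cell_integral F P Q h : 0 < h ->
  (forall x, - h < x < 0 -> F x = P.[x]) -> (forall x, 0 < x < h -> F x = Q.[x]) ->
  (forall x, x < - h \/ h < x -> F x = 0) ->
  mu.-integrable setT (EFin \o F) /\
  \int[mu]_x F x =
    \int[mu]_(x in `[- h, 0]) P.[x] + \int[mu]_(x in `[0, h]) Q.[x].
Proof.
move=> h0 hP hQ hz; have hN : - h < 0 by lra.
have i1 := open_cell_integrable hN hP; have i2 := open_cell_integrable h0 hQ.
pose A : set R := `[- h, 0[%classic; pose B : set R := `[0, h]%classic.
have mA : measurable A by exact: measurable_itv.
have mB : measurable B by exact: measurable_itv.
have i1' : mu.-integrable A (EFin \o F).
  by apply: integrableS i1 => //; apply: subset_itvl; rewrite bnd_simp.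
have j1 : mu.-integrable setT (EFin \o (F \_ A)).
  by have := (@integrable_mkcond _ _ _ mu A (EFin \o F) mA).1 i1'; rewrite restrict_EFin.
have j2 : mu.-integrable setT (EFin \o (F \_ B)).
  by have := (@integrable_mkcond _ _ _ mu B (EFin \o F) mB).1 i2; rewrite restrict_EFin.
have e : F = (fun x => (F \_ A) x + (F \_ B) x).
  apply/funext => x; rewrite !patchE /A /B !mem_setE !in_itv /=.
  have [x0|x0] := ltP x 0; rewrite ?andbT ?andbF /= ?addr0 ?add0r.
    by case: leP => // hx; rewrite hz //; left.
  by case: leP => // hx; rewrite hz //; right.
split.
  have -> : (EFin \o F) = ((EFin \o (F \_ A)) \+ (EFin \o (F \_ B)))%E.
    by apply/funext => x; rewrite /= [in LHS]e EFinD.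
  exact: (@integrableD _ _ _ mu setT measurableT _ _ j1 j2).
rewrite [in LHS]e RintegralD // -!Rintegral_mkcond.
by rewrite (open_cell_Rintegral _ _ hP) (open_cell_Rintegral _ _ hQ).
Qed.

Lemma cell_Rintegral P h (m : R) : 0 < h ->
  \int[mu]_(x in `[m * h, (m + 1) * h]) P.[x] =
  h * cellint (P \Po (h *: 'X + (h * (m + 2^-1))%:P)).
Proof.
move=> h0; have [Q eQ] := poly_antiderivative P.
have dQ x : is_derive x (1:R) (horner Q) P.[x].
  by have := is_derive_poly Q x; rewrite eQ.
have mh : m * h < (m + 1) * h by rewrite ltr_pM2r //; lra.
rewrite (@Rintegral_derive _ (horner Q) (horner P) _ _ mh) //; last exact: continuous_horner.
have -> : h * cellint (P \Po (h *: 'X + (h * (m + 2^-1))%:P)) =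
    cellint (Q \Po (h *: 'X + (h * (m + 2^-1))%:P))^`().
  rewrite deriv_comp eQ derivD derivZ derivX derivC addr0.
  by rewrite -linearZ /= -scalerAr mulr1.
by rewrite cellint_deriv !horner_comp !hornerE; congr (_.[_] - _.[_]); field.
Qed.

Lemma Rintegral_prod F G :
  mu.-integrable setT (EFin \o F) -> mu.-integrable setT (EFin \o G) ->
  (mu \x mu)%E.-integrable setT (EFin \o (fun z : R * R => F z.1 * G z.2)) /\
  \int[(mu \x mu)%E]_z (F z.1 * G z.2) = (\int[mu]_x F x) * (\int[mu]_x G x).
Proof.
move=> iF iG; have [mF fF] := integrableP _ _ _ iF; have [mG fG] := integrableP _ _ _ iG.
have mFr : measurable_fun setT F by apply/measurable_EFinP.
have mGr : measurable_fun setT G by apply/measurable_EFinP.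
have mFG : measurable_fun [set: R * R] (fun z : R * R => F z.1 * G z.2).
  apply: measurable_funM.
    exact: (measurableT_comp mFr measurable_fst).
  exact: (measurableT_comp mGr measurable_snd).
have iFG : (mu \x mu)%E.-integrable setT (EFin \o (fun z : R * R => F z.1 * G z.2)).
  apply/integrable12ltyP; first exact/measurable_EFinP.
  have e1 (x : R) : (\int[mu]_y `|(EFin \o (fun z : R * R => (F z.1 * G z.2)%R)) (x, y)|)%E =
      (`|F x|%:E * \int[mu]_y `|(EFin \o G) y|)%E.
    rewrite -ge0_integralZl_EFin //; last first.
      by apply: measurableT_comp => //.
    by apply: eq_integral => y _; rewrite /= normrM EFinM.
  under eq_integral => x _ do rewrite e1.
  rewrite ge0_integralZr //; last first.
  - exact: integral_ge0.
  - by apply/measurable_EFinP; apply: measurableT_comp.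
  rewrite lte_mul_pinfty //; first exact: integral_ge0.
  by rewrite ge0_fin_numE //; exact: integral_ge0.
split => //.
have fG' : (\int[mu]_x (EFin \o G) x)%E \is a fin_num by exact: integrable_fin_num.
have fF' : (\int[mu]_x (EFin \o F) x)%E \is a fin_num by exact: integrable_fin_num.
rewrite /Rintegral -integral12_prod_meas1 // -fineM //; congr fine.
have e2 (x : R) : (\int[mu]_y (F x * G y)%:E)%E =
    ((fine (\int[mu]_x (EFin \o G) x))%:E * (EFin \o F) x)%E.
  by rewrite fineK // muleC -integralZl.
transitivity (\int[mu]_x ((fine (\int[mu]_x (EFin \o G) x))%:E * (EFin \o F) x))%E.
  by apply: eq_integral => x _; rewrite -e2.
by rewrite integralZl // fineK // muleC.
Qed.

End PiecewiseIntegrals.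

(** * The nodal basis functions *)

Section HatFunctions.
Variable R : realType.
Variables (p : nat) (h : R).
Hypotheses (p0 : (0 < p)%N) (h0 : 0 < h).
Implicit Types (i j m n : int) (x y : R).

Definition cell_poly i m : {poly R} :=
  lag R p (i - m * p%:Z) \Po (h^-1 *: 'X - (m%:~R + 2^-1)%:P).

(** At a mesh point this picks the cell to the right; [hat_cell] shows that the
left one gives the same value. *)
Definition hat i x : R := (cell_poly i (Num.floor (x / h))).[x].

Lemma cell_polyE i m x :
  (cell_poly i m).[x] = (lag R p (i - m * p%:Z)).[x / h - m%:~R - 2^-1].
Proof.
rewrite /cell_poly horner_comp !hornerE; congr (_.[_]); rewrite mulrC; ring.
Qed.

Lemma cell_poly_glue i m :
  (cell_poly i (m + 1)).[(m + 1)%:~R * h] = (cell_poly i m).[(m + 1)%:~R * h].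
Proof.
have hn : h != 0 by rewrite gt_eqF.
rewrite !cell_polyE mulfK // subrr sub0r.
have -> : (m + 1)%:~R - m%:~R - 2^-1 = 2^-1 :> R by rewrite intrD; field.
rewrite -(cell_node0 R p) -(cell_nodep R p0) !lag_node //; congr ((_ : bool)%:R).
by apply/eqP/eqP; lia.
Qed.

Lemma hat_cell i m x : m%:~R * h <= x <= (m + 1)%:~R * h -> hat i x = (cell_poly i m).[x].
Proof.
move=> /andP[h1 h2]; rewrite /hat.
have [e|ne] := eqVneq x ((m + 1)%:~R * h).
  by rewrite e mulfK ?gt_eqF // intrKfloor cell_poly_glue.
have h3 : x < (m + 1)%:~R * h by rewrite lt_neqAle ne.
suff -> : Num.floor (x / h) = m by [].
by apply/floor_def; rewrite ler_pdivlMr // h1 ltr_pdivrMr.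
Qed.

Lemma right_cell x : exists m, m%:~R * h <= x < (m + 1)%:~R * h.
Proof.
exists (Num.floor (x / h)); rewrite -ler_pdivlMr // -ltr_pdivrMr //.
by rewrite floor_le_tmp /= ?floorD1_gt // ?num_real.
Qed.

Lemma left_cell x : exists m, m%:~R * h < x <= (m + 1)%:~R * h.
Proof.
have [m /andP[h1 h2]] := right_cell x.
have [e|ne] := eqVneq (m%:~R * h) x.
  exists (m - 1); rewrite subrK e lexx andbT -e ltr_pM2r // ltr_int; lia.
by exists m; rewrite lt_neqAle ne h1 ltW.
Qed.

Lemma near_right_cell x m : m%:~R * h <= x < (m + 1)%:~R * h ->
  \forall y \near x^'+, m%:~R * h < y < (m + 1)%:~R * h.
Proof.
move=> /andP[h1 h2]; near=> y; apply/andP; split.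
  by rewrite (le_lt_trans h1) //; near: y; exact: nbhs_right_gt.
by near: y; exact: nbhs_right_lt.
Unshelve. all: by end_near. Qed.

Lemma near_left_cell x m : m%:~R * h < x <= (m + 1)%:~R * h ->
  \forall y \near x^'-, m%:~R * h < y < (m + 1)%:~R * h.
Proof.
move=> /andP[h1 h2]; near=> y; apply/andP; split.
  by near: y; exact: nbhs_left_gt.
by apply: lt_le_trans h2; near: y; exact: nbhs_left_lt.
Unshelve. all: by end_near. Qed.

Lemma hat_open i m x : m%:~R * h < x < (m + 1)%:~R * h -> hat i x = (cell_poly i m).[x].
Proof. by move=> /andP[a b]; apply: hat_cell; rewrite !ltW. Qed.

Lemma continuous_hat i : continuous (hat i).
Proof.
move=> x; apply/left_right_continuousP; split.
  have [m hm] := left_cell x; have /andP[a b] := hm.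
  rewrite (@hat_cell i m) ?b ?ltW //.
  have c : (cell_poly i m).[y] @[y --> x^'-] --> (cell_poly i m).[x].
  by apply: cvg_at_left_filter; exact: continuous_horner.
apply: cvg_trans c.
  apply: near_eq_cvg; have := near_left_cell hm; apply: filterS => y hy.
  by rewrite (hat_open _ hy).
have [m hm] := right_cell x; have /andP[a b] := hm.
rewrite (@hat_cell i m) ?a ?ltW //.
have c : (cell_poly i m).[y] @[y --> x^'+] --> (cell_poly i m).[x].
  by apply: cvg_at_right_filter; exact: continuous_horner.
apply: cvg_trans c.
apply: near_eq_cvg; have := near_right_cell hm; apply: filterS => y hy.
by rewrite (hat_open _ hy).
Qed.

Lemma node_cell (m : int) (r : nat) :
  (m * p%:Z + r%:Z)%:~R * h / p%:R / h - m%:~R - 2^-1 = cell_node R p r.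
Proof.
have hn : h != 0 by rewrite gt_eqF.
have pn := pF0 R p0.
by rewrite /cell_node intrD intrM; field; rewrite hn pn.
Qed.

Lemma node_in_cell (m : int) (r : nat) : (r <= p)%N ->
  m%:~R * h <= (m * p%:Z + r%:Z)%:~R * h / p%:R <= (m + 1)%:~R * h.
Proof.
move=> rp; have pp : 0 < p%:R :> R by rewrite ltr0n.
have e : (m * p%:Z + r%:Z)%:~R * h / p%:R = m%:~R * h + r%:R / p%:R * h.
  by rewrite intrD intrM; field; rewrite gt_eqF.
have a : 0 <= r%:R / p%:R :> R by rewrite divr_ge0.
have b : r%:R / p%:R <= 1 :> R by rewrite ler_pdivrMr // mul1r ler_nat.
rewrite e; apply/andP; split; first by rewrite lerDl mulr_ge0 // ltW.
rewrite intrD mulrDl lerD2l; apply: ler_wpM2r => //; exact: ltW.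
Qed.

Lemma hat_node i j : hat i (j%:~R * h / p%:R) = (i == j)%:R.
Proof.
pose m := (j %/ p%:Z)%Z; pose r := `|(j %% p%:Z)%Z|%N.
have pn : p%:Z != 0 by rewrite eqz_nat -lt0n.
have er : r%:Z = (j %% p%:Z)%Z by rewrite /r gez0_abs // modz_ge0.
have ej : j = m * p%:Z + r%:Z by rewrite er -divz_eq.
have rp : (r < p)%N by rewrite -ltz_nat er ltz_pmod // ltz_nat.
rewrite ej (@hat_cell i m); last exact/node_in_cell/ltnW.
rewrite cell_polyE node_cell (lag_node R p0) ?(ltnW rp) //.
by congr ((_ : bool)%:R); apply/eqP/eqP; lia.
Qed.

Definition hat2 i j (z : R * R) : R := hat i z.1 * hat j z.2.

Lemma size_cell_poly i m : (size (cell_poly i m) <= p.+1)%N.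
Proof.
rewrite /cell_poly; have hn : h^-1 != 0 by rewrite invr_eq0 gt_eqF.
have [->|P0] := eqVneq (lag R p (i - m * p%:Z)) 0; first by rewrite comp_poly0 size_poly0.
rewrite size_comp_poly2; first exact: size_lag.
rewrite size_polyDl size_scale // size_polyX // size_polyN.
by rewrite (leq_ltn_trans (size_polyC_leq1 _)).
Qed.

Lemma hat2_fe i j : fe_space p h (hat2 i j).
Proof.
split.
  move=> z; apply: cvgM.
    by apply: (@continuous_comp _ _ _ fst (hat i)); [exact: cvg_fst|exact: continuous_hat].
  by apply: (@continuous_comp _ _ _ snd (hat j)); [exact: cvg_snd|exact: continuous_hat].
move=> m n; exists (\matrix_(a, b) ((cell_poly i m)`_a * (cell_poly j n)`_b)).
move=> [x y] [] /=; rewrite /mesh_interval /= !in_itv /= => hx hy.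
rewrite /hat2 /= (hat_cell _ hx) (hat_cell _ hy).
rewrite !(horner_coef_wide _ (size_cell_poly _ _)) mulr_suml.
apply: eq_bigr => a _; rewrite mulr_sumr; apply: eq_bigr => b _.
by rewrite mxE; ring.
Qed.

(** On each square the difference is a polynomial of degree at most p in each
variable that vanishes on a grid of (p+1)^2 nodes. For y on the grid it vanishes
at p+1 values of x, so its coefficients in x are zero; these are polynomials in y
with p+1 zeros. *)
Lemma fe_unique (u v : R * R -> R) : fe_space p h u -> fe_space p h v ->
  (forall i j, u (node p h i j) = v (node p h i j)) -> u = v.
Proof.
move=> [_ hu] [_ hv] e; apply/funext => -[x y].
have [m hm] := right_cell x; have [n hn] := right_cell y.
have /andP[hm1 hm2] := hm; have /andP[hn1 hn2] := hn.
have [c hc] := hu m n; have [d hd] := hv m n.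
pose dd a b := c a b - d a b.
have diff z : mesh_square h m n z ->
  u z - v z = \sum_(a < p.+1) (\sum_(b < p.+1) dd a b * z.2 ^+ b) * z.1 ^+ a.
  move=> hz; rewrite (hc _ hz) (hd _ hz) -sumrB; apply: eq_bigr => a _.
  rewrite -sumrB mulr_suml; apply: eq_bigr => b _; rewrite /dd; ring.
pose nx (r : nat) : R := (m * p%:Z + r%:Z)%:~R * h / p%:R.
pose ny (r : nat) : R := (n * p%:Z + r%:Z)%:~R * h / p%:R.
have injn (k : int) : injective (fun r : nat => (k * p%:Z + r%:Z)%:~R * h / p%:R : R).
  move=> r s /(mulIf (invr_neq0 (pF0 R p0))) /(mulIf (lt0r_neq0 h0)) /eqP.
  by rewrite eqr_int => /eqP /addrI [].
have roots (P : {poly R}) (k : int) : (size P <= p.+1)%N ->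
    (forall r, (r <= p)%N -> P.[(k * p%:Z + r%:Z)%:~R * h / p%:R] = 0) -> P = 0.
  move=> sP hP; apply/eqP/negPn/negP => ne0.
  have := @max_poly_roots _ P [seq (k * p%:Z + r%:Z)%:~R * h / p%:R | r : nat <- iota 0 p.+1] ne0.
  rewrite size_map size_iota => /(_ _ _) H.
  suff : (p.+1 < size P)%N by rewrite ltnNge sP.
  apply: H; last by rewrite map_inj_uniq ?iota_uniq //; exact: injn.
  apply/allP => z /mapP[r]; rewrite mem_iota add0n ltnS => /andP[_ rp] ->.
  by rewrite /root hP.
have insq r s : (r <= p)%N -> (s <= p)%N -> mesh_square h m n (nx r, ny s).
  by move=> rp sp; split; rewrite /mesh_interval /= in_itv /= node_in_cell.
have row y' : (forall r, (r <= p)%N ->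
     \sum_(a < p.+1) (\sum_(b < p.+1) dd a b * y' ^+ b) * nx r ^+ a = 0) ->
   forall a : 'I_p.+1, \sum_(b < p.+1) dd a b * y' ^+ b = 0.
  move=> hr a; pose P : {poly R} := \poly_(a < p.+1) (\sum_(b < p.+1) dd (inord a) b * y' ^+ b).
  have P0 : P = 0.
    apply: (roots P m); first exact: size_poly.
    move=> r rp; rewrite horner_poly -[RHS](hr r rp); apply: eq_bigr => a' _.
    by rewrite inord_val.
  have := congr1 (fun Q : {poly R} => Q`_a) P0.
  by rewrite coef_poly ltn_ord coef0 inord_val.
have z1 (s : nat) (a : 'I_p.+1) : (s <= p)%N -> \sum_(b < p.+1) dd a b * ny s ^+ b = 0.
  move=> sp; move: a; apply: row => r rp; have /= <- := diff _ (insq r s rp sp).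
  by apply/eqP; rewrite subr_eq0; apply/eqP; exact: (e (m * p%:Z + r%:Z) (n * p%:Z + s%:Z)).
have z2 (a : 'I_p.+1) y' : \sum_(b < p.+1) dd a b * y' ^+ b = 0.
  pose P : {poly R} := \poly_(b < p.+1) dd a (inord b).
  have P0 : P = 0.
    apply: (roots P n); first exact: size_poly.
    move=> s sp; rewrite horner_poly -[RHS](z1 s a sp); apply: eq_bigr => b' _.
    by rewrite inord_val.
  have := congr1 (fun Q : {poly R} => Q.[y']) P0.
  rewrite horner_poly horner0 => e0; rewrite -[RHS]e0; apply: eq_bigr => b _.
  by rewrite inord_val.
apply/eqP; rewrite -subr_eq0 diff.
  by apply/eqP; apply: big1 => a _; rewrite z2 mul0r.
by split; rewrite /mesh_interval /= in_itv /= ?hm1 ?hn1 /= ltW.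
Qed.

Lemma phiE i j : phi p h i j = hat2 i j.
Proof.
have hb : is_nodal_basis p h i j (hat2 i j).
  split; first exact: hat2_fe.
  move=> i' j'; rewrite /hat2 /node /= !hat_node -natrM mulnb.
  by rewrite (eq_sym i) (eq_sym j).
rewrite /phi; case: xgetP => [u _ [fu hu]|/(_ _ hb) //].
apply: fe_unique => //; first exact: hat2_fe.
by move=> i' j'; rewrite hu; case: hb => _ ->.
Qed.

End HatFunctions.

(** * Derivatives and jumps of the basis functions *)

Section Derivatives.
Variable R : realType.
Implicit Types (f : R -> R) (P : {poly R}) (a b x c : R).

Lemma derive1n_open f P a b n : (forall x, a < x < b -> f x = P.[x]) ->
  forall x, a < x < b -> derive1n n f x = P^`(n).[x].
Proof.
move=> h; elim: n => [|n IH] x hx; first by rewrite derive1n0 h.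
rewrite derive1nS derive1E (@near_eq_derive R R R _ (horner P^`(n))).
  by rewrite -derive1E -derivE derivnS.
have oab : nbhs x `]a, b[%classic by apply: near_in_itvoo; rewrite in_itv.
by apply: filterS oab => y; rewrite /= in_itv /= => /IH.
Qed.

(** Valid at points where f is not derivable: there a nonzero multiple of f is not
derivable either, and both derivatives take the default value 0 of a divergent
limit. So partial derivatives of products factor on the mesh lines as well. *)
Lemma derive1_mulr f c x : derive1 (fun y => f y * c) x = derive1 f x * c.
Proof.
have [d|nd] := pselect (derivable f x 1); first exact: derive1Mr.
have [->|c0] := eqVneq c 0.
  rewrite mulr0; have -> : (fun y => f y * 0) = cst 0 by apply/funext => y; rewrite mulr0.
  by rewrite derive1_cst.
have nd' : ~ derivable (fun y => f y * c) x 1.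
  move=> d; apply: nd.
  have -> : f = (fun y => c^-1 * (f y * c)).
    by apply/funext => y; rewrite mulrCA mulVf ?mulr1.
  exact: (@derivableZ R R R (fun y => f y * c) c^-1 x 1).
by rewrite !derive1E /derive (dvgP nd) (dvgP nd') mul0r.
Qed.

(** The n-th derivatives are constant on either side, so they are their own
one-sided limits, and the point of evaluation 0 is immaterial. *)
Lemma jump_open f (P Q : {poly R}) n a d : 0 < d ->
  (forall x, a - d < x < a -> f x = P.[x]) ->
  (forall x, a < x < a + d -> f x = Q.[x]) ->
  (size P <= n.+1)%N -> (size Q <= n.+1)%N ->
  jump (derive1n n f) a = Q^`(n).[0] - P^`(n).[0].
Proof.
move=> d0 hP hQ sP sQ; rewrite /jump; congr (_ - _); apply: lim_near_cst.
- exact: Rhausdorff.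
- near=> x; rewrite (derive1n_open n hQ).
    by rewrite derivn_top // !hornerC.
  apply/andP; split; first by near: x; exact: nbhs_right_gt.
  by near: x; apply: nbhs_right_lt; lra.
- exact: Rhausdorff.
- near=> x; rewrite (derive1n_open n hP).
    by rewrite derivn_top // !hornerC.
  apply/andP; split; last by near: x; exact: nbhs_left_lt.
  by near: x; apply: nbhs_left_gt; lra.
Unshelve. all: by end_near. Qed.

End Derivatives.

Section CipForm.
Variable R : realType.
Variables (p : nat) (h : R).
Hypotheses (p0 : (0 < p)%N) (h0 : 0 < h).
Implicit Types (i j m n : int) (x y : R).
Notation mu := (@lebesgue_measure R).
Notation hat := (hat p h).
Notation cp := (cell_poly p h).
Notation lag := (lag R p).

Let hn0 : h != 0. Proof. by rewrite gt_eqF. Qed.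

Lemma cell_poly_affine i m :
  cp i m \Po (h *: 'X + (h * (m%:~R + 2^-1))%:P) = lag (i - m * p%:Z).
Proof.
rewrite /cell_poly -comp_polyA comp_polyB comp_polyZ comp_polyX comp_polyC.
rewrite scalerDr scalerA mulVf // scale1r -mul_polyC -polyCM mulrA mulVf // mul1r.
by rewrite addrK comp_polyXr.
Qed.

Lemma derivn_cell_poly (n : nat) i m : (cp i m)^`(n) =
  h^-1 ^+ n *: ((lag (i - m * p%:Z))^`(n) \Po (h^-1 *: 'X - (m%:~R + 2^-1)%:P)).
Proof.
elim: n => [|n IH]; first by rewrite expr0 scale1r.
rewrite derivnS IH derivZ deriv_comp derivB derivZ derivX derivC subr0 -derivnS.
by rewrite -scalerAr mulr1 scalerA exprSr.
Qed.

Lemma cell_poly_top i m : (cp i m)^`(p).[0] = h^-1 ^+ p * lag_top R p (i - m * p%:Z).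
Proof.
rewrite derivn_cell_poly hornerZ /lag_top derivn_top ?size_lag //.
by rewrite comp_polyC !hornerC.
Qed.

Lemma deriv_cell_poly_affine i m :
  (cp i m)^`() \Po (h *: 'X + (h * (m%:~R + 2^-1))%:P) =
  h^-1 *: (lag (i - m * p%:Z))^`().
Proof.
rewrite -cell_poly_affine [in RHS]deriv_comp derivD derivZ derivX derivC addr0.
by rewrite -scalerAr mulr1 scalerA mulVf // scale1r.
Qed.

Section OneDim.
Variable (a : int) (b : 'I_p).

Let lag_in m : m != -1 -> m != 0 -> lag (b%:Z - m * p%:Z) = 0.
Proof.
move=> m1 m0; apply: lag_out; have bp := ltn_ord b; apply/orP.
have [hm|hm] : m <= -2 \/ 1 <= m by lia.
  by right; nia.
by left; nia.
Qed.

Lemma hat_outside x : x < - h \/ h < x -> hat b x = 0.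
Proof.
have [m hm] := right_cell h0 x => hx; have /andP[h1 h2] := hm.
rewrite (@hat_cell R p h p0 h0 b m); last by rewrite h1 ltW.
rewrite /cell_poly lag_in ?comp_poly0 ?horner0 //.
  apply/eqP => e; move: h1 h2 hx; rewrite e; lra.
apply/eqP => e; move: h1 h2 hx; rewrite e; lra.
Qed.

Lemma derive_hat_outside x : x < - h \/ h < x -> derive1 (hat b) x = 0.
Proof.
have z y : (y < - h \/ h < y) -> hat b y = (0 : {poly R}).[y].
  by move=> hy; rewrite hat_outside // horner0.
case=> hx.
  have := @derive1n_open R (hat b) 0 (x - 1) (- h) 1.
  rewrite derive1n1 => ->; rewrite ?derivn1 ?linear0 ?horner0 //.
    by move=> y /andP[_ hy]; rewrite z; [rewrite horner0|left].
  by apply/andP; split => //; lra.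
have := @derive1n_open R (hat b) 0 h (x + 1) 1.
rewrite derive1n1 => ->; rewrite ?derivn1 ?linear0 ?horner0 //.
  by move=> y /andP[hy _]; rewrite z; [rewrite horner0|right].
by apply/andP; split => //; lra.
Qed.

Lemma derive_hat_open i m x : m%:~R * h < x < (m + 1)%:~R * h ->
  derive1 (hat i) x = (cp i m)^`().[x].
Proof.
move=> hx; have := @derive1n_open R (hat i) (cp i m) _ _ 1 _ x hx.
by rewrite derive1n1 derivn1; apply => y; exact: hat_open.
Qed.

Let two_cells (F : R -> R) (P Q : {poly R}) :
  (forall x, (-1)%:~R * h < x < (-1 + 1)%:~R * h -> F x = P.[x]) ->
  (forall x, 0%:~R * h < x < (0 + 1)%:~R * h -> F x = Q.[x]) ->
  (forall x, x < - h \/ h < x -> F x = 0) ->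
  mu.-integrable setT (EFin \o F) /\
  \int[mu]_x F x =
   h * (cellint (P \Po (h *: 'X + (h * ((-1)%:~R + 2^-1))%:P)) +
        cellint (Q \Po (h *: 'X + (h * (0%:~R + 2^-1))%:P))).
Proof.
move=> hP hQ hz.
have eN : (-1)%:~R * h = - h by rewrite mulN1r.
have e0 : (-1 + 1)%:~R * h = 0 by rewrite addNr mul0r.
have e0' : 0%:~R * h = 0 by rewrite mul0r.
have e1 : (0 + 1)%:~R * h = h by rewrite add0r mul1r.
have [||//|i e] := @two_cell_integral R F P Q h h0.
- by move=> x hx; apply: hP; rewrite eN e0.
- by move=> x hx; apply: hQ; rewrite e0' e1.
split => //; rewrite e mulrDr -!cell_Rintegral //.
by rewrite -!intrD1 ?eN ?e0 ?e0' ?e1; congr (_ + _); congr Rintegral; rewrite ?mulN1r ?addNr ?mul0r ?add0r ?mul1r.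
Qed.

Lemma hat_mass : mu.-integrable setT (EFin \o (fun x => hat a x * hat b x)) /\
  \int[mu]_x (hat a x * hat b x) = h * mass1 R p a b.
Proof.
have [|||i e] := two_cells (F := fun x => hat a x * hat b x)
   (P := cp a (-1) * cp b (-1)) (Q := cp a 0 * cp b 0).
- by move=> x hx; rewrite hornerM !(hat_open p0 h0 _ hx).
- by move=> x hx; rewrite hornerM !(hat_open p0 h0 _ hx).
- by move=> x hx; rewrite (hat_outside hx) mulr0.
split => //; rewrite e /mass1 !big_cons big_nil addr0.
by rewrite !comp_polyM !cell_poly_affine.
Qed.

Lemma hat_stiff :
  mu.-integrable setT (EFin \o (fun x => derive1 (hat a) x * derive1 (hat b) x)) /\
  \int[mu]_x (derive1 (hat a) x * derive1 (hat b) x) = h^-1 * stiff1 R p a b.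
Proof.
have [|||i e] := two_cells (F := fun x => derive1 (hat a) x * derive1 (hat b) x)
   (P := (cp a (-1))^`() * (cp b (-1))^`()) (Q := (cp a 0)^`() * (cp b 0)^`()).
- by move=> x hx; rewrite hornerM !(derive_hat_open _ hx).
- by move=> x hx; rewrite hornerM !(derive_hat_open _ hx).
- by move=> x hx; rewrite (derive_hat_outside hx) mulr0.
split => //; rewrite e /stiff1 !big_cons big_nil addr0.
rewrite !comp_polyM !deriv_cell_poly_affine -!scalerAl -!scalerAr !linearZ /=.
by field.
Qed.

Lemma hat_cell_mass n :
  \int[mu]_(y in mesh_interval h n) (hat a y * hat b y) =
  h * cellint (lag (a - n * p%:Z) * lag (b%:Z - n * p%:Z)).
Proof.
have -> : \int[mu]_(y in mesh_interval h n) (hat a y * hat b y) =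
    \int[mu]_(y in `[n%:~R * h, (n%:~R + 1) * h]) (cp a n * cp b n).[y].
  rewrite /mesh_interval intrD; apply: eq_Rintegral => y.
  rewrite inE /= in_itv /= => hy; rewrite hornerM !(@hat_cell R p h p0 h0 _ n) ?intrD //.
by rewrite cell_Rintegral // comp_polyM !cell_poly_affine.
Qed.

Lemma hat_cell_mass_out n : n != -1 -> n != 0 ->
  \int[mu]_(y in mesh_interval h n) (hat a y * hat b y) = 0.
Proof. by move=> n1 n2; rewrite hat_cell_mass lag_in // mulr0 linear0 mulr0. Qed.

Lemma lag_jump_out m : m \notin [:: -1; 0; 1] -> lag_jump R p b m = 0.
Proof.
rewrite !inE !negb_or => /and3P[m1 m2 m3]; rewrite /lag_jump /lag_top !lag_in ?subrr //.
all: apply/eqP; lia.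
Qed.

End OneDim.

Lemma jump_hat i c m : jump (derive1n p (fun x => hat i x * c)) (m%:~R * h) =
  h^-1 ^+ p * lag_jump R p i m * c.
Proof.
have sz k : (size (c *: cp i k) <= p.+1)%N.
  by rewrite (leq_trans (size_scale_leq _ _)) // size_cell_poly.
have e1 : (m - 1 + 1)%:~R * h = m%:~R * h by rewrite subrK.
have e2 : (m - 1)%:~R * h = m%:~R * h - h by rewrite intrB; ring.
have e3 : (m + 1)%:~R * h = m%:~R * h + h by rewrite intrD; ring.
rewrite (@jump_open R _ (c *: cp i (m - 1)) (c *: cp i m) p _ h) //.
- rewrite !derivnZ !hornerZ !cell_poly_top /lag_jump; ring.
- by move=> x hx; rewrite hornerZ mulrC (@hat_open R p h p0 h0 i (m - 1)) // e1 e2.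
- by move=> x hx; rewrite hornerZ mulrC (@hat_open R p h p0 h0 i m) // e3.
Qed.

End CipForm.

(** * The bilinear form on the nodal basis *)

Lemma fsbig_box (V : nmodType) (F : int * int -> V) (r1 r2 : seq int) : uniq r1 -> uniq r2 ->
  (forall m n, (m \notin r1) || (n \notin r2) -> F (m, n) = 0) ->
  \sum_(e \in [set: int * int]) F e = \sum_(m <- r1) \sum_(n <- r2) F (m, n).
Proof.
move=> u1 u2 hF; rewrite (@fsbigE _ _ _ _ _ [seq (m, n) | m <- r1, n <- r2]) //.
- under eq_bigl do rewrite in_setT.
  by rewrite big_allpairs.
- by apply: allpairs_uniq => // -[x y] [x' y'] _ _ /= [-> ->].
- move=> [m n] _ hmn; apply: hF; rewrite -negb_and; apply: contra hmn => /andP[x y].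
  by apply/allpairsP; exists (m, n).
Qed.

Section CipFormE.
Variable R : realType.
Variables (p : nat) (h : R).
Hypotheses (p0 : (0 < p)%N) (h0 : 0 < h).
Notation mu := (@lebesgue_measure R).
Variables (gamma k : R) (a b : int) (i j : 'I_p).
Notation hat := (hat p h).

Let hn0 : h != 0. Proof. by rewrite gt_eqF. Qed.

Lemma volume_term :
  \int[(mu \x mu)%E]_z
    (pderiv1 1 (hat2 p h a b) z * pderiv1 1 (hat2 p h i j) z
     + pderiv2 1 (hat2 p h a b) z * pderiv2 1 (hat2 p h i j) z
     - k ^+ 2 * hat2 p h a b z * hat2 p h i j z) =
  stiff1 R p a i * mass1 R p b j + mass1 R p a i * stiff1 R p b j
  - (k * h) ^+ 2 * mass1 R p a i * mass1 R p b j.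
Proof.
have [im1 m1] := hat_mass p0 h0 a i; have [im2 m2] := hat_mass p0 h0 b j.
have [is1 s1] := hat_stiff p0 h0 a i; have [is2 s2] := hat_stiff p0 h0 b j.
have [i1 e1] := Rintegral_prod is1 im2; have [i2 e2] := Rintegral_prod im1 is2.
have [i3 e3] := Rintegral_prod im1 im2.
set f1 := (fun z : R * R => _) in i1 e1.
set f2 := (fun z : R * R => _) in i2 e2.
set f3 := (fun z : R * R => _) in i3 e3.
have p1 u v (z : R * R) : pderiv1 1 (hat2 p h u v) z = derive1 (hat u) z.1 * hat v z.2.
  by rewrite /pderiv1 derive1n1 -derive1_mulr.
have p2 u v (z : R * R) : pderiv2 1 (hat2 p h u v) z = hat u z.1 * derive1 (hat v) z.2.
  rewrite /pderiv2 derive1n1.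
  have -> : (fun y => hat2 p h u v (z.1, y)) = (fun y => hat v y * hat u z.1).
    by apply/funext => y; exact: mulrC.
  by rewrite derive1_mulr [RHS]mulrC.
transitivity (\int[(mu \x mu)%E]_z (f1 z + f2 z - k ^+ 2 * f3 z)).
  apply: eq_Rintegral => z _; rewrite !p1 !p2 /f1 /f2 /f3 /hat2; ring.
have i4 : (mu \x mu)%E.-integrable setT (EFin \o (fun z => k ^+ 2 * f3 z)).
  exact: (@integrableZl _ _ _ _ setT measurableT (k ^+ 2) _ i3).
rewrite RintegralB //; last exact: (@integrableD _ _ _ _ setT measurableT _ _ i1 i2).
rewrite RintegralD // RintegralZl //.
rewrite e1 e2 e3 m1 m2 s1 s2.
by field.
Qed.

Lemma vertical_term (m n : int) :
  vertical_edge_term p h (hat2 p h a b) (hat2 p h i j) m n =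
  h^-1 ^+ p * h^-1 ^+ p * lag_jump R p a m * lag_jump R p i m *
  \int[mu]_(y in mesh_interval h n) (hat b y * hat j y).
Proof.
have im : mu.-integrable (mesh_interval h n) (EFin \o (fun y => hat b y * hat j y)).
  apply: integrableS (proj1 (hat_mass p0 h0 b j)) => //.
  exact: measurable_itv.
rewrite /vertical_edge_term -RintegralZl //; last exact: measurable_itv.
apply: eq_Rintegral => y _; rewrite /pderiv1 /hat2 /= !jump_hat //; ring.
Qed.

Lemma horizontal_term (m n : int) :
  horizontal_edge_term p h (hat2 p h a b) (hat2 p h i j) m n =
  h^-1 ^+ p * h^-1 ^+ p * lag_jump R p b n * lag_jump R p j n *
  \int[mu]_(y in mesh_interval h m) (hat a y * hat i y).
Proof.
have im : mu.-integrable (mesh_interval h m) (EFin \o (fun y => hat a y * hat i y)).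
  apply: integrableS (proj1 (hat_mass p0 h0 a i)) => //.
  exact: measurable_itv.
rewrite /horizontal_edge_term -RintegralZl //; last exact: measurable_itv.
have sw (u v : int) (x : R) : (fun y => pderiv2 p (hat2 p h u v) (x, y)) =
   derive1n p (fun y => hat v y * hat u x).
  rewrite /pderiv2 /hat2 /=; congr (derive1n _ _).
  by apply/funext => y; rewrite mulrC.
apply: eq_Rintegral => y _; rewrite !sw !jump_hat //; ring.
Qed.

(** The power of h in the penalty balances two derivatives of order p and the
length of an edge: no power of h survives in two dimensions. *)
Lemma penalty_scaling : h ^+ (2 * p).-1 * (h^-1 ^+ p * h^-1 ^+ p) * h = 1.
Proof.
have -> : h ^+ (2 * p).-1 * (h^-1 ^+ p * h^-1 ^+ p) * h =
   (h ^+ (2 * p).-1 * h) * (h^-1 ^+ p * h^-1 ^+ p) by ring.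
rewrite -exprSr prednK ?muln_gt0 // -exprD addnn -mul2n -exprMn mulfV // expr1n //.
Qed.

(** Both the volume terms and the edge terms are products of one-dimensional
quantities, by Fubini's theorem and because a jump across an edge concerns one
variable only. *)
Lemma cip_formE : cip_form p gamma k h (phi p h a b) (phi p h i j) =
  energy1 p gamma a i * mass1 R p b j + mass1 R p a i * energy1 p gamma b j
  - (k * h) ^+ 2 * mass1 R p a i * mass1 R p b j.
Proof.
rewrite /cip_form !phiE // volume_term.
transitivity (stiff1 R p a i * mass1 R p b j + mass1 R p a i * stiff1 R p b j
  - (k * h) ^+ 2 * mass1 R p a i * mass1 R p b j +
  (gamma * jump1 R p a i * mass1 R p b j + gamma * jump1 R p b j * mass1 R p a i));
  last by rewrite /energy1; ring.
congr (_ + (_ + _)).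
- rewrite (@fsbig_box R _ [:: -1; 0; 1] [:: -1; 0]) //; last first.
    move=> m n /orP[hm|hn]; rewrite vertical_term.
      by rewrite (lag_jump_out p0 h0 _ hm) mulr0 mul0r mulr0.
    rewrite !inE negb_or in hn; have /andP[n1 n2] := hn.
    by rewrite (hat_cell_mass_out p0 h0 _ _ n1 n2) !mulr0.
  rewrite /jump1 [gamma * \sum_(_ <- _) _]mulr_sumr mulr_suml; apply: eq_bigr => m _.
  rewrite /mass1 mulr_sumr; apply: eq_bigr => n _.
  rewrite vertical_term hat_cell_mass //= -[RHS]mul1r -penalty_scaling; ring.
- rewrite (@fsbig_box R _ [:: -1; 0] [:: -1; 0; 1]) //; last first.
    move=> m n /orP[hm|hn]; rewrite horizontal_term.
      rewrite !inE negb_or in hm; have /andP[n1 n2] := hm.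
      by rewrite (hat_cell_mass_out p0 h0 _ _ n1 n2) !mulr0.
    by rewrite (lag_jump_out p0 h0 _ hn) mulr0 mul0r mulr0.
  rewrite exchange_big /= /jump1 [gamma * \sum_(_ <- _) _]mulr_sumr mulr_suml; apply: eq_bigr => n _.
  rewrite /mass1 mulr_sumr; apply: eq_bigr => m _.
  rewrite horizontal_term hat_cell_mass //= -[RHS]mul1r -penalty_scaling; ring.
Qed.

End CipFormE.

(** * Kronecker structure of the Bloch matrix *)

Section BlochMatrix.
Variable R : realType.
Variables (p : nat) (gamma k h : R).
Hypotheses (p0 : (0 < p)%N) (h0 : 0 < h).
Local Notation C := (R[i]).
Local Notation toC := (real_complex R).

Definition bloch_energy_mx (t : R) : 'M[C]_p := \matrix_(b, i)
  \sum_(m <- shifts) expi (m%:~R * t) * toC (energy1 p gamma (i%:Z + m * p%:Z) b).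
Definition bloch_mass_mx (t : R) : 'M[C]_p := \matrix_(b, i)
  \sum_(m <- shifts) expi (m%:~R * t) * toC (mass1 R p (i%:Z + m * p%:Z) b).

Lemma bloch_matrixE kh theta :
  bloch_matrix p gamma k h kh theta =
  bloch_energy_mx (kh * cos theta * h) *t bloch_mass_mx (kh * sin theta * h)
  + bloch_mass_mx (kh * cos theta * h) *t bloch_energy_mx (kh * sin theta * h)
  - toC ((k * h) ^+ 2) *:
    (bloch_mass_mx (kh * cos theta * h) *t bloch_mass_mx (kh * sin theta * h)).
Proof.
set t1 := kh * cos theta * h; set t2 := kh * sin theta * h.
apply/matrixP => r s; rewrite !mxE.
case: (mxtens_unindex r) => i j; case: (mxtens_unindex s) => i' j'.
have eE (m n : int) : expi ((m%:~R * (kh * cos theta) + n%:~R * (kh * sin theta)) * h)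
   = expi (m%:~R * t1) * expi (n%:~R * t2).
  by rewrite -expiD; congr expi; rewrite /t1 /t2; ring.
rewrite /= (@fsbig_box C _ shifts shifts) //; last first.
  move=> m n hmn.
  rewrite /= cip_formE //.
  by case/orP: hmn => hm; rewrite (energy1_far p0 _ _ _ hm) (mass1_far _ p0 _ _ hm)
    !(mul0r, mulr0, subr0, addr0).
rewrite !mulr_suml mulr_sumr -!big_split -sumrB /=.
apply: eq_bigr => m _; rewrite !mulr_sumr -!big_split -sumrB /=.
apply: eq_bigr => n _; rewrite eE /= cip_formE //.
rewrite rmorphB rmorphD !rmorphM /=; ring.
Qed.

(** On the Kronecker product of the two one-dimensional eigenvectors the Bloch
matrix acts as l1 + l2 - (kh)^2 times the product of the mass matrices. *)
Lemma bloch_matrix_det kh theta l1 l2 (U1 U2 : 'I_p -> C) :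
  (exists i, U1 i != 0) -> (exists i, U2 i != 0) ->
  (forall b : 'I_p,
    \sum_(i < p) \sum_(m <- shifts)
       U1 i * expi (m%:~R * (kh * cos theta * h)) * toC (energy1 p gamma (i%:Z + m * p%:Z) b)
    = toC l1 * \sum_(i < p) \sum_(m <- shifts)
       U1 i * expi (m%:~R * (kh * cos theta * h)) * toC (mass1 R p (i%:Z + m * p%:Z) b)) ->
  (forall b : 'I_p,
    \sum_(i < p) \sum_(m <- shifts)
       U2 i * expi (m%:~R * (kh * sin theta * h)) * toC (energy1 p gamma (i%:Z + m * p%:Z) b)
    = toC l2 * \sum_(i < p) \sum_(m <- shifts)
       U2 i * expi (m%:~R * (kh * sin theta * h)) * toC (mass1 R p (i%:Z + m * p%:Z) b)) ->
  l1 + l2 = (k * h) ^+ 2 ->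
  discrete_wave_number p gamma k h theta kh.
Proof.
move=> [i1 n1] [i2 n2] h1 h2 e.
pose V1 : 'cV[C]_p := \col_i U1 i; pose V2 : 'cV[C]_p := \col_i U2 i.
have eig (t l : R) (U : 'I_p -> C) : (forall b : 'I_p,
    \sum_(i < p) \sum_(m <- shifts)
       U i * expi (m%:~R * t) * toC (energy1 p gamma (i%:Z + m * p%:Z) b)
    = toC l * \sum_(i < p) \sum_(m <- shifts)
       U i * expi (m%:~R * t) * toC (mass1 R p (i%:Z + m * p%:Z) b)) ->
    bloch_energy_mx t *m (\col_i U i) = toC l *: (bloch_mass_mx t *m (\col_i U i)).
  move=> hU; apply/matrixP => b z; rewrite !mxE.
  have tr (X : int -> R) : \sum_(i < p) (\sum_(m <- shifts) expi (m%:~R * t) * toC (X (i%:Z + m * p%:Z))) * U i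
    = \sum_(i < p) \sum_(m <- shifts) U i * expi (m%:~R * t) * toC (X (i%:Z + m * p%:Z)).
    by apply: eq_bigr => i _; rewrite mulr_suml; apply: eq_bigr => m _; ring.
  rewrite (eq_bigr (fun i : 'I_p => (\sum_(m <- shifts) expi (m%:~R * t) *
     toC (energy1 p gamma (i%:Z + m * p%:Z) b)) * U i)); last by move=> i _; rewrite !mxE.
  rewrite (tr (fun a => energy1 p gamma a b)) hU -(tr (fun a => mass1 R p a b)).
  by congr (_ * _); apply: eq_bigr => i _; rewrite !mxE.
have E1 := eig _ _ _ h1; have E2 := eig _ _ _ h2.
have null : bloch_matrix p gamma k h kh theta *m (V1 *t V2) = 0.
  rewrite bloch_matrixE mulmxBl mulmxDl -scalemxAl !tensmx_mul E1 E2.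
  rewrite -/V1 -/V2; set A := bloch_mass_mx _ *m V1; set B := bloch_mass_mx _ *m V2.
  apply/matrixP => x y; rewrite !mxE -e rmorphD /=; ring.
rewrite /discrete_wave_number -det_tr; apply/eqP/det0P.
exists ((V1 *t V2)^T); last by rewrite -trmx_mul null trmx0.
apply/eqP => /matrixP /(_ 0 (mxtens_index (i1, i2))); rewrite !mxE mxtens_indexK /=.
by move/eqP; rewrite mulf_eq0 (negbTE n1) (negbTE n2).
Qed.

End BlochMatrix.

(** * Solving for the discrete wave number *)

Lemma double_exponent_le p : (0 < p)%N -> (p.*2.+4 <= p.*2.+1 + p.*2.+1)%N.
Proof. lia. Qed.

Section PhaseError.
Variable R : realType.
Implicit Types (x tau theta : R).

Lemma exprn_diff n x y M : 0 <= x <= M -> 0 <= y <= M ->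
  `|y ^+ n.+1 - x ^+ n.+1| <= n.+1%:R * M ^+ n * `|y - x|.
Proof.
move=> /andP[x0 xM] /andP[y0 yM]; have M0 := le_trans x0 xM.
elim: n => [|n IH]; first by rewrite !expr1 expr0 !mul1r.
have -> : y ^+ n.+2 - x ^+ n.+2 = y * (y ^+ n.+1 - x ^+ n.+1) + x ^+ n.+1 * (y - x).
  by rewrite !exprS; ring.
rewrite (le_trans (ler_normD _ _)) // !normrM (ger0_norm y0).
rewrite (ger0_norm (exprn_ge0 _ x0)).
have h1 : y * `|y ^+ n.+1 - x ^+ n.+1| <= M * (n.+1%:R * M ^+ n * `|y - x|) by rewrite ler_pM.
have h2 : x ^+ n.+1 * `|y - x| <= M ^+ n.+1 * `|y - x|.
  by rewrite ler_wpM2r // lerXn2r ?nnegrE.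
have -> : n.+2%:R * M ^+ n.+1 * `|y - x| =
   M * (n.+1%:R * M ^+ n * `|y - x|) + M ^+ n.+1 * `|y - x|.
  by rewrite -[n.+2%:R]natr1 exprS; ring.
exact: lerD.
Qed.

Definition trig_weight p theta : R := cos theta ^+ p.*2.+2 + sin theta ^+ p.*2.+2.

Lemma trig_weight_bound p theta : 0 <= trig_weight p theta <= 1.
Proof.
have ev n (u : R) : u ^+ n.*2 = (u ^+ 2) ^+ n by rewrite -exprM mul2n.
rewrite /trig_weight -doubleS !ev addr_ge0 ?(exprn_ge0 _ (sqr_ge0 _)) //=.
have c1 : cos theta ^+ 2 <= 1 by have := cos2Dsin2 theta; have := sqr_ge0 (sin theta); lra.
have s1 : sin theta ^+ 2 <= 1 by have := cos2Dsin2 theta; have := sqr_ge0 (cos theta); lra.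
have le_pow (u : R) : 0 <= u -> u <= 1 -> u ^+ p.+1 <= u.
  by move=> u0 u1; rewrite exprS -[leRHS]mulr1 ler_wpM2l // exprn_ile1.
have := le_pow _ (sqr_ge0 _) c1; have := le_pow _ (sqr_ge0 _) s1.
by have := cos2Dsin2 theta; lra.
Qed.

Lemma trig_weight0 p : trig_weight p 0 = 1.
Proof. by rewrite /trig_weight cos0 sin0 expr1n exprS mul0r addr0. Qed.

Section Solve.
Variables (p : nat) (c K t0 : R) (Lam : R -> R).
Hypotheses (p0 : (0 < p)%N) (t00 : 0 < t0) (K0 : 0 <= K).
Hypothesis Lam_lip : forall t t', `|t| <= t0 -> `|t'| <= t0 ->
  `|Lam t - Lam t'| <= K * `|t - t'|.
Hypothesis Lam_exp : forall t, `|t| <= t0 ->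
  `|Lam t - (t ^+ 2 + c * t ^+ p.*2.+2)| <= K * `|t| ^+ p.*2.+4.

Let L2 theta tau := Lam (tau * cos theta) + Lam (tau * sin theta).

Let abs_tau_le theta tau : 0 <= tau -> `|tau * cos theta| <= tau /\ `|tau * sin theta| <= tau.
Proof.
move=> h; rewrite !normrM (ger0_norm h); split; rewrite -[leRHS]mulr1 ler_wpM2l //.
  exact: cos_max.
exact: sin_max.
Qed.

Lemma L2_exp theta tau : 0 <= tau <= t0 ->
  `|L2 theta tau - (tau ^+ 2 + c * trig_weight p theta * tau ^+ p.*2.+2)|
  <= 2 * K * tau ^+ p.*2.+4.
Proof.
move=> /andP[h0 h1]; have [hc hs] := abs_tau_le theta h0.
have hc' := le_trans hc h1; have hs' := le_trans hs h1.
have e1 := Lam_exp hc'; have e2 := Lam_exp hs'.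
have b1 : K * `|tau * cos theta| ^+ p.*2.+4 <= K * tau ^+ p.*2.+4.
  by rewrite ler_wpM2l // lerXn2r ?nnegrE.
have b2 : K * `|tau * sin theta| ^+ p.*2.+4 <= K * tau ^+ p.*2.+4.
  by rewrite ler_wpM2l // lerXn2r ?nnegrE.
have -> : L2 theta tau - (tau ^+ 2 + c * trig_weight p theta * tau ^+ p.*2.+2) =
   (Lam (tau * cos theta) - ((tau * cos theta) ^+ 2 + c * (tau * cos theta) ^+ p.*2.+2)) +
   (Lam (tau * sin theta) - ((tau * sin theta) ^+ 2 + c * (tau * sin theta) ^+ p.*2.+2)).
  rewrite /L2 /trig_weight !(exprMn _ tau) -[tau ^+ 2 in LHS]mulr1 -(cos2Dsin2 theta).
  move: (tau ^+ _) (cos theta ^+ p.*2.+2) (sin theta ^+ p.*2.+2) => T C S; ring.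
rewrite (le_trans (ler_normD _ _)) //.
have := le_trans e1 b1; have := le_trans e2 b2; lra.
Qed.

Lemma L2_continuous theta a b : 0 <= a -> b <= t0 ->
  {within `[a, b], continuous (L2 theta)}.
Proof.
move=> a0 bt; apply: (@lipschitz_within_continuous _ _ (2 * K)) => x y /andP[ax xb] /andP[ay yb].
have x0 := le_trans a0 ax; have y0 := le_trans a0 ay.
have [c1 s1] := abs_tau_le theta x0; have [c2 s2] := abs_tau_le theta y0.
have xt := le_trans xb bt; have yt := le_trans yb bt.
have e1 := Lam_lip (le_trans c1 xt) (le_trans c2 yt).
have e2 := Lam_lip (le_trans s1 xt) (le_trans s2 yt).
rewrite -!mulrBl !normrM in e1 e2.
have f1 : K * (`|x - y| * `|cos theta|) <= K * `|x - y|.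
  by rewrite ler_wpM2l // -[leRHS]mulr1 ler_wpM2l // cos_max.
have f2 : K * (`|x - y| * `|sin theta|) <= K * `|x - y|.
  by rewrite ler_wpM2l // -[leRHS]mulr1 ler_wpM2l // sin_max.
rewrite /L2 opprD addrACA (le_trans (ler_normD _ _)) //; lra.
Qed.

Let A := `|c| + 2 * K.

(** In this range L2 theta tau is tau^2 up to a relative error 1/2, so it is below
x^2 at x/2 and above x^2 at 2x. *)
Lemma solve_tau theta x : 0 < x -> 2 * x <= t0 -> 2 * x <= 1 -> 4 * A * x <= 1 ->
  exists tau, x / 2 <= tau <= 2 * x /\ L2 theta tau = x ^+ 2.
Proof.
move=> x0 xt x1 xA.
have A0 : 0 <= A by rewrite /A addr_ge0 // mulr_ge0.
have near_sq tau : 0 <= tau <= 2 * x -> `|L2 theta tau - tau ^+ 2| <= 2^-1 * tau ^+ 2.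
  move=> /andP[t0' t2]; have tt := le_trans t2 xt; have t1 := le_trans t2 x1.
  have := @L2_exp theta tau; rewrite t0' tt => /(_ isT) e.
  have /andP[g0 g1] := trig_weight_bound p theta.
  have T0 : 0 <= tau ^+ p.*2.+2 by exact: exprn_ge0.
  have c1 : `|c * trig_weight p theta * tau ^+ p.*2.+2| <= `|c| * tau ^+ p.*2.+2.
    rewrite normrM (normrM c) (ger0_norm T0) (ger0_norm g0) ler_wpM2r //.
    by rewrite -[leRHS]mulr1 ler_wpM2l.
  have T4 : tau ^+ p.*2.+4 <= tau ^+ p.*2.+2 by rewrite ler_wiXn2l // ltnW.
  have T3 : tau ^+ p.*2.+2 <= tau ^+ 2 * tau.
    have -> : tau ^+ 2 * tau = tau ^+ 3 by rewrite [RHS]exprSr.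
    have n3 : (3 <= p.*2.+2)%N by case: (p) p0.
    exact: (ler_wiXn2l t0' t1 n3).
  have k1 : 2 * K * tau ^+ p.*2.+4 <= 2 * K * tau ^+ p.*2.+2 by rewrite ler_wpM2l // mulr_ge0.
  have k2 : A * tau ^+ p.*2.+2 <= A * (tau ^+ 2 * tau) by rewrite ler_wpM2l.
  have k3 : A * tau <= 2^-1.
    have : A * tau <= A * (2 * x) by rewrite ler_wpM2l.
    lra.
  have k4 : A * (tau ^+ 2 * tau) <= 2^-1 * tau ^+ 2.
    by rewrite mulrCA mulrC ler_wpM2r // sqr_ge0.
  have -> : L2 theta tau - tau ^+ 2 =
    (L2 theta tau - (tau ^+ 2 + c * trig_weight p theta * tau ^+ p.*2.+2)) +
    c * trig_weight p theta * tau ^+ p.*2.+2 by ring.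
  rewrite (le_trans (ler_normD _ _)) //.
  have : A * tau ^+ p.*2.+2 = `|c| * tau ^+ p.*2.+2 + 2 * K * tau ^+ p.*2.+2 by rewrite /A; ring.
  lra.
have hx : x / 2 <= 2 * x by lra.
have cf := @L2_continuous theta (x / 2) (2 * x) _ xt.
have cf' := cf (ltW (divr_gt0 x0 (ltr0n _ 2))).
have l1 := near_sq (x / 2); have l2 := near_sq (2 * x).
have {}l1 : `|L2 theta (x / 2) - (x / 2) ^+ 2| <= 2^-1 * (x / 2) ^+ 2 by apply: l1; lra.
have {}l2 : `|L2 theta (2 * x) - (2 * x) ^+ 2| <= 2^-1 * (2 * x) ^+ 2 by apply: l2; lra.
have xx : 0 < x ^+ 2 by rewrite exprn_gt0.
have m1 : L2 theta (x / 2) <= x ^+ 2.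
  move: l1; rewrite ler_norml => /andP[_]; rewrite exprMn.
  have -> : 2^-1 ^+ 2 = 4^-1 :> R by field.
  lra.
have m2 : x ^+ 2 <= L2 theta (2 * x).
  move: l2; rewrite ler_norml => /andP[+ _]; rewrite exprMn.
  have -> : 2 ^+ 2 = 4 :> R by ring.
  lra.
have [|tau ht e] := IVT hx cf' (v := x ^+ 2).
  by rewrite ge_min le_max m1 m2 orbT.
by exists tau; split => //; move: ht; rewrite in_itv.
Qed.

(** Factor x^2 - tau^2 as (x + tau) (x - tau). Since x + tau >= x, the expansion of
L2 yields x - tau = O(x^(2p+1)); with this, tau may be replaced by x in the
leading term and in the factor x + tau. *)
Lemma tau_expansion : exists2 K' : R, 0 <= K' & forall theta x tau,
  0 < x -> 2 * x <= t0 -> 2 * x <= 1 -> x / 2 <= tau <= 2 * x ->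
  L2 theta tau = x ^+ 2 ->
  `|x - tau - c / 2 * trig_weight p theta * x ^+ p.*2.+1| <= K' * x ^+ p.*2.+3.
Proof.
pose A1 := A * 2 ^+ p.*2.+2.
pose B := p.*2.+2%:R * 2 ^+ p.*2.+1 + 1 : R.
have A0 : 0 <= A by rewrite /A addr_ge0 // mulr_ge0.
have A10 : 0 <= A1 by rewrite mulr_ge0 // exprn_ge0.
have B0 : 0 <= B by rewrite addr_ge0 // mulr_ge0 // exprn_ge0.
exists (`|c| * B * A1 + 2 * K * 2 ^+ p.*2.+4).
  apply: addr_ge0; first exact: (mulr_ge0 (mulr_ge0 (normr_ge0 c) B0) A10).
  by rewrite mulr_ge0 ?exprn_ge0 // mulr_ge0.
move=> theta x tau x0 xt x1 /andP[ht1 ht2] e.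
have tau0 : 0 <= tau by lra.
have tt := le_trans ht2 xt; have t1 := le_trans ht2 x1.
have x2 : 0 <= 2 * x by lra.
have := @L2_exp theta tau; rewrite tau0 tt e => /(_ isT) e1.
have /andP[g0 g1] := trig_weight_bound p theta.
set g := trig_weight p theta in e1 g0 g1 *.
set rho := x ^+ 2 - (tau ^+ 2 + c * g * tau ^+ p.*2.+2) in e1.
have sq : (x + tau) * (x - tau) = c * g * tau ^+ p.*2.+2 + rho by rewrite /rho; ring.
have T2 : tau ^+ p.*2.+2 <= 2 ^+ p.*2.+2 * x ^+ p.*2.+2.
  by rewrite -exprMn lerXn2r ?nnegrE.
have T4 : tau ^+ p.*2.+4 <= 2 ^+ p.*2.+4 * x ^+ p.*2.+4.
  by rewrite -exprMn lerXn2r ?nnegrE.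
have T42 : tau ^+ p.*2.+4 <= tau ^+ p.*2.+2 by rewrite ler_wiXn2l // ltnW.
have Tp : 0 <= tau ^+ p.*2.+2 by exact: exprn_ge0.
have sum_lb (y : R) (Y : R) : `|(x + tau) * y| <= x * Y -> `|y| <= Y.
  rewrite normrM (ger0_norm (_ : 0 <= x + tau)); last lra.
  move=> hy; rewrite -(ler_pM2l x0) (le_trans _ hy) // ler_wpM2r //; lra.
have d1 : `|x - tau| <= A1 * x ^+ p.*2.+1.
  apply: sum_lb; rewrite sq (le_trans (ler_normD _ _)) //.
  have c1 : `|c * g * tau ^+ p.*2.+2| <= `|c| * tau ^+ p.*2.+2.
    rewrite normrM (normrM c) (ger0_norm Tp) (ger0_norm g0) ler_wpM2r //.
    by rewrite -[leRHS]mulr1 ler_wpM2l.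
  have k1 : 2 * K * tau ^+ p.*2.+4 <= 2 * K * tau ^+ p.*2.+2 by rewrite ler_wpM2l // mulr_ge0.
  have k2 : A * tau ^+ p.*2.+2 <= A * (2 ^+ p.*2.+2 * x ^+ p.*2.+2) by rewrite ler_wpM2l.
  have k3 : x * (A1 * x ^+ p.*2.+1) = A * (2 ^+ p.*2.+2 * x ^+ p.*2.+2).
    by rewrite /A1 (exprS x p.*2.+1); ring.
  have k4 : A * tau ^+ p.*2.+2 = `|c| * tau ^+ p.*2.+2 + 2 * K * tau ^+ p.*2.+2 by rewrite /A; ring.
  rewrite k3; lra.
apply: sum_lb.
have X1 : x <= 1 by lra.
have -> : (x + tau) * (x - tau - c / 2 * g * x ^+ p.*2.+1) =
    c * g * ((tau ^+ p.*2.+2 - x ^+ p.*2.+2) + x ^+ p.*2.+1 / 2 * (x - tau)) + rho.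
  by rewrite mulrBr sq (exprS x p.*2.+1); field.
rewrite (le_trans (ler_normD _ _)) //.
have -> : x * ((`|c| * B * A1 + 2 * K * 2 ^+ p.*2.+4) * x ^+ p.*2.+3) =
  `|c| * B * A1 * x ^+ p.*2.+4 + 2 * K * (2 ^+ p.*2.+4 * x ^+ p.*2.+4).
  by rewrite (exprS x p.*2.+3); ring.
apply: lerD; last by rewrite (le_trans e1) // ler_wpM2l // mulr_ge0.
have d2 : `|tau ^+ p.*2.+2 - x ^+ p.*2.+2| <= p.*2.+2%:R * (2 * x) ^+ p.*2.+1 * `|x - tau|.
  by rewrite distrC (distrC x) -[`|tau - x|]normrN opprB; rewrite (distrC _ (tau ^+ _)) distrC;
     apply: exprn_diff; lra.
have X0 : 0 <= x ^+ p.*2.+1 by rewrite exprn_ge0 // ltW.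
have d3 : `|x ^+ p.*2.+1 / 2 * (x - tau)| <= x ^+ p.*2.+1 * `|x - tau|.
  rewrite normrM ger0_norm; last by lra.
  by rewrite ler_wpM2r //; lra.
have d4 : `|tau ^+ p.*2.+2 - x ^+ p.*2.+2 + x ^+ p.*2.+1 / 2 * (x - tau)| <=
    B * x ^+ p.*2.+1 * `|x - tau|.
  rewrite (le_trans (ler_normD _ _)) // /B.
  have -> : (p.*2.+2%:R * 2 ^+ p.*2.+1 + 1) * x ^+ p.*2.+1 * `|x - tau| =
     p.*2.+2%:R * (2 * x) ^+ p.*2.+1 * `|x - tau| + x ^+ p.*2.+1 * `|x - tau|.
    by rewrite exprMn; ring.
  exact: lerD.
have d5 : B * x ^+ p.*2.+1 * `|x - tau| <= B * A1 * x ^+ p.*2.+4.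
  have s1 : x ^+ p.*2.+1 * x ^+ p.*2.+1 <= x ^+ p.*2.+4.
    by rewrite -exprD; exact: (ler_wiXn2l (ltW x0) X1 (double_exponent_le p0)).
  rewrite -(mulrA B) -(mulrA B); apply: (ler_wpM2l B0).
  apply: le_trans (ler_wpM2l X0 d1) _.
  by rewrite [leLHS]mulrCA; exact: (ler_wpM2l A10 s1).
rewrite normrM (normrM c) (ger0_norm g0).
rewrite -(mulrA `|c|) -(mulrA `|c|) -(mulrA `|c|); apply: (ler_wpM2l (normr_ge0 c)).
rewrite -[leRHS]mul1r; apply: ler_pM => //; exact: le_trans d4 d5.
Qed.

End Solve.
End PhaseError.

(** The main term a * g theta is largest in modulus at theta = 0, where g = 1. *)
Lemma phase_difference_bound (R : realType) (k : R) (kh g : R -> R) (a e : R) :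
  0 <= e -> (forall theta, 0 <= g theta <= 1) -> g 0 = 1 ->
  (forall theta, `|k - kh theta - a * g theta| <= e) ->
  (`|phase_difference k kh - `|a|%:E| <= e%:E)%E.
Proof.
move=> e0 hg g0 h.
have up : (phase_difference k kh <= (`|a| + e)%:E)%E.
  apply: ge_ereal_sup => _ [theta _ <-]; rewrite lee_fin.
  have /andP[t0 t1] := hg theta; have := h theta.
  have : `|a * g theta| <= `|a|.
    by rewrite normrM (ger0_norm t0) -[leRHS]mulr1 ler_wpM2l.
  have := ler_normD (k - kh theta - a * g theta) (a * g theta).
  rewrite subrK; lra.
have lo : ((`|a| - e)%:E <= phase_difference k kh)%E.
  apply: le_trans (_ : (`|k - kh 0|%:E <= _)%E); last first.
    by apply: ereal_sup_ubound; exists 0.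
  rewrite lee_fin; have := h 0; rewrite g0 mulr1.
  have := ler_normD (a - (k - kh 0)) (k - kh 0); rewrite subrK distrC; lra.
have fS : phase_difference k kh \is a fin_num.
  rewrite fin_numElt; apply/andP; split.
    by apply: lt_le_trans lo; rewrite ltNyr.
  by apply: le_lt_trans up _; rewrite ltry.
move: up lo; rewrite -(fineK fS) !lee_fin => up lo.
rewrite ler_norml; lra.
Qed.

Theorem theorem4p1 (R : realType) (p : nat) (hp : (1 <= p)%N) (gamma : R) :
  exists C0 : R, 0 < C0 /\
  exists C : R, forall k h : R, 0 < k -> 0 < h -> k * h / p%:R <= C0 ->
  exists kh : R -> R,
    [/\ forall theta : R,
          0 < kh theta /\ discrete_wave_number p gamma k h theta (kh theta),
        (`|phase_difference k kh
           - (2^-1 * `|fem_phase_coef R p + gamma|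
              * k ^+ (2 * p + 1) * h ^+ (2 * p))%:E|
         <= (C * k ^+ (2 * p + 3) * h ^+ (2 * p + 2))%:E)%E
      & gamma = - fem_phase_coef R p ->
        (phase_difference k kh
         <= (C * k ^+ (2 * p + 3) * h ^+ (2 * p + 2))%:E)%E].
Proof.
have [Lam [t0 [K [t00 K0 Lmode Llip Lexp]]]] := dispersion_relation hp gamma.
set c := fem_phase_coef R p + gamma in Lexp *.
have [K' K'0 hexp] := tau_expansion hp K0 Lexp.
pose A := `|c| + 2 * K.
have A0 : 0 <= A by rewrite addr_ge0 // mulr_ge0.
(* The first bound keeps 2 x in the domain of the expansion, the second makes the
   deviation of Lam from t^2 relatively small, as [solve_tau] demands. *)
pose x0 := Num.min (t0 / 2) (4 * (A + 1))^-1.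
have x00 : 0 < x0 by rewrite lt_min divr_gt0 //= invr_gt0; lra.
have p0 : 0 < p%:R :> R by rewrite ltr0n.
exists (x0 / p%:R); split; first by rewrite divr_gt0.
exists K' => k h k0 h0; rewrite ler_pM2r ?invr_gt0 // => khx.
set x := k * h in khx.
have xpos : 0 < x by rewrite mulr_gt0.
have xt : 2 * x <= t0.
  by move: khx; rewrite /x0 le_min => /andP[+ _]; lra.
have xA' : x * (4 * (A + 1)) <= 1.
  move: khx; rewrite /x0 le_min => /andP[_]; rewrite -[_^-1]mul1r ler_pdivlMr //; lra.
have xA4 : x * A * 4 + x * 4 <= 1 by move: xA'; rewrite (_ : x * (4 * (A + 1)) = x * A * 4 + x * 4) //; ring.
have xA0 : 0 <= x * A by rewrite mulr_ge0 // ltW.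
have x1 : 2 * x <= 1 by lra.
have xA : 4 * A * x <= 1 by rewrite (_ : 4 * A * x = x * A * 4); [lra|ring].
have sol theta : exists tau, x / 2 <= tau <= 2 * x /\
    Lam (tau * cos theta) + Lam (tau * sin theta) = x ^+ 2.
  exact: (solve_tau hp K0 Llip Lexp _ xpos xt x1 xA).
have [tau htau] := choice sol.
pose kh theta := tau theta / h.
have hn : h != 0 by rewrite gt_eqF.
have khh theta : kh theta * h = tau theta by rewrite /kh divfK.
have err theta : `|k - kh theta - c / 2 * k ^+ (2 * p + 1) * h ^+ (2 * p) * trig_weight p theta|
    <= K' * k ^+ (2 * p + 3) * h ^+ (2 * p + 2).
  have [h1 h2] := htau theta; have := hexp theta x (tau theta) xpos xt x1 h1 h2.
  rewrite mul2n addn1 addn2 addn3 => e.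
  rewrite -(ler_pM2r h0) -{2}(ger0_norm (ltW h0)) -normrM.
  have -> : (k - kh theta - c / 2 * k ^+ p.*2.+1 * h ^+ p.*2 * trig_weight p theta) * h =
      x - tau theta - c / 2 * trig_weight p theta * x ^+ p.*2.+1.
    by rewrite -khh /x exprMn (exprSr h p.*2); ring.
  have -> : K' * k ^+ p.*2.+3 * h ^+ p.*2.+2 * h = K' * x ^+ p.*2.+3.
    by rewrite /x exprMn (exprSr h p.*2.+2); ring.
  exact: e.
have E0 : 0 <= K' * k ^+ (2 * p + 3) * h ^+ (2 * p + 2).
  by rewrite !mulr_ge0 // exprn_ge0 // ltW.
have main : (`|phase_difference k kh
    - (2^-1 * `|c| * k ^+ (2 * p + 1) * h ^+ (2 * p))%:E|
    <= (K' * k ^+ (2 * p + 3) * h ^+ (2 * p + 2))%:E)%E.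
  have -> : 2^-1 * `|c| * k ^+ (2 * p + 1) * h ^+ (2 * p) =
     `|c / 2 * k ^+ (2 * p + 1) * h ^+ (2 * p)|.
    rewrite normrM (normrM (c / 2)) (normrM c) (ger0_norm (_ : 0 <= 2^-1)) ?invr_ge0 //.
    by rewrite (ger0_norm (exprn_ge0 _ (ltW k0))) (ger0_norm (exprn_ge0 _ (ltW h0))) (mulrC 2^-1).
  exact: (phase_difference_bound E0 (trig_weight_bound p) (trig_weight0 R p) err).
exists kh; split => //.
- move=> theta; have [/andP[h1 h2] h3] := htau theta.
  have tau0 : 0 < tau theta by lra.
  split; first by rewrite divr_gt0.
  have abs1 : `|tau theta * cos theta| <= t0.
    rewrite normrM gtr0_norm // (@le_trans _ _ (tau theta)) ?(le_trans h2) //.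
    by rewrite -[leRHS]mulr1 ler_wpM2l ?cos_max // ltW.
  have abs2 : `|tau theta * sin theta| <= t0.
    rewrite normrM gtr0_norm // (@le_trans _ _ (tau theta)) ?(le_trans h2) //.
    by rewrite -[leRHS]mulr1 ler_wpM2l ?sin_max // ltW.
  have [b1 e1 o1] := Lmode _ abs1; have [b2 e2 o2] := Lmode _ abs2.
  have [U1 [n1 k1]] := bloch_vector hp b1 e1 o1.
  have [U2 [n2 k2]] := bloch_vector hp b2 e2 o2.
  have q1 : kh theta * cos theta * h = tau theta * cos theta by rewrite mulrAC khh.
  have q2 : kh theta * sin theta * h = tau theta * sin theta by rewrite mulrAC khh.
  by apply: (@bloch_matrix_det R p gamma k h hp h0 (kh theta) theta _ _ U1 U2 n1 n2 _ _ h3);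
    rewrite ?q1 ?q2.
- move=> g0; have c0 : c = 0 by rewrite /c g0 subrr.
  move: main; rewrite c0 normr0 mulr0 !mul0r sube0 => main.
  by apply: le_trans main; exact: lee_abs.
Qed.
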